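(* Under the semilinear assumptions (S1)-(S4) listed in the context, the system $$w_t(x,t)=\Lambda(x)w_x(x,t)+F(x,w(x,t)),\quad \dot X(t)=f^0(X(t),v(0,t),t),\quad u(0,t)=g^0(X(t),v(0,t),t),\quad v(1,t)=U(t),$$ $w(\cdot,0)=w_0$, $X(0)=X_0$, in closed loop with the state feedback $U(t)$ constructed at each time $t\ge0$ from $(w(\cdot,t),X(t))$ by the semilinear control algorithm described in the context, has a globally asymptotically stable equilibrium at the origin $(w,X)=(0,0)$.
   Context: Notation: $w(x,t)=(u(x,t),v(x,t))^T\in\mathbb{R}^2$ for $x\in[0,1]$, $t\ge0$; $X(t)\in\mathbb{R}^n$; $w_0=(u_0,v_0)^T\in L^\infty([0,1];\mathbb{R}^2)$, $X_0\in\mathbb{R}^n$; $U$ is the control input; $\Lambda(x)=\mathrm{diag}(-\lambda^u(x),\lambda^v(x))$, $\lambda^u,\lambda^v>0$; $F=(f^u,f^v)^T$. Solutions are broad solutions in $L^\infty$, i.e. solutions of the integral equations obtained by integrating the PDE along its characteristic lines. Semilinear assumptions: (S1) $\Lambda$ does not depend on $w$, and $\sup_{x\in[0,1]}\max\{(\lambda^u(x))^{-1},(\lambda^v(x))^{-1}\}\le l_{\Lambda^{-1}}<\infty$. (S2) $F,f^0,g^0$ are globally Lipschitz in the state arguments: $\partial_wF(x,w)$ is essentially bounded over $x\in[0,1]$, $w\in\mathbb{R}^2$, and $\partial_Xf^0,\partial_vf^0,\partial_Xg^0,\partial_vg^0$ (at $(X,v,t)$) are essentially bounded over $X\in\mathbb{R}^n,v\in\mathbb{R},t\ge0$.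 (S3) $F(x,0)=0$ for all $x\in[0,1]$, and $f^0(0,0,t)=0$, $g^0(0,0,t)=0$ for all $t\ge0$. (S4) $K(X,t)$ is a given real-valued function with $\partial_XK$ essentially bounded over $X\in\mathbb{R}^n,t\ge0$, $K(0,t)=0$ for all $t\ge0$, and such that the ODE $\dot X(t)=f^0(X(t),K(X(t),t),t)$ has a globally asymptotically stable equilibrium at the origin. Characteristic times and determinate set: $\tau^v(t;x)=t+\int_x^1\frac{1}{\lambda^v(\xi)}d\xi$, and $\mathcal{D}(t)=\{(x,s):x\in[0,1],\,s\in[t,\tau^v(t;x)]\}$. Semilinear control algorithm. Given the state $(w(\cdot,t),X(t))$ at time $t$: Step 1 (prediction): solve, over $\mathcal{D}(t)$, the system $\bar w_t(x,s)=\Lambda(x)\bar w_x(x,s)+F(x,\bar w(x,s))$, $\dot{\bar X}(s)=f^0(\bar X(s),\bar v(0,s),s)$, $\bar u(0,s)=g^0(\bar X(s),\bar v(0,s),s)$, with $\bar w(\cdot,t)=w(\cdot,t)$, $\bar X(t)=X(t)$ (and no boundary condition at $x=1$), where $\bar w=(\bar u,\bar v)^T$. The solution $\bar u$ on $\mathcal{D}(t)$ and $\bar X$ on $[t,\tau^v(t;0)]$ is uniquely determined, independently of the input; this gives $\bar u(x,\tau^v(t;x))$, $x\in[0,1]$, and $\bar X(\tau^v(t;0))$. Step 2: set $U^*(\tau^v(t;0))=K(\bar X(\tau^v(t;0)),\tau^v(t;0))$. Step 3: solve the ODE in $x\in[0,1]$ $$\frac{d}{dx}\bar v^*(x,\tau^v(t;x))=-\frac{f^v\big(x,(\bar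 u(x,\tau^v(t;x)),\bar v^*(x,\tau^v(t;x)))\big)}{\lambda^v(x)},\qquad \bar v^*(0,\tau^v(t;0))=U^*(\tau^v(t;0)),$$ and set $U(t)=\bar v^*(1,\tau^v(t;1))$ (note $\tau^v(t;1)=t$). Stability and convergence of $(w(\cdot,t),X(t))$ are understood in the supremum norm $\|w(\cdot,t)\|_\infty$, $\|X(t)\|_\infty$, with initial data given at $t=0$. *)

(* Defs.v *)
From HB Require Import structures.
From mathcomp Require Import all_boot all_order all_algebra.
From mathcomp Require Import all_classical all_reals all_analysis.

Set Implicit Arguments.
Unset Strict Implicit.
Unset Printing Implicit Defensive.

Import Order.TTheory GRing.Theory Num.Theory.
Import numFieldNormedType.Exports.

Local Open Scope classical_set_scope.
Local Open Scope ring_scope.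

(* Global asymptotic stability of the origin of a possibly time-varying system
   started at time [t0]. [traj z0 z] says that [z] is a trajectory on
   [t0, +oo[ with initial state [z0] at time [t0]; [size] is the norm, taken in
   the extended reals so that it needs no boundedness side condition. *)
Definition gas_origin (R : realType) (S : zmodType) (adm : set S)
    (size : S -> \bar R) (t0 : R) (traj : S -> (R -> S) -> Prop) : Prop :=
  [/\ traj 0 (fun=> 0),
      forall z0, adm z0 -> exists z, traj z0 z,
      forall e, 0 < e -> exists2 d, 0 < d &
        forall z0 z, traj z0 z -> (size z0 < d%:E)%E ->
          forall t, t0 <= t -> (size (z t) < e%:E)%E
    & forall z0 z, traj z0 z -> size (z t) @[t --> +oo] --> 0%E].

(* [X] is a solution on [D] of the ordinary differential equation X' = h, in
   the sense of Caratheodory, with initial time [t0]. The right-hand side is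
   already evaluated along the solution. *)
Definition ode_solution (R : realType) (n : nat) (D : set R) (t0 : R)
    (h : R -> 'cV[R]_n) (X : R -> 'cV[R]_n) : Prop :=
  {within D, continuous X} /\
  forall t, D t -> forall i,
    X t i 0 = X t0 i 0 + \int[@lebesgue_measure R]_(s in `[t0, t]) h s i 0.

(* The data of the system
     u_t = - lamu u_x + fu(x, (u, v)),   v_t = lamv v_x + fv(x, (u, v)),
     X' = f0(X, v(0, .), t),             u(0, .) = g0(X, v(0, .), t).
   All pairs (u, v) : R * R and (X, v) : 'cV[R]_n * R carry the max norm. *)
Record system (R : realType) (n : nat) := System {
  lamu : R -> R;
  lamv : R -> R;
  fu : R -> R * R -> R;
  fv : R -> R * R -> R;
  f0 : 'cV[R]_n -> R -> R -> 'cV[R]_n;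
  g0 : 'cV[R]_n -> R -> R -> R
}.

Section semilinear.
Context (R : realType) (n : nat).
Implicit Types (P : system R n) (K : 'cV[R]_n -> R -> R).
Implicit Types (Om : set (R * R)) (w : R -> R -> R * R) (X : R -> 'cV[R]_n).

Local Notation mu := (@lebesgue_measure R).
Local Notation I01 := `[0 : R, 1]%classic.
Local Notation Rge0 := `[0 : R, +oo[%classic.

(* Measurability in the independent variables x and t, implicit in the use of
   L^oo coefficients; together with [S2] and [S4] these are the Caratheodory
   conditions that give a meaning to the integral equations below. *)
Definition measurable_data P K : Prop :=
  [/\ measurable_fun I01 (lamu P) /\ measurable_fun I01 (lamv P),
      forall q : R * R, measurable_fun I01 (fun x => fu P x q) /\
                measurable_fun I01 (fun x => fv P x q),
      forall (Y : 'cV_n) v i, measurable_fun Rge0 (fun t => f0 P Y v t i 0),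
      forall (Y : 'cV_n) v, measurable_fun Rge0 (fun t => g0 P Y v t)
    & forall Y, measurable_fun Rge0 (fun t => K Y t)].

Definition S1 P : Prop :=
  (forall x, 0 <= x <= 1 -> 0 < lamu P x /\ 0 < lamv P x) /\
  exists l, forall x, 0 <= x <= 1 ->
    Num.max (lamu P x)^-1 (lamv P x)^-1 <= l.

(* Essential boundedness of the partial derivatives of a function that is
   Lipschitz in these variables is a uniform bound on the Lipschitz constant. *)
Definition S2 P : Prop :=
  exists L : R,
  [/\ forall x, 0 <= x <= 1 -> L.-lipschitz (fu P x) /\ L.-lipschitz (fv P x),
      forall t, 0 <= t -> L.-lipschitz (fun p => f0 P p.1 p.2 t)
    & forall t, 0 <= t -> L.-lipschitz (fun p => g0 P p.1 p.2 t)].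

Definition S3 P : Prop :=
  (forall x, 0 <= x <= 1 -> fu P x 0 = 0 /\ fv P x 0 = 0) /\
  (forall t, 0 <= t -> f0 P 0 0 t = 0 /\ g0 P 0 0 t = 0).

Definition nominal_traj P K (t0 : R) (X0 : 'cV[R]_n) X : Prop :=
  X t0 = X0 /\
  ode_solution `[t0, +oo[ t0 (fun s => f0 P (X s) (K (X s) s) s) X.

(* The nominal equation is time-varying: as usual, its origin is stable and
   attractive for every initial time, not necessarily uniformly in it. *)
Definition S4 P K : Prop :=
  [/\ exists L : R, forall t, 0 <= t -> L.-lipschitz (fun Y => K Y t),
      forall t, 0 <= t -> K 0 t = 0
    & forall t0, 0 <= t0 ->
        gas_origin setT (fun X : 'cV[R]_n => `|X|%:E) t0 (nominal_traj P K t0)].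

(* Travel time from [a] to [b] at speed [lam]. *)
Definition travel (lam : R -> R) (a b : R) : R :=
  \int[mu]_(xi in `[a, b]) (lam xi)^-1.

Definition tau_v P (t x : R) : R := t + travel (lamv P) x 1.

Definition determinate P (t : R) : set (R * R) :=
  [set p | 0 <= p.1 <= 1 /\ t <= p.2 <= tau_v P t p.1].

Definition halfstrip : set (R * R) := [set p | 0 <= p.1 <= 1 /\ 0 <= p.2].

(* Broad solutions in L^oo over a space-time domain [Om] with initial time [t0].
   They are represented by Borel functions, bounded up to every finite time,
   that satisfy the integral equations at every point, so that the traces on
   all vertical, horizontal and characteristic lines are meaningful. Since the
   characteristics do not depend on w, those through (x, s) are parametrized by
   the space variable:
     u : xi |-> s - travel lamu xi x  for xi <= x   (du/dxi = fu / lamu),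
     v : xi |-> s - travel lamv x xi  for xi >= x   (dv/dxi = - fv / lamv).
   Equations are integrated between (x, s) and any earlier point of the
   characteristic lying in [Om], in particular its foot on the initial line or
   on a lateral boundary. There is no condition at x = 1, and the one at x = 0
   is only required after the initial time since L^oo initial data need not
   satisfy compatibility conditions at the corners. *)
Definition broad_solution P Om (t0 : R) w X : Prop :=
  [/\ measurable_fun Om (fun p => w p.1 p.2) /\
      (forall T, exists M, forall x s, Om (x, s) -> s <= T -> `|w x s| <= M),
      forall x s y, Om (x, s) -> 0 <= y <= x ->
        let ch xi := s - travel (lamu P) xi x in
        Om (y, ch y) ->
        (w x s).1 = (w y (ch y)).1 +
          \int[mu]_(xi in `[y, x]) (fu P xi (w xi (ch xi)) / lamu P xi),
      forall x s y, Om (x, s) -> x <= y <= 1 ->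
        let ch xi := s - travel (lamv P) x xi in
        Om (y, ch y) ->
        (w x s).2 = (w y (ch y)).2 +
          \int[mu]_(xi in `[x, y]) (fv P xi (w xi (ch xi)) / lamv P xi),
      ode_solution [set s | Om (0, s)] t0
        (fun s => f0 P (X s) (w 0 s).2 s) X
    & forall s, Om (0, s) -> t0 < s -> (w 0 s).1 = g0 P (X s) (w 0 s).2 s].

(* [U] is the control value computed by the algorithm at time [t] from the
   state [(wt, Xt)]: [(wb, Xb)] is the prediction over the determinate set and
   [V x] stands for the value of \bar v^* at (x, tau_v t x). *)
Definition feedback P K (t : R) (wt : R -> R * R) (Xt : 'cV[R]_n) (U : R) :
    Prop :=
  exists wb Xb (V : R -> R),
  [/\ broad_solution P (determinate P t) t wb Xb,
      (forall x, 0 <= x <= 1 -> wb x t = wt x) /\ Xb t = Xt,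
      {within I01, continuous V},
      forall x, 0 <= x <= 1 ->
        V x = K (Xb (tau_v P t 0)) (tau_v P t 0) -
          \int[mu]_(xi in `[0, x])
            (fv P xi ((wb xi (tau_v P t xi)).1, V xi) / lamv P xi)
    & U = V 1].

Definition state : zmodType := ((R -> R * R) * 'cV[R]_n)%type.

Definition admissible : set state :=
  [set z : state | measurable_fun I01 (z.1 : R -> R * R) /\
                   exists M : R, forall x, 0 <= x <= 1 -> `|z.1 x| <= M].

Definition state_norm (z : state) : \bar R :=
  maxe (ereal_sup [set `|z.1 x|%:E | x in I01]) `|z.2|%:E.

(* The actuated boundary condition v(1, t) = U(t) is required for t > 0 for the
   same reason as the one at x = 0. *)
Definition closed_loop_traj P K (z0 : state) (z : R -> state) : Prop :=
  let w x t := (z t).1 x in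
  let X t := (z t).2 in
  [/\ broad_solution P halfstrip 0 w X,
      forall x, 0 <= x <= 1 -> w x 0 = z0.1 x,
      X 0 = z0.2
    & exists U : R -> R,
        (forall t, 0 <= t -> feedback P K t (z t).1 (z t).2 (U t)) /\
        (forall t, 0 < t -> (w 1 t).2 = U t)].

End semilinear.

(* Main.v *)
Require Import Defs.
From HB Require Import structures.
From mathcomp Require Import all_boot all_order all_algebra.
From mathcomp Require Import all_classical all_reals all_analysis.
From mathcomp Require Import measurable_realfun ring lra.

Set Implicit Arguments.
Unset Strict Implicit.
Unset Printing Implicit Defensive.
Import Order.TTheory GRing.Theory Num.Theory.
Import numFieldNormedType.Exports.
Local Open Scope classical_set_scope.
Local Open Scope ring_scope.

(** The characteristics do not depend on the state, so the prediction made at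
    time [t] obeys over the determinate set the same equations as the plant.
    These equations involve no boundary value at [x = 1] and have at most one
    solution with given data at time [t] ([determinate_dependence] with a zero
    difference of the data), hence the predicted future is the true one. Let
    [tau = travel lamv 0 1]. Along the last characteristic of [v] in this set,
    from [x = 1] at time [t] to [x = 0] at time [t + tau], the plant and the
    design equation of the algorithm are the same Volterra equation for [v] with
    the same value at [x = 1], the applied control; hence they also agree at
    [x = 0], where the design equation starts from the desired value:
      [(w 0 s).2 = K (X s) s] for every [s > tau]   ([controlled_trace]).
    From time [tau] on, [X] is thus a trajectory of the nominal equation
    ([traj_nominal]).

    What remains is to bound [w] by [X]. Over the determinate set of time 0 the
    solution is bounded by its data ([initial_estimate]). Beyond this set [v] can
    be followed from [x = 0], where [X] bounds both [u] and [v]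
    ([boundary_estimate]), and [u] from [x = 0] or from the edge of this set;
    there [x] plays the role of time, and as it ranges over a bounded interval
    the resulting constant does not depend on the time elapsed
    ([outer_estimate]). Applied to everything beyond the determinate set of time
    0 this gives stability ([global_estimate]), applied to the characteristics
    that have left [x = 0] late it gives attractivity ([late_estimate]).

    Trajectories are obtained from the closed loop solved for its unknowns: [v]
    comes from the initial data as long as its characteristic arrives at [x = 0]
    no later than [tau], and otherwise from the feedback law at the time [r] of
    arrival, by integration from [x = 0] to [x]. The value of [v] at time [s]
    then depends on the later state [X r], so that time does not order the
    dependences, but [depth] does: [solution_map] is a contraction of a supremum
    norm with a weight exponential in the depth. Its fixed point is a broad
    solution and is its own prediction, so the algorithm computes precisely the
    value of [v] at [x = 1]; only at time 0, where the initial data may be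
    incompatible with the control, is the design equation solved separately
    ([design_ode_exists]).

    All these estimates are contractions in exponentially weighted supremum
    norms ([contraction_bound], [weighted_fixed_point]). The clock of the weight
    along a characteristic is the travel time, whose density, the slowness, is
    only measurable; [integral_density_expR_le] is the calculus this needs. *)

(** * Integrals over compact intervals *)

Section interval_integral.
Context {R : realType}.
Local Notation mu := (@lebesgue_measure R).
Implicit Types (a b c x y : R) (f g : R -> R).

Lemma integrable_itv_bounded a b f M : measurable_fun `[a, b] f ->
  (forall x, a <= x <= b -> `|f x| <= M) -> mu.-integrable `[a, b] (EFin \o f).
Proof.
move=> mf fM; apply: measurable_bounded_integrable => //.
  by rewrite /= lebesgue_measure_itv/=; case: ifP => // _; rewrite -EFinB ltry.
exists M; split; first by rewrite num_real.
move=> N MN x /=; rewrite in_itv/= => xab.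
by rewrite (le_trans (fM _ xab))// ltW.
Qed.

Lemma sub_itvcc a b x y : a <= x -> y <= b -> `[x, y]%classic `<=` `[a, b]%classic.
Proof. by move=> ax yb; apply: subset_itv; rewrite bnd_simp. Qed.

Lemma integrable_sub_itv a b x y f : a <= x -> y <= b ->
  mu.-integrable `[a, b] (EFin \o f) -> mu.-integrable `[x, y] (EFin \o f).
Proof. by move=> ax yb; apply: integrableS => //; exact: sub_itvcc. Qed.

Lemma integrable_scale a b k f : mu.-integrable `[a, b] (EFin \o f) ->
  mu.-integrable `[a, b] (EFin \o (fun x => k * f x)).
Proof.
move=> fi; have := @integrableZl _ _ _ mu `[a, b] (measurable_itv _) k _ fi.
by apply: eq_integrable.
Qed.

Lemma integral_itv_split a b c f : a <= b <= c ->
  mu.-integrable `[a, c] (EFin \o f) ->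
  \int[mu]_(x in `[a, c]) f x =
  \int[mu]_(x in `[a, b]) f x + \int[mu]_(x in `[b, c]) f x.
Proof.
move=> /andP[ab bc] fi.
apply/eqP; rewrite addrC -subr_eq; apply/eqP.
have := @Rintegral_itvB R f (BLeft a) (BRight c) b fi.
rewrite !bnd_simp => /(_ ab bc) ->.
rewrite Rintegral_itv_obnd_cbnd//; apply: integrableS fi => //.
by apply: subset_itv; rewrite bnd_simp.
Qed.

Lemma integral_itv_cst a b (k : R) : a <= b ->
  \int[mu]_(x in `[a, b]) k = k * (b - a).
Proof.
move=> ab; rewrite Rintegral_cst//= lebesgue_measure_itv/= lte_fin.
by case: ltgtP ab => // [-> _]; rewrite ?subrr.
Qed.

Lemma integral_itv_point a f : \int[mu]_(x in `[a, a]) f x = 0.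
Proof. by rewrite set_itv1 Rintegral_set1. Qed.

Lemma le_integral_itv a b f g :
  mu.-integrable `[a, b] (EFin \o f) -> mu.-integrable `[a, b] (EFin \o g) ->
  (forall x, a <= x <= b -> f x <= g x) ->
  \int[mu]_(x in `[a, b]) f x <= \int[mu]_(x in `[a, b]) g x.
Proof. by move=> fi gi fg; apply: le_Rintegral => // x /=; rewrite in_itv/=; exact: fg. Qed.

Lemma eq_integral_itv a b f g : (forall x, a <= x <= b -> f x = g x) ->
  \int[mu]_(x in `[a, b]) f x = \int[mu]_(x in `[a, b]) g x.
Proof. by move=> fg; apply: eq_Rintegral => x; rewrite inE/= in_itv/=; exact: fg. Qed.

(** Over a uniform subdivision of [a, b] into [N] intervals the increments
    add up to at most [C * (b - a) ^+ 2 / N]. *)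
Lemma le_of_quadratic_increments (H : R -> R) a b (C : R) : a <= b -> 0 <= C ->
  (forall x y, a <= x <= y -> y <= b -> H y - H x <= C * (y - x) ^+ 2) ->
  H b <= H a.
Proof.
move=> ab C0 HC.
have step N k : (k <= N.+1)%N ->
    H (a + k%:R * ((b - a) / N.+1%:R)) - H a <=
    k%:R * (C * ((b - a) / N.+1%:R) ^+ 2).
  set h := (b - a) / _; have h0 : 0 <= h by rewrite divr_ge0// subr_ge0.
  have hN : N.+1%:R * h = b - a by rewrite /h mulrC divfK.
  elim: k => [_|k IH kN]; first by rewrite !mul0r addr0 subrr.
  have kh : k.+1%:R * h = k%:R * h + h by rewrite -addn1 natrD mulrDl mul1r.
  have := HC (a + k%:R * h) (a + k.+1%:R * h).
  have -> : a + k.+1%:R * h - (a + k%:R * h) = h by rewrite kh; ring.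
  have -> : a <= a + k%:R * h <= a + k.+1%:R * h.
    by rewrite lerDl mulr_ge0//= lerD2l kh lerDl.
  move=> /(_ isT); have -> : a + k.+1%:R * h <= b.
    by rewrite -lerBrDl -hN; apply: ler_wpM2r => //; rewrite ler_nat.
  move=> /(_ isT); have := IH (ltnW kN).
  rewrite -[in k.+1%:R * (C * _)]addn1 natrD; lra.
rewrite -subr_le0; apply/ler_addgt0Pr => e e0; rewrite add0r.
have [N ltN] : exists N : nat, C * (b - a) ^+ 2 / e < N%:R.
  by exists (Num.truncn (C * (b - a) ^+ 2 / e)).+1; exact: truncnS_gt.
have := step N N.+1 (leqnn _).
rewrite [X in H (a + X)]mulrC divfK// (addrC a) subrK => /le_trans; apply.
have -> : N.+1%:R * (C * ((b - a) / N.+1%:R) ^+ 2) =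
  (C * (b - a) ^+ 2) / N.+1%:R by field.
rewrite ler_pdivrMr//.
rewrite ltr_pdivrMr// in ltN; rewrite (le_trans (ltW ltN))// mulrC.
by rewrite ler_pM2l// ler_nat.
Qed.

(** The function [expR (A * G z) / A] is a primitive of the integrand almost
    everywhere. Instead of differentiating, its increment and the integral over
    a short interval are compared: they agree up to the square of the length. *)
Lemma integral_density_expR_le (rho G : R -> R) (a b l A : R) :
  a <= b -> A != 0 -> measurable_fun `[a, b] rho ->
  (forall x, a <= x <= b -> 0 <= rho x <= l) -> measurable_fun `[a, b] G ->
  (forall x y, a <= x <= y -> y <= b ->
     G y - G x = \int[mu]_(z in `[x, y]) rho z) ->
  \int[mu]_(z in `[a, b]) (rho z * expR (A * G z)) <=
  (expR (A * G b) - expR (A * G a)) / A.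
Proof.
move=> ab A0 mrho rho0l mG dG.
have l0 : 0 <= l.
  by have := rho0l a; rewrite lexx => /(_ ab) /andP[/le_trans]; apply.
have irho x y : a <= x <= y -> y <= b ->
    mu.-integrable `[x, y] (EFin \o rho).
  move=> /andP[ax xy] yb; apply: (integrable_sub_itv ax yb).
  apply: (@integrable_itv_bounded _ _ _ l) => // z zab.
  by have /andP[? ?] := rho0l _ zab; rewrite ger0_norm.
have Gnd x y : a <= x <= y -> y <= b -> 0 <= G y - G x <= l * (y - x).
  move=> axy yb; rewrite dG//; have /andP[ax xy] := axy; apply/andP; split.
    apply: Rintegral_ge0 => z /=; rewrite in_itv/= => /andP[xz zy].
    have := rho0l z; rewrite (le_trans ax xz) (le_trans zy yb).
    by move=> /(_ isT)/andP[].
  rewrite -integral_itv_cst//; apply: le_integral_itv.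
  - exact: irho.
  - apply: (@integrable_itv_bounded _ _ _ l) => // z _.
    by rewrite ger0_norm.
  - move=> z /andP[xz zy].
    have := rho0l z; rewrite (le_trans ax xz) (le_trans zy yb).
    by move=> /(_ isT)/andP[].
pose E := expR (`|A| * (`|G a| + `|G b|)).
have EG z : a <= z <= b -> expR (A * G z) <= E.
  move=> /andP[az zb]; rewrite /E ler_expR (le_trans (ler_norm _))// normrM.
  rewrite ler_wpM2l//.
  have := Gnd a z; have := Gnd z b; rewrite az zb !lexx => /(_ isT isT) + /(_ isT isT).
  have := ler_norm (G b); have := ler_norm (- G a); rewrite normrN.
  have := normr_ge0 (G a); have := normr_ge0 (G b).
  by case: (leP 0 (G z)) => [/ger0_norm|/ltr0_norm] ->; lra.
pose F z := rho z * expR (A * G z).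
have mF : measurable_fun `[a, b] F.
  apply: measurable_funM => //; apply: measurableT_comp => //.
  exact: measurable_funM.
have iF x y : a <= x <= y -> y <= b -> mu.-integrable `[x, y] (EFin \o F).
  move=> /andP[ax xy] yb; apply: (integrable_sub_itv ax yb).
  apply: (@integrable_itv_bounded _ _ _ (l * E)) => // z zab.
  have /andP[? ?] := rho0l _ zab; rewrite /F ger0_norm ?mulr_ge0 ?expR_ge0//.
  by rewrite ler_pM ?expR_ge0 ?EG.
pose H z := \int[mu]_(t in `[a, z]) F t - expR (A * G z) / A.
suff : H b <= H a by rewrite /H integral_itv_point mulrBl; lra.
apply: (@le_of_quadratic_increments H a b (E * `|A| * l ^+ 2)) => //.
  by rewrite !mulr_ge0// ?sqr_ge0// expR_ge0.
move=> x y axy yb; have /andP[ax xy] := axy.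
rewrite {}/H (@integral_itv_split a x y) ?iF ?lexx ?(le_trans ax)//.
set p := A * G x; set q := A * G y.
(* the tangents at both end points control the error of the difference quotient *)
have tangent (u v : R) : expR u * (v - u) <= expR v - expR u.
  rewrite -[in expR v](subrK u v) expRD.
  have := expR_ge1Dx (v - u); have := expR_gt0 u; nra.
have Fle z : x <= z <= y -> F z <= Num.max (expR p) (expR q) * rho z.
  move=> /andP[xz zy]; have [azb|//] := boolP (a <= z <= b); last first.
    by rewrite (le_trans ax)// (le_trans zy).
  have /andP[r0 _] := rho0l _ azb.
  rewrite /F mulrC ler_wpM2r//.
  have /andP[Gzy _] : 0 <= G y - G z <= l * (y - z).
    by apply: Gnd => //; rewrite (le_trans ax xz).
  have /andP[Gxz _] : 0 <= G z - G x <= l * (z - x).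
    by apply: Gnd; rewrite ?ax// (le_trans zy).
  rewrite le_max !ler_expR /p /q; case: (ltP A 0) => [A_lt0|A_ge0].
    by rewrite ler_nM2l// -subr_ge0 Gxz.
  by rewrite orbC ler_wpM2l// -subr_ge0.
have : \int[mu]_(t in `[x, y]) F t <= Num.max (expR p) (expR q) * (G y - G x).
  rewrite dG// -RintegralZl//; last exact: irho.
  apply: le_integral_itv => //; first exact: iF.
  by apply: integrable_scale; exact: irho.
have := Gnd x y axy yb; set D := G y - G x => /andP[D0 Dl].
have pqD : q - p = A * D by rewrite /p /q -mulrBr.
have tpq := tangent p q; have tqp := tangent q p.
have pE : expR p <= E by apply: EG; rewrite ax (le_trans xy).
have qE : expR q <= E by apply: EG; rewrite yb (le_trans ax).
have D2 : E * `|A| * D ^+ 2 <= E * `|A| * (l * (y - x)) ^+ 2.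
  by rewrite ler_wpM2l ?mulr_ge0 ?expR_ge0// lerXn2r ?nnegrE// (le_trans D0).
rewrite exprMn mulrA in D2; move=> IF; set I := \int[mu]_(t in `[a, x]) F t.
suff : Num.max (expR p) (expR q) * D - (expR q - expR p) / A <= E * `|A| * D ^+ 2.
  by rewrite mulrBl; lra.
move: A0; rewrite neq_lt => /orP[A0|A0].
- have qp : expR q <= expR p by rewrite ler_expR -subr_le0 pqD; nra.
  rewrite max_l// ltr0_norm//.
  have -> : expR p * D - (expR q - expR p) / A =
    ((expR q - expR p) - expR p * (A * D)) * (- A^-1) by field; lra.
  have -> : E * - A * D ^+ 2 = (E * (A * D) ^+ 2) * (- A^-1) by field; lra.
  apply: ler_wpM2r; first by rewrite oppr_ge0 invr_le0 ltW.
  move: tpq tqp; rewrite -(opprB q p) pqD => tpq tqp.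
  have : A * D <= 0 by nra.
  move: tpq tqp; set h := A * D => tpq tqp h0.
  have : (expR p - expR q) * - h <= expR p * - h * - h by nra.
  have := ler_wpM2r (sqr_ge0 h) pE; lra.
- have qp : expR p <= expR q by rewrite ler_expR -subr_ge0 pqD; nra.
  rewrite max_r// gtr0_norm//.
  have -> : expR q * D - (expR q - expR p) / A =
    (expR q * (A * D) - (expR q - expR p)) * A^-1 by field; lra.
  have -> : E * A * D ^+ 2 = (E * (A * D) ^+ 2) * A^-1 by field; lra.
  apply: ler_wpM2r; first by rewrite invr_ge0 ltW.
  move: tpq tqp; rewrite -(opprB q p) pqD => tpq tqp.
  have : 0 <= A * D by nra.
  move: tpq tqp; set h := A * D => tpq tqp h0.
  have : (expR q - expR p) * h <= expR q * h * h by nra.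
  have := ler_wpM2r (sqr_ge0 h) qE; lra.
Qed.

End interval_integral.

Lemma integrable_diff (R : realType) (a b : R) (f g : R -> R) :
  (@lebesgue_measure R).-integrable `[a, b] (EFin \o f) ->
  (@lebesgue_measure R).-integrable `[a, b] (EFin \o g) ->
  (@lebesgue_measure R).-integrable `[a, b] (EFin \o (fun x => f x - g x)).
Proof.
move=> fi gi.
have := @integrableB _ _ _ (@lebesgue_measure R) `[a, b] (measurable_itv _) _ _ fi gi.
by apply: eq_integrable.
Qed.

Lemma integral_diff_le (R : realType) (a b : R) (f g k : R -> R) :
  (@lebesgue_measure R).-integrable `[a, b] (EFin \o f) ->
  (@lebesgue_measure R).-integrable `[a, b] (EFin \o g) ->
  (@lebesgue_measure R).-integrable `[a, b] (EFin \o k) ->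
  (forall x, a <= x <= b -> `|f x - g x| <= k x) ->
  `|\int[@lebesgue_measure R]_(x in `[a, b]) f x -
    \int[@lebesgue_measure R]_(x in `[a, b]) g x| <=
  \int[@lebesgue_measure R]_(x in `[a, b]) k x.
Proof.
move=> fi gi ki fgk; rewrite -RintegralB//.
have fgi := integrable_diff fi gi.
rewrite ler_norml; apply/andP; split; last first.
  by apply: le_integral_itv => // x /fgk; apply: le_trans; exact: ler_norm.
rewrite -[leLHS]mulN1r -RintegralZl//; apply: le_integral_itv => //.
  exact: integrable_scale.
by move=> x /fgk; rewrite mulN1r ler_norml => /andP[].
Qed.

Lemma integral_diff_expR_le (R : realType) (h h' : R -> R) (a b A C : R) :
  a <= b -> A != 0 ->
  (@lebesgue_measure R).-integrable `[a, b] (EFin \o h) ->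
  (@lebesgue_measure R).-integrable `[a, b] (EFin \o h') ->
  0 <= C -> (forall x, a <= x <= b -> `|h x - h' x| <= C * expR (A * x)) ->
  `|\int[@lebesgue_measure R]_(x in `[a, b]) h x -
    \int[@lebesgue_measure R]_(x in `[a, b]) h' x| <=
  C * ((expR (A * b) - expR (A * a)) / A).
Proof.
move=> ab A0 ih ih' C0 hC.
have iE : (@lebesgue_measure R).-integrable `[a, b] (EFin \o (fun x => 1 * expR (A * x))).
  apply: (@integrable_itv_bounded _ _ _ _ (expR (`|A| * (`|a| + `|b|)))).
    apply: measurable_funM => //; apply: measurableT_comp => //.
  move=> x /andP[ax xb]; rewrite mul1r ger0_norm ?expR_ge0// ler_expR.
  rewrite (le_trans (ler_norm _))// normrM ler_wpM2l// ler_norml.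
  have := ler_norm (- a); rewrite normrN => ?; have := ler_norm b.
  have := normr_ge0 a; have := normr_ge0 b; lra.
apply: (le_trans (integral_diff_le ih ih' (integrable_scale C iE) _)).
  by move=> x xab; rewrite mul1r hC.
rewrite RintegralZl//; apply: ler_wpM2l => //.
apply: (@integral_density_expR_le R (fun=> 1) id a b 1) => //.
- by move=> x _; rewrite ler01 lexx.
- by move=> x y /andP[_ xy] _; rewrite integral_itv_cst// mul1r.
Qed.

Lemma integral_diff_growth (R : realType) (h h' : R -> R) (a b A C c : R) :
  a <= b -> 0 < A -> 0 <= C ->
  (@lebesgue_measure R).-integrable `[a, b] (EFin \o h) ->
  (@lebesgue_measure R).-integrable `[a, b] (EFin \o h') ->
  (forall x, a <= x <= b -> `|h x - h' x| <= C * expR (A * (x - c))) ->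
  `|\int[@lebesgue_measure R]_(x in `[a, b]) h x -
    \int[@lebesgue_measure R]_(x in `[a, b]) h' x| <= C / A * expR (A * (b - c)).
Proof.
move=> ab A0 C0 ih ih' hC.
have e0 := expR_ge0 (- (A * c)).
have /(_ _)/le_trans := integral_diff_expR_le ab (lt0r_neq0 A0) ih ih' (mulr_ge0 C0 e0).
apply; first by move=> x /hC; rewrite mulrBr [A * x - _]addrC expRD mulrA.
rewrite mulrBr [A * b - A * c]addrC expRD.
have -> : C / A * (expR (- (A * c)) * expR (A * b)) =
  C * expR (- (A * c)) * (expR (A * b) / A) by ring.
apply: ler_wpM2l; first by rewrite !mulr_ge0.
by apply: ler_wpM2r; [rewrite invr_ge0 ltW | rewrite lerBlDr lerDl expR_ge0].
Qed.

(** For a boundary law that holds only after the time [a]. *)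
Lemma integral_itv_eq_off_left (R : realType) (a b : R) (f g : R -> R) :
  (@lebesgue_measure R).-integrable `[a, b] (EFin \o f) ->
  (@lebesgue_measure R).-integrable `[a, b] (EFin \o g) ->
  (forall x, a < x <= b -> f x = g x) ->
  \int[@lebesgue_measure R]_(x in `[a, b]) f x = \int[@lebesgue_measure R]_(x in `[a, b]) g x.
Proof.
move=> fi gi fg.
have sub : `]a, b]%classic `<=` `[a, b]%classic.
  by apply: subset_itv; rewrite bnd_simp.
rewrite -(@Rintegral_itv_obnd_cbnd R a (BRight b) f); last exact: integrableS fi.
rewrite -(@Rintegral_itv_obnd_cbnd R a (BRight b) g); last exact: integrableS gi.
by apply: eq_Rintegral => x; rewrite inE/= in_itv/=; exact: fg.
Qed.

Lemma integral_increment_le (R : realType) (a x y M : R) (f : R -> R) :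
  a <= x <= y -> (@lebesgue_measure R).-integrable `[a, y] (EFin \o f) ->
  (forall r, x <= r <= y -> `|f r| <= M) ->
  `|\int[@lebesgue_measure R]_(r in `[a, y]) f r -
    \int[@lebesgue_measure R]_(r in `[a, x]) f r| <= M * (y - x).
Proof.
move=> /andP[ax xy] fi fM; rewrite (@integral_itv_split _ a x y) ?ax// addrC addKr.
have fi' := integrable_sub_itv ax (lexx y) fi.
have i0 : (@lebesgue_measure R).-integrable `[x, y] (EFin \o (fun=> (0 : R))).
  by apply: (@integrable_itv_bounded _ _ _ _ 0) => // r _; rewrite normr0.
have iM : (@lebesgue_measure R).-integrable `[x, y] (EFin \o (fun=> M)).
  by apply: (@integrable_itv_bounded _ _ _ _ `|M|).
have := integral_diff_le fi' i0 iM; rewrite !integral_itv_cst// mul0r subr0; apply.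
by move=> r rI; rewrite subr0; exact: fM.
Qed.

(** * Contractions in weighted supremum norms *)

Section weighted_contraction.
Context {R : realType}.

Lemma exists_halving (M e : R) : 0 < e -> exists k, M / 2 ^+ k < e.
Proof.
move=> e0; have [k hk] : exists k : nat, M / e < k%:R.
  by exists (Num.truncn (M / e)).+1; exact: truncnS_gt.
exists k; rewrite ltr_pdivrMr ?exprn_gt0//; rewrite ltr_pdivrMr// mulrC in hk.
by rewrite (lt_le_trans hk)// ler_wpM2l ?(ltW e0)// -natrX ler_nat ltnW// ltn_expl.
Qed.

(** Iterating the hypothesis halves the excess over [2 * B] at each step. *)
Lemma contraction_bound (I : Type) (S : I -> Prop) (d om : I -> R) (B M : R) :
  (forall i, S i -> 0 <= om i) -> 0 <= B -> 0 <= M ->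
  (forall i, S i -> d i <= M * om i) ->
  (forall C : R, 0 <= C -> (forall i, S i -> d i <= C * om i) ->
     forall i, S i -> d i <= (B + C / 2) * om i) ->
  forall i, S i -> d i <= 2 * B * om i.
Proof.
move=> om0 B0 M0 dM dC.
have step k : forall i, S i -> d i <= (2 * B + M / 2 ^+ k) * om i.
  elim: k => [|k IH] i Si.
    rewrite expr0 divr1 (le_trans (dM _ Si))// ler_wpM2r ?om0//; lra.
  have := dC (2 * B + M / 2 ^+ k) _ IH i Si.
  have -> : 0 <= 2 * B + M / 2 ^+ k by rewrite addr_ge0 ?mulr_ge0 ?invr_ge0 ?exprn_ge0.
  move=> /(_ isT) /le_trans; apply; rewrite ler_wpM2r ?om0// exprS invfM; lra.
move=> i Si; apply/ler_addgt0Pr => e e0.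
have [k hk] := exists_halving (M * om i) e0.
by rewrite (le_trans (step k i Si))// mulrDl lerD2l mulrAC ltW.
Qed.

(** Banach's theorem in a weighted supremum norm. [good] is the class of
    functions on which the operator is controlled; it must survive limits that
    are dominated by the weight. *)
Lemma weighted_fixed_point (I : Type) (om : I -> R) (good : (I -> R) -> Prop)
    (Phi : (I -> R) -> I -> R) (C0 : R) :
  (forall i, 0 < om i) -> good (fun=> 0) ->
  (forall W, good W -> good (Phi W)) ->
  (forall (w : nat -> I -> R) (W : I -> R) (C : R), (forall k, good (w k)) ->
     (forall k i, `|w k i| <= C * om i) ->
     (forall i, w k i @[k --> \oo] --> W i) -> good W) ->
  (forall i, `|Phi (fun=> 0) i| <= C0 * om i) ->
  (forall W W' (C : R), good W -> good W' -> 0 <= C ->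
     (forall i, `|W i - W' i| <= C * om i) ->
     forall i, `|Phi W i - Phi W' i| <= C / 2 * om i) ->
  exists W, good W /\ forall i, Phi W i = W i.
Proof.
move=> om0 good0 goodPhi goodlim Phi0 PhiC.
have [[i0]|noI] := pselect (inhabited I); last first.
  by exists (fun=> 0); split => // i; exfalso; apply: noI.
have C00 : 0 <= C0.
  by have := le_trans (normr_ge0 _) (Phi0 i0); rewrite pmulr_lge0.
pose w k := iter k Phi (fun=> 0).
have wgood k : good (w k) by elim: k => //= k IH; exact: goodPhi.
have wS k i : `|w k.+1 i - w k i| <= C0 / 2 ^+ k * om i.
  elim: k i => [|k IH] i; first by rewrite /w/= subr0 divr1.
  have := PhiC _ _ (C0 / 2 ^+ k) (wgood k.+1) (wgood k) _ IH i.
  by rewrite divr_ge0 ?exprn_ge0// exprS [2 * _]mulrC invfM mulrA; apply.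
have wD k m i : `|w (k + m)%N i - w k i| <= 2 * C0 / 2 ^+ k * om i.
  have e0 : 0 <= C0 / 2 ^+ k * om i by rewrite mulr_ge0 ?divr_ge0 ?exprn_ge0// ltW.
  suff: `|w (k + m)%N i - w k i| <= (2 - 2 / 2 ^+ m) * (C0 / 2 ^+ k * om i).
    move=> /le_trans; apply.
    have : 0 <= 2 / 2 ^+ m * (C0 / 2 ^+ k * om i).
      by rewrite mulr_ge0// divr_ge0 ?exprn_ge0.
    lra.
  elim: m => [|m IH]; first by rewrite addn0 expr0 divr1 !subrr normr0 mul0r.
  rewrite -(subrK (w (k + m)%N i) (w (k + m.+1)%N i)) -addrA.
  apply: (le_trans (ler_normD _ _)).
  have := wS (k + m)%N i; rewrite -addnS.
  move: e0 IH; rewrite exprD exprS !invfM; set a := _^-1; set b := _^-1.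
  by move=> e0 IH h; move: (lerD h IH) => /le_trans; apply; lra.
have small i (e : R) : 0 < e -> exists k, forall m, `|w (k + m)%N i - w k i| < e.
  move=> /(exists_halving (2 * C0 * om i))[k hk]; exists k => m.
  by rewrite (le_lt_trans (wD k m i))// mulrAC.
have cw i : cvgn (fun k => w k i).
  apply/cauchy_cvgP/cauchy_exP => e /(small i)[k hk]; exists (w k i).
  exists k => //= m km; rewrite /ball/= distrC.
  by have := hk (m - k)%N; rewrite subnKC.
pose W i := lim (w k i @[k --> \oo]).
have wW i : w k i @[k --> \oo] --> W i by exact: cw.
have Ww k i : `|W i - w k i| <= 2 * C0 / 2 ^+ k * om i.
  apply/ler_addgt0Pr => e e0; have /cvgrPdist_lt/(_ e e0)[N _ hN] := wW i.
  have /hN/= h : (N <= k + N)%N by rewrite leq_addl.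
  rewrite -(subrK (w (k + N)%N i) (W i)) -addrA (le_trans (ler_normD _ _))//.
  by rewrite [leLHS]addrC (lerD (wD k N i) (ltW h)).
have gW : good W.
  apply: (goodlim w W (2 * C0)) => // k i.
  by have := wD 0%N k i; rewrite add0n /= subr0 expr0 divr1.
exists W; split => // i; apply/eqP; rewrite -subr_eq0 -normr_le0.
apply/ler_addgt0Pr => e e0; rewrite add0r.
have [k hk] := exists_halving (2 * C0 * om i) e0.
have h1 := PhiC _ _ _ gW (wgood k) _ (Ww k) i.
have /h1 {}h1 : 0 <= 2 * C0 / 2 ^+ k by rewrite divr_ge0 ?mulr_ge0 ?exprn_ge0.
have := Ww k.+1 i; rewrite distrC => h2.
rewrite -(subrK (w k.+1 i) (Phi W i)) -addrA (le_trans (ler_normD _ _))//.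
rewrite (le_trans (lerD h1 h2))// exprS invfM (le_trans _ (ltW hk))//; lra.
Qed.

End weighted_contraction.

Lemma norm_limit_le (R : realType) (u : nat -> R) (y c : R) :
  (forall k, `|u k| <= c) -> u k @[k --> \oo] --> y -> `|y| <= c.
Proof.
move=> uc uy; apply/ler_addgt0Pr => e e0.
have /cvgrPdist_lt/(_ e e0)[N _ hN] := uy.
have /= h := hN N (leqnn N).
rewrite -(subrK (u N) y) (le_trans (ler_normD _ _))// addrC lerD//; exact: ltW.
Qed.

(** * Measurability *)

Section caratheodory.
Context d (T : measurableType d) {R : realType}.

(** The values of [q] are rounded down to multiples of [2 ^- k]; on each of the
    countably many pieces on which the rounded values are constant, [f] is
    measurable by hypothesis, and the Lipschitz bound passes to the limit. *)
Lemma measurable_caratheodory (J : finType) (D : set T)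
    (f : T -> (J -> R) -> R) (q : J -> T -> R) (L : R) :
  measurable D -> 0 <= L ->
  (forall a, measurable_fun D (f ^~ a)) -> (forall j, measurable_fun D (q j)) ->
  (forall t a b e, D t -> 0 <= e -> (forall j, `|a j - b j| <= e) ->
     `|f t a - f t b| <= L * e) ->
  measurable_fun D (fun t => f t (q ^~ t)).
Proof.
move=> mD L0 mf mq fL.
pose r k (m : int) : R := m%:~R / 2 ^+ k.
pose fl k j t := Num.floor (q j t * 2 ^+ k).
pose F k t := f t (fun j => r k (fl k j t)).
apply: (@measurable_fun_cvg _ _ _ D F).
  move=> k _ B mB.
  have -> : D `&` F k @^-1` B = \bigcup_(i : {ffun J -> int})
      ((D `&` (f ^~ (fun j => r k (i j))) @^-1` B) `&`
       \bigcap_(j in [set: J]) (D `&` (q j) @^-1` `[r k (i j), r k (i j + 1)%R[)).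
    apply/seteqP; split => t.
      move=> [Dt Bt]; exists [ffun j => fl k j t] => //; split.
        split => //=; move: Bt; rewrite /preimage/= /F.
        by congr (B (f t _)); apply/funext => j; rewrite ffunE.
      move=> j _; split => //=; rewrite ffunE in_itv/= /r.
      rewrite ler_pdivrMr ?exprn_gt0// ltr_pdivlMr ?exprn_gt0//.
      by rewrite real_floor_itv ?num_real.
    move=> [i _ [[Dt Bt] it]]; split => //; move: Bt.
    rewrite /preimage/= /F; congr (B (f t _)); apply/funext => j.
    have [_] := it j I; rewrite /= in_itv/= /r.
    rewrite ler_pdivrMr ?exprn_gt0// ltr_pdivlMr ?exprn_gt0// => h.
    by rewrite /fl (floor_def h).
  apply: countable_bigcupT_measurable => // i; apply: measurableI.
    exact: mf.
  apply: fin_bigcap_measurable; first exact: finite_finset.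
  by move=> j _; apply: mq => //; exact: measurable_itv.
move=> t Dt; apply/cvgrPdist_lt => e e0.
have [k hk] := exists_halving L e0.
exists k => // m /= km; rewrite /F; apply: le_lt_trans hk.
have {}km : (2 ^+ m)^-1 <= (2 ^+ k)^-1 :> R.
  by rewrite lef_pV2 ?posrE ?exprn_gt0// ler_eXn2l// ltr1n.
rewrite (le_trans _ (ler_wpM2l L0 km))//; apply: fL => // j.
have m0 : 0 < 2 ^+ m :> R by rewrite exprn_gt0.
have := @real_floor_itv R (q j t * 2 ^+ m) (num_real _).
rewrite -/(fl m j t) intrD -ler_pdivrMr// -ltr_pdivlMr// mulrDl => /andP[h1 h2].
by rewrite ger0_norm ?subr_ge0// lerBlDr addrC -[_^-1]mul1r ltW.
Qed.

Local Notation mu := (@lebesgue_measure R).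

Lemma measurable_between (D : set T) (a b : T -> R) : measurable D ->
  measurable_fun D a -> measurable_fun D b ->
  measurable [set p : T * R | D p.1 /\ a p.1 <= p.2 <= b p.1].
Proof.
move=> mD ma mb.
have mD1 : measurable (fst @^-1` D : set (T * R)).
  by rewrite -[X in measurable X]setTI; exact: measurable_fst.
have m1 (g : T -> R) : measurable_fun D g ->
    measurable_fun (fst @^-1` D : set (T * R)) (g \o fst).
  move=> mg; apply: (measurable_comp mD) mg _; first by move=> _ [p Dp <-].
  exact: measurable_funTS.
have m2 : measurable_fun (fst @^-1` D : set (T * R)) snd by exact: measurable_funTS.
have h1 := measurable_fun_ler (m1 _ ma) m2.
have h2 := measurable_fun_ler m2 (m1 _ mb).
have tm : measurable [set true] by [].
have := measurable_and h1 h2 mD1 tm.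
congr (measurable _); exact/seteqP.
Qed.

(** The integrand, extended by zero outside the domain of integration, is split
    into its positive and negative parts, to which the theorem of Tonelli applies
    without any integrability. *)
Lemma measurable_integral_param (D : set T) (a b : T -> R) (h : T * R -> R) :
  measurable D -> measurable_fun D a -> measurable_fun D b ->
  measurable_fun [set p : T * R | D p.1 /\ a p.1 <= p.2 <= b p.1] h ->
  measurable_fun D (fun t => \int[mu]_(x in `[a t, b t]) h (t, x)).
Proof.
move=> mD ma mb; set E := [set p | _] => mh.
have mE : measurable E by exact: measurable_between.
have mk : measurable_fun setT (EFin \o (h \_ E)).
  by apply/measurable_EFinP; have := (measurable_restrictT h mE).1 mh; apply.
have mpos := @measurable_fun_fubini_tonelli_F _ _ T _ R mu _ (measurable_funepos mk) (@funepos_ge0 _ _ _).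
have mneg := @measurable_fun_fubini_tonelli_F _ _ T _ R mu _ (measurable_funeneg mk) (@funeneg_ge0 _ _ _).
apply: (@eq_measurable_fun _ _ _ _ D
  (fun t => fine (fubini_F mu (EFin \o (h \_ E))^\+%E t - fubini_F mu (EFin \o (h \_ E))^\-%E t)%E)).
  move=> t; rewrite inE => Dt.
  rewrite /Rintegral; congr fine; rewrite [RHS]integral_mkcond [RHS]integralE.
  have e (x : R) : ((t, x) \in E) = (x \in `[a t, b t]%classic).
    by apply/idP/idP; rewrite !inE /E/= in_itv/=; first by case.
  by congr (_ - _)%E; apply: eq_integral => x _;
    rewrite ?funeposE ?funenegE /patch/= e; case: ifP.
apply: measurable_funTS; apply: measurableT_comp => //.
exact: emeasurable_funB.
Qed.
End caratheodory.

(** Outside [D] both functions are replaced by their values at a point of [D],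
    which makes them measurable everywhere. *)
Lemma measurable_fun_pair_on d d1 d2 (T : measurableType d)
    (T1 : measurableType d1) (T2 : measurableType d2) (D : set T)
    (f : T -> T1) (g : T -> T2) : measurable D ->
  measurable_fun D f -> measurable_fun D g ->
  measurable_fun D (fun t => (f t, g t)).
Proof.
move=> mD mf mg.
have [->|/set0P[t0 Dt0]] := eqVneq D set0; first exact: measurable_fun_set0.
pose F t := if t \in D then f t else f t0.
pose G t := if t \in D then g t else g t0.
have DE : (fun t : T => t \in D) @^-1` [set true] = D.
  by apply/seteqP; split => t; [move=> /set_mem|move=> /mem_set].
have mid : measurable_fun setT (fun t : T => t \in D).
  by apply: (measurable_fun_bool true); rewrite setTI DE.
have mF : measurable_fun setT F.
  by apply: measurable_fun_if => //; rewrite setTI ?DE//; exact: measurable_cst.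
have mG : measurable_fun setT G.
  by apply: measurable_fun_if => //; rewrite setTI ?DE//; exact: measurable_cst.
apply: (@eq_measurable_fun _ _ _ _ D (fun t => (F t, G t))).
  by move=> t tD; rewrite /F /G tD.
by apply: measurable_funTS; exact: measurable_fun_pair.
Qed.

Lemma measurable_comp01 (R : realType) d (S : measurableType d) (D : set S)
    d' (U : measurableType d') (f : R -> U) (x : S -> R) :
  measurable_fun `[0 : R, 1]%classic f -> measurable_fun D x ->
  (forall t, D t -> 0 <= x t <= 1) -> measurable_fun D (f \o x).
Proof.
move=> mf mx x01; apply: (measurable_comp _ _ mf mx) => //.
by move=> _ [t Dt <-] /=; rewrite in_itv/=; exact: x01.
Qed.

Lemma measurable_comp_ge0 (R : realType) d (S : measurableType d) (D : set S)
    d' (U : measurableType d') (f : R -> U) (x : S -> R) :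
  measurable_fun `[0 : R, +oo[%classic f -> measurable_fun D x ->
  (forall t, D t -> 0 <= x t) -> measurable_fun D (f \o x).
Proof.
move=> mf mx x0; apply: (measurable_comp _ _ mf mx) => //.
by move=> _ [t Dt <-] /=; rewrite in_itv/= andbT; exact: x0.
Qed.

(** * Norms and Lipschitz functions *)

Section norms.
Context {R : realType}.

Lemma prod_norm_le (U V : normedModType R) (p : U * V) (c : R) :
  (`|p| <= c) = (`|p.1| <= c) && (`|p.2| <= c).
Proof. by rewrite -ge_max. Qed.

Lemma colvec_norm_le n (X : 'cV[R]_n) (c : R) : 0 <= c ->
  (forall i, `|X i 0| <= c) -> `|X| <= c.
Proof.
move=> c0 Xc; rewrite /Num.norm/= mx_normrE.
by apply: bigmax_le => // -[i j] _; rewrite /= ord1.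
Qed.

Lemma colvec_norm_ge n (X : 'cV[R]_n) i : `|X i 0| <= `|X|.
Proof.
rewrite [leRHS]/Num.norm/= mx_normrE.
exact: (le_bigmax _ (fun ij : 'I_n * 'I_1 => `|X ij.1 ij.2|) (i, 0)).
Qed.

Lemma lipschitz_le (U V : normedModType R) (f : U -> V) (k k' : R) :
  k.-lipschitz f -> k <= k' -> forall p q, `|f p - f q| <= k' * `|p - q|.
Proof.
move=> kf kk' p q; have := kf (p, q) => /(_ (conj I I)) /= /le_trans; apply.
by rewrite ler_wpM2r.
Qed.

Lemma locally_lipschitz_within_continuous (V : normedModType R) (A : set R)
    (f : R -> V) :
  (forall x, A x -> exists k : R, forall y, A y -> `|x - y| < 1 ->
     `|f x - f y| <= k * `|x - y|) -> {within A, continuous f}.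
Proof.
move=> lf; apply/subspace_continuousP => x Ax; have [k hk] := lf x Ax.
apply/cvgrPdist_lt => e e0.
have k0 : 0 < `|k| + 1 by rewrite ltr_pwDr.
have d0 : 0 < Num.min 1 (e / (`|k| + 1)) by rewrite lt_min ltr01 divr_gt0.
rewrite /prop_near1 /within /=; exists (Num.min 1 (e / (`|k| + 1))) => // y /=.
rewrite /ball/= lt_min => /andP[xy1 xye] Ay.
apply: (le_lt_trans (hk y Ay xy1)).
rewrite ltr_pdivlMr// mulrC in xye; apply: le_lt_trans xye.
by rewrite ler_wpM2r// (le_trans (ler_norm k))// lerDl.
Qed.

End norms.

(** * Travel times *)

(** [u] and [v] are transported in opposite directions; [speed] and [flux] hold
    what their equations have in common, so that both families of characteristics
    are covered by the same lemmas. *)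
Record speed (R : realType) (lam : R -> R) (l : R) : Prop := {
  speed_measurable : measurable_fun `[0 : R, 1]%classic lam;
  speed_gt0 : forall x, 0 <= x <= 1 -> 0 < lam x;
  speedV_le : forall x, 0 <= x <= 1 -> (lam x)^-1 <= l
}.

Section travel.
Context {R : realType} (lam : R -> R) (l : R) (slam : speed lam l).
Local Notation mu := (@lebesgue_measure R).
Local Notation I01 := `[0 : R, 1]%classic.
Let mlam := speed_measurable slam.
Let lam_gt0 := speed_gt0 slam.
Let lamV_le := speedV_le slam.
Local Notation T := (travel lam 0).

Lemma slowness_bounds x : 0 <= x <= 1 -> 0 <= (lam x)^-1 <= l.
Proof. by move=> x01; rewrite lamV_le// invr_ge0 ltW// lam_gt0. Qed.

Lemma slowness_bound_ge0 : 0 <= l.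
Proof. by have /andP[/le_trans] := @slowness_bounds 0 (ltac:(rewrite lexx ler01//)); apply. Qed.

Lemma measurable_slowness : measurable_fun I01 (fun x => (lam x)^-1).
Proof.
apply: (@eq_measurable_fun _ _ _ _ _ (fun x => lam x `^ (-1))).
  by move=> x; rewrite inE/= in_itv/= => x01; rewrite powR_inv1// ltW// lam_gt0.
exact: (measurableT_comp (measurable_powR _)).
Qed.

Lemma integrable_slowness a b : 0 <= a -> b <= 1 ->
  mu.-integrable `[a, b] (EFin \o (fun x => (lam x)^-1)).
Proof.
move=> a0 b1; apply: (integrable_sub_itv a0 b1).
apply: (@integrable_itv_bounded _ _ _ _ l) => [|x x01].
  exact: measurable_slowness.
by have /andP[? ?] := slowness_bounds x01; rewrite ger0_norm.
Qed.

Lemma travelE a b : 0 <= a <= b -> b <= 1 -> travel lam a b = T b - T a.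
Proof.
move=> /andP[a0 ab] b1; rewrite /travel (@integral_itv_split _ 0 a b) ?a0//.
  by rewrite addrC addKr.
exact: integrable_slowness.
Qed.

Lemma travel00 : T 0 = 0.
Proof. exact: integral_itv_point. Qed.

Lemma travel_increment_bounds a b : 0 <= a <= b -> b <= 1 ->
  0 <= T b - T a <= l * (b - a).
Proof.
move=> ab b1; have /andP[a0 ab'] := ab; rewrite -travelE//; apply/andP; split.
  apply: Rintegral_ge0 => x /=; rewrite in_itv/= => /andP[ax xb].
  by have /andP[] := @slowness_bounds x (ltac:(by rewrite (le_trans a0)//= (le_trans xb))).
rewrite -integral_itv_cst//; apply: le_integral_itv.
- exact: integrable_slowness.
- by apply: (@integrable_itv_bounded _ _ _ _ `|l|).
- by move=> x /andP[ax xb]; rewrite lamV_le// (le_trans a0)//= (le_trans xb).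
Qed.

Lemma travel_le a b : 0 <= a <= b -> b <= 1 -> T a <= T b.
Proof. by move=> ab b1; rewrite -subr_ge0; have /andP[] := travel_increment_bounds ab b1. Qed.

Lemma travel_ge0 x : 0 <= x <= 1 -> 0 <= T x.
Proof. by move=> /andP[x0 x1]; rewrite -[leLHS]travel00 travel_le// lexx. Qed.

(** If the travel time vanished, the slowness, which is positive, would be zero
    almost everywhere on an interval of positive length. *)
Lemma travel_lt a b : 0 <= a -> a < b -> b <= 1 -> T a < T b.
Proof.
move=> a0 ab b1; have ab' : 0 <= a <= b by rewrite a0 ltW.
rewrite lt_neqAle (travel_le ab' b1) andbT.
apply/eqP => Tab.
have iab := integrable_slowness a0 b1.
pose f x : \bar R := ((lam x)^-1)%:E.
have m : measurable_fun `[a, b] f by exact: (measurable_int mu).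
have : (\int[mu]_(x in `[a, b]) `|f x| = 0)%E.
  transitivity (\int[mu]_(x in `[a, b]) f x)%E.
    apply: eq_integral => x; rewrite inE/= in_itv/= => /andP[ax xb].
    by rewrite /f ger0_norm// invr_ge0 ltW// lam_gt0// (le_trans a0 ax) (le_trans xb).
  rewrite -[LHS]fineK; last exact: integrable_fin_num.
  by congr EFin; rewrite -/(Rintegral _ _ _) -/(travel lam a b) travelE// Tab subrr.
move/(ae_eq_integral_abs mu (measurable_itv _) m).
rewrite /ae_eq/= => -[N [mN N0 subN]].
have abN : `[a, b]%classic `<=` N.
  move=> x /= xab; apply: subN => /= /(_ xab) [] /eqP.
  rewrite invr_eq0 => /eqP lx0; move: xab; rewrite in_itv/= => /andP[ax xb].
  by have := @lam_gt0 x; rewrite lx0 ltxx (le_trans a0 ax) (le_trans xb b1) => /(_ isT).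
have : mu `[a, b] = 0%E by apply: (subset_measure0 _ mN abN N0); exact: measurable_itv.
rewrite /= lebesgue_measure_itv/= lte_fin ab -EFinB => -[] /eqP.
by rewrite subr_eq0 gt_eqF.
Qed.

Lemma continuous_travel : {within I01, continuous T}.
Proof.
apply: locally_lipschitz_within_continuous => x /=; rewrite in_itv/= => /andP[x0 x1].
exists l => y; rewrite in_itv/= => /andP[y0 y1] _.
wlog xy : x y x0 x1 y0 y1 / x <= y.
  move=> H; have [/H|/ltW/H] := leP x y; first exact.
  by rewrite distrC (distrC y); apply.
have /andP[? ?] := @travel_increment_bounds x y (ltac:(by rewrite x0)) y1.
by rewrite distrC (distrC x) !ger0_norm// subr_ge0.
Qed.

Lemma measurable_travel : measurable_fun I01 T.
Proof. by apply: subspace_continuous_measurable_fun => //; exact: continuous_travel. Qed.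

(** Exponential growth along a characteristic: with time measured by [T], the
    density is the slowness. *)
Lemma integral_slowness_expR_le a b A : 0 <= a <= b -> b <= 1 -> A != 0 ->
  \int[mu]_(x in `[a, b]) ((lam x)^-1 * expR (A * T x)) <=
  (expR (A * T b) - expR (A * T a)) / A.
Proof.
move=> /andP[a0 ab] b1 A0; apply: (@integral_density_expR_le _ _ _ _ _ l) => //.
- by apply: measurable_funS measurable_slowness => //; exact: sub_itvcc.
- by move=> x /andP[ax xb]; apply: slowness_bounds; rewrite (le_trans a0 ax) (le_trans xb).
- by apply: measurable_funS measurable_travel => //; exact: sub_itvcc.
- by move=> x y /andP[ax xy] yb; rewrite -travelE ?(le_trans a0) ?(le_trans yb).
Qed.

(** The inverse of the travel time, extended to a monotone function on [R] so
    that it is Borel. It is 0 at negative times, which also serves as the foot of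
    a characteristic that starts on the boundary [x = 0]. *)
Definition travel_inv (c : R) : R := sup [set y | 0 <= y <= 1 /\ T y <= c].

Lemma travelK x : 0 <= x <= 1 -> travel_inv (T x) = x.
Proof.
move=> /andP[x0 x1]; rewrite /travel_inv.
have -> : [set y | 0 <= y <= 1 /\ T y <= T x] = `[0, x]%classic.
  apply/seteqP; split => y /=; rewrite in_itv/=.
    move=> [/andP[y0 y1] Tyx]; rewrite y0/= leNgt; apply/negP => xy.
    by have := travel_lt x0 xy y1; rewrite ltNge Tyx.
  move=> /andP[y0 yx]; have y1 := le_trans yx x1.
  by rewrite y0 y1 travel_le ?y0.
exact: sup_itvcc.
Qed.

Lemma travel_surj c : 0 <= c <= T 1 -> exists2 y, 0 <= y <= 1 & T y = c.
Proof.
move=> c01; have [|y] := @IVT R T 0 1 c ler01 continuous_travel.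
  by rewrite travel00 min_l ?max_r// travel_ge0// ler01 lexx.
by rewrite in_itv/=; exists y.
Qed.

Lemma travel_inv_itv c : 0 <= c <= T 1 -> 0 <= travel_inv c <= 1.
Proof. by move=> /travel_surj[y y01 <-]; rewrite travelK. Qed.

Lemma travel_invK c : 0 <= c <= T 1 -> T (travel_inv c) = c.
Proof. by move=> /travel_surj[y y01 <-]; rewrite travelK. Qed.

Lemma travel_inv_neg c : c < 0 -> travel_inv c = 0.
Proof.
move=> c0; rewrite /travel_inv (_ : [set y | _ /\ T y <= c] = set0) ?sup0//.
apply/seteqP; split => // y [y01 yc]; have := travel_ge0 y01.
by rewrite leNgt (le_lt_trans yc).
Qed.

Lemma measurable_travel_inv D : measurable D -> measurable_fun D travel_inv.
Proof.
move=> mD; apply: nondecreasing_measurable => // c c' cc'.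
have ub e : has_ubound [set y | 0 <= y <= 1 /\ T y <= e].
  by exists 1 => y [/andP[]].
have [c0|c0] := ltP c 0.
  rewrite travel_inv_neg// /travel_inv.
  have [->|/set0P[y yS]] := eqVneq [set y | 0 <= y <= 1 /\ T y <= c'] set0.
    by rewrite sup0.
  by have [/andP[/le_trans y0 _] _] := yS; apply: y0; exact: ub_le_sup.
apply: le_sup => //.
- move=> y [y01 yc]; exists y; split; last exact: lexx.
  by split => //; exact: le_trans cc'.
- by exists 0; split; rewrite ?lexx ?ler01// travel00.
- by split => //; exists 0; split; rewrite ?lexx ?ler01// travel00 (le_trans c0).
Qed.

End travel.

(** * Integration along one family of characteristics *)

Record flux (R : realType) (phi : R -> R * R -> R) (L : R) : Prop := {
  flux_measurable : forall q, measurable_fun `[0 : R, 1]%classic (phi ^~ q);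
  flux_lipschitz : forall x, 0 <= x <= 1 ->
    forall p q, `|phi x p - phi x q| <= L * `|p - q|;
  flux0 : forall x, 0 <= x <= 1 -> phi x 0 = 0
}.

Definition bounded_path (R : realType) (a b : R) (w : R -> R * R) : Prop :=
  [/\ measurable_fun `[a, b]%classic (fst \o w),
      measurable_fun `[a, b]%classic (snd \o w)
    & exists M, forall x, a <= x <= b -> `|w x| <= M].

Section flux.
Context {R : realType} (lam : R -> R) (l : R) (slam : speed lam l).
Context (phi : R -> R * R -> R) (L : R) (L0 : 0 <= L) (fphi : flux phi L).
Local Notation mu := (@lebesgue_measure R).
Local Notation I01 := `[0 : R, 1]%classic.
Local Notation T := (travel lam 0).

Lemma measurable_flux_comp d (S : measurableType d) (D : set S) (x u v : S -> R) :
  measurable D -> measurable_fun D x -> (forall t, D t -> 0 <= x t <= 1) ->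
  measurable_fun D u -> measurable_fun D v ->
  measurable_fun D (fun t => phi (x t) (u t, v t) / lam (x t)).
Proof.
move=> mD mx x01 mu_ mv.
have xI (f : R -> R) : measurable_fun I01 f -> measurable_fun D (f \o x).
  move=> mf; apply: (measurable_comp _ _ mf mx) => //.
  by move=> _ [t Dt <-] /=; rewrite in_itv/=; exact: x01.
apply: measurable_funM; last exact: (xI _ (measurable_slowness slam)).
pose q (j : bool) := if j then u else v.
apply: (@measurable_caratheodory _ _ R bool D
  (fun t a => phi (x t) (a true, a false)) q L) => //.
- by move=> a; apply: (xI (phi ^~ (a true, a false))); exact: (flux_measurable fphi).
- by case.
- move=> t a b e Dt e0 abe; apply: (le_trans (flux_lipschitz fphi (x01 t Dt) _ _)).
  by apply: ler_wpM2l => //; rewrite prod_norm_le !abe.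
Qed.

Lemma flux_le x q : 0 <= x <= 1 -> `|phi x q / lam x| <= L * l * `|q|.
Proof.
move=> x01; rewrite normrM mulrAC.
have /andP[s0 sl] := slowness_bounds slam x01.
rewrite (ger0_norm s0); apply: ler_pM => //.
by have := flux_lipschitz fphi x01 q 0; rewrite (flux0 fphi x01) !subr0.
Qed.

Lemma integrable_flux a b w : 0 <= a -> b <= 1 -> bounded_path a b w ->
  mu.-integrable `[a, b] (EFin \o (fun x => phi x (w x) / lam x)).
Proof.
move=> a0 b1 [mu_ mv [M wM]].
have xab x : a <= x <= b -> 0 <= x <= 1.
  by move=> /andP[ax xb]; rewrite (le_trans a0 ax) (le_trans xb).
apply: (@integrable_itv_bounded _ _ _ _ (L * l * M)).
  apply: (@eq_measurable_fun _ _ _ _ _ (fun x => phi x ((fst \o w) x, (snd \o w) x) / lam x)).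
    by move=> x _ /=; case: (w x).
  by apply: measurable_flux_comp => // x /=; rewrite in_itv/=; exact: xab.
move=> x xI; apply: (le_trans (flux_le _ (xab _ xI))).
by apply: ler_wpM2l (wM _ xI); rewrite mulr_ge0// (slowness_bound_ge0 slam).
Qed.

(** Both signs of [A] are used: the weight grows or decays along the
    characteristic according to the direction in which it is followed. *)
Lemma flux_diff_le a b w w' A C : 0 <= a <= b -> b <= 1 -> A != 0 -> 0 <= C ->
  bounded_path a b w -> bounded_path a b w' ->
  (forall x, a <= x <= b -> `|w x - w' x| <= C * expR (A * T x)) ->
  `|\int[mu]_(x in `[a, b]) (phi x (w x) / lam x) -
    \int[mu]_(x in `[a, b]) (phi x (w' x) / lam x)| <=
  L * C * ((expR (A * T b) - expR (A * T a)) / A).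
Proof.
move=> ab b1 A0 C0 bw bw' wC; have /andP[a0 ab'] := ab.
have iw := integrable_flux a0 b1 bw; have iw' := integrable_flux a0 b1 bw'.
have xab x : a <= x <= b -> 0 <= x <= 1.
  by move=> /andP[ax xb]; rewrite (le_trans a0 ax) (le_trans xb).
have iE : mu.-integrable `[a, b] (EFin \o (fun x => (lam x)^-1 * expR (A * T x))).
  have /andP[Ta Tb] : (0 <= T a) && (0 <= T b).
    by rewrite !(travel_ge0 slam)// ?xab// ?ab' lexx.
  apply: (@integrable_itv_bounded _ _ _ _ (l * expR (`|A| * T b))).
    apply: measurable_funM.
      by apply: measurable_funS (measurable_slowness slam) => //; exact: sub_itvcc.
    apply: measurableT_comp => //; apply: measurable_funM => //.
    by apply: measurable_funS (measurable_travel slam) => //; exact: sub_itvcc.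
  move=> x xI; have x01 := xab _ xI; have /andP[s0 sl] := slowness_bounds slam x01.
  have e0 := expR_ge0 (A * T x).
  rewrite (ger0_norm (mulr_ge0 s0 e0)); apply: (ler_pM s0 e0 sl).
  rewrite ler_expR (le_trans (ler_norm _))// normrM ler_wpM2l//.
  have /andP[ax xb] := xI; have /andP[x0 _] := x01.
  by rewrite ger0_norm ?(travel_ge0 slam)// (travel_le slam)// x0.
apply: (le_trans (integral_diff_le iw iw' (integrable_scale (L * C) iE) _)).
  move=> x xI; have x01 := xab _ xI; have /andP[s0 sl] := slowness_bounds slam x01.
  rewrite -mulrBl normrM (ger0_norm s0).
  have -> : L * C * ((lam x)^-1 * expR (A * T x)) =
    L * (C * expR (A * T x)) * (lam x)^-1 by ring.
  apply: ler_wpM2r => //; apply: (le_trans (flux_lipschitz fphi x01 _ _)).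
  exact: (ler_wpM2l L0 (wC x xI)).
rewrite RintegralZl//; apply: ler_wpM2l; first exact: mulr_ge0.
exact: (integral_slowness_expR_le slam).
Qed.

End flux.

Lemma bounded_path_sub (R : realType) (a b a' b' : R) (w : R -> R * R) :
  a <= a' -> b' <= b -> bounded_path a b w -> bounded_path a' b' w.
Proof.
move=> aa' b'b [m1 m2 [M hM]]; have sub := sub_itvcc aa' b'b; split.
- by apply: measurable_funS m1.
- by apply: measurable_funS m2.
- by exists M => x /andP[a'x xb']; apply: hM; rewrite (le_trans aa')// (le_trans xb').
Qed.

Section weighted_flux.
Context {R : realType} (lam : R -> R) (l : R) (slam : speed lam l).
Context (phi : R -> R * R -> R) (L : R) (L0 : 0 <= L) (fphi : flux phi L).
Local Notation mu := (@lebesgue_measure R).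
Local Notation T := (travel lam 0).

Lemma flux_diff_growth a b w w' A C c : 0 <= a <= b -> b <= 1 -> 0 < A -> 0 <= C ->
  bounded_path a b w -> bounded_path a b w' ->
  (forall x, a <= x <= b -> `|w x - w' x| <= C * expR (A * (c + T x))) ->
  `|\int[mu]_(x in `[a, b]) (phi x (w x) / lam x) -
    \int[mu]_(x in `[a, b]) (phi x (w' x) / lam x)| <=
  L * C / A * expR (A * (c + T b)).
Proof.
move=> ab b1 A0 C0 bw bw' wC.
have e0 := expR_ge0 (A * c).
have /(_ _)/le_trans := @flux_diff_le _ _ _ slam _ _ L0 fphi a b w w' A (C * expR (A * c)) ab b1
  (lt0r_neq0 A0) (mulr_ge0 C0 e0) bw bw'.
apply; first by move=> x /wC; rewrite mulrDr expRD mulrA.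
rewrite mulrDr expRD.
have -> : L * C / A * (expR (A * c) * expR (A * T b)) =
  L * (C * expR (A * c)) * (expR (A * T b) / A) by ring.
apply: ler_wpM2l; first by rewrite !mulr_ge0.
by apply: ler_wpM2r; [rewrite invr_ge0 ltW | rewrite lerBlDr lerDl expR_ge0].
Qed.

Lemma flux_diff_decay a b w w' A C c : 0 <= a <= b -> b <= 1 -> 0 < A -> 0 <= C ->
  bounded_path a b w -> bounded_path a b w' ->
  (forall x, a <= x <= b -> `|w x - w' x| <= C * expR (A * (c - T x))) ->
  `|\int[mu]_(x in `[a, b]) (phi x (w x) / lam x) -
    \int[mu]_(x in `[a, b]) (phi x (w' x) / lam x)| <=
  L * C / A * expR (A * (c - T a)).
Proof.
move=> ab b1 A0 C0 bw bw' wC.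
have e0 := expR_ge0 (A * c).
have nA0 : - A != 0 by rewrite oppr_eq0 lt0r_neq0.
have /(_ _)/le_trans := @flux_diff_le _ _ _ slam _ _ L0 fphi a b w w' (- A) (C * expR (A * c)) ab b1
  nA0 (mulr_ge0 C0 e0) bw bw'.
apply; first by move=> x /wC; rewrite mulrDr mulrN -mulNr expRD mulrA.
rewrite mulrDr mulrN -mulNr expRD.
have -> : L * C / A * (expR (A * c) * expR (- A * T a)) =
  L * (C * expR (A * c)) * (expR (- A * T a) / A) by ring.
apply: ler_wpM2l; first by rewrite !mulr_ge0.
rewrite invrN mulrN -mulNr opprB.
by apply: ler_wpM2r; [rewrite invr_ge0 ltW | rewrite lerBlDr lerDl expR_ge0].
Qed.

End weighted_flux.

Section flux_zero.
Context {R : realType} (lam : R -> R) (l : R) (slam : speed lam l).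
Context (phi : R -> R * R -> R) (L : R) (L0 : 0 <= L) (fphi : flux phi L).
Local Notation mu := (@lebesgue_measure R).
Local Notation T := (travel lam 0).

Lemma bounded_path0 (a b : R) : bounded_path a b (fun=> (0 : R * R)).
Proof. by split; [exact: measurable_cst|exact: measurable_cst|exists 0 => x _; rewrite normr0]. Qed.

Lemma integral_flux0 a b : 0 <= a -> b <= 1 ->
  \int[mu]_(x in `[a, b]) (phi x 0 / lam x) = 0.
Proof.
move=> a0 b1; rewrite (@eq_integral_itv _ _ _ _ (fun=> 0)).
  have [ab|ba] := leP a b; first by rewrite integral_itv_cst// mul0r.
  by rewrite set_itv_ge ?bnd_simp -?ltNge// Rintegral_set0.
by move=> x /andP[ax xb]; rewrite (flux0 fphi) ?mul0r// (le_trans a0 ax) (le_trans xb).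
Qed.

Lemma flux_growth a b w A C c : 0 <= a <= b -> b <= 1 -> 0 < A -> 0 <= C ->
  bounded_path a b w ->
  (forall x, a <= x <= b -> `|w x| <= C * expR (A * (c + T x))) ->
  `|\int[mu]_(x in `[a, b]) (phi x (w x) / lam x)| <=
  L * C / A * expR (A * (c + T b)).
Proof.
move=> ab b1 A0 C0 bw wC; have /andP[a0 _] := ab.
have := @flux_diff_growth _ _ _ slam _ _ L0 fphi a b w (fun=> 0) A C c ab b1 A0 C0
  bw (bounded_path0 a b).
rewrite integral_flux0// subr0; apply => x xI; rewrite subr0; exact: wC.
Qed.

End flux_zero.

Lemma flux_integral_lipschitz (R : realType) (lam : R -> R) (l : R)
    (phi : R -> R * R -> R) (L : R) (w : R -> R * R) :
  speed lam l -> 0 <= L -> flux phi L -> bounded_path 0 1 w ->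
  exists M, forall x y, 0 <= x <= 1 -> 0 <= y <= 1 ->
    `|\int[@lebesgue_measure R]_(xi in `[0, x]) (phi xi (w xi) / lam xi) -
      \int[@lebesgue_measure R]_(xi in `[0, y]) (phi xi (w xi) / lam xi)| <=
    M * `|x - y|.
Proof.
move=> slam L0 fphi bw; have [_ _ [M hM]] := bw; exists (L * l * M) => x y.
wlog xy : x y / y <= x.
  move=> H x01 y01; have [/H|/ltW xy] := leP y x; first exact.
  by rewrite distrC (distrC x); apply: H.
move=> /andP[x0 x1] /andP[y0 y1].
rewrite (ger0_norm (x := x - y)) ?subr_ge0//.
apply: integral_increment_le; first by rewrite y0.
  by apply: (integrable_flux slam L0 fphi) => //; exact: bounded_path_sub bw.
move=> r /andP[yr rx]; have r01 : 0 <= r <= 1 by rewrite (le_trans y0) ?(le_trans rx).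
apply: (le_trans (flux_le slam fphi _ r01)).
by apply: ler_wpM2l (hM _ r01); rewrite mulr_ge0// (slowness_bound_ge0 slam).
Qed.

(** * The data and the integral equations *)

(** All that is assumed of the data except the stability of the nominal
    equation, with one Lipschitz constant [L] and one bound [l] of the
    slownesses. *)
Record regular (R : realType) n (P : system R n) (K : 'cV[R]_n -> R -> R)
    (L l : R) : Prop := {
  reg_L : 0 <= L;
  reg_lamu : speed (lamu P) l;
  reg_lamv : speed (lamv P) l;
  reg_fu : flux (fu P) L;
  reg_fv : flux (fv P) L;
  reg_f0m : forall Y v i, measurable_fun `[0 : R, +oo[%classic (fun t => f0 P Y v t i 0);
  reg_f0 : forall t, 0 <= t -> forall Y v Y' v',
    `|f0 P Y v t - f0 P Y' v' t| <= L * `|(Y - Y', v - v')|;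
  reg_f00 : forall t, 0 <= t -> f0 P 0 0 t = 0;
  reg_g0m : forall Y v, measurable_fun `[0 : R, +oo[%classic (fun t => g0 P Y v t);
  reg_g0 : forall t, 0 <= t -> forall Y v Y' v',
    `|g0 P Y v t - g0 P Y' v' t| <= L * `|(Y - Y', v - v')|;
  reg_g00 : forall t, 0 <= t -> g0 P 0 0 t = 0;
  reg_Km : forall Y, measurable_fun `[0 : R, +oo[%classic (fun t => K Y t);
  reg_K : forall t, 0 <= t -> forall Y Y', `|K Y t - K Y' t| <= L * `|Y - Y'|;
  reg_K0 : forall t, 0 <= t -> K 0 t = 0
}.

Lemma regular_data (R : realType) n (P : system R n) (K : 'cV[R]_n -> R -> R) :
  measurable_data P K -> S1 P -> S2 P -> S3 P -> S4 P K ->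
  exists L l, regular P K L l.
Proof.
move=> [[mlu mlv] mf mf0 mg0 mK] [lam0 [l lamV]] [L [Lf Lf0 Lg0]].
move=> [f00 fg00] [[L' LK] K0 _].
exists (Num.max `|L| `|L'|), l.
have LL : L <= Num.max `|L| `|L'| by rewrite le_max ler_norm.
have LL' : L' <= Num.max `|L| `|L'| by rewrite le_max ler_norm orbT.
split=> //.
- split => // x x01; first by have [] := lam0 x x01.
  by have := lamV x x01; rewrite ge_max => /andP[].
- split => // x x01; first by have [] := lam0 x x01.
  by have := lamV x x01; rewrite ge_max => /andP[].
- split => [q|x x01|x x01]; first by have [] := mf q.
  + by have [h _] := Lf x x01; exact: lipschitz_le h LL.
  + by have [] := f00 x x01.
- split => [q|x x01|x x01]; first by have [] := mf q.
  + by have [_ h] := Lf x x01; exact: lipschitz_le h LL.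
  + by have [] := f00 x x01.
- move=> t t0 Y v Y' v'; exact: (lipschitz_le (Lf0 t t0) LL (Y, v) (Y', v')).
- by move=> t t0; have [] := fg00 t t0.
- move=> t t0 Y v Y' v'; exact: (lipschitz_le (Lg0 t t0) LL (Y, v) (Y', v')).
- by move=> t t0; have [] := fg00 t t0.
- by move=> t t0 Y Y'; exact: (lipschitz_le (LK t t0) LL').
Qed.

Section regular.
Context {R : realType} {n : nat} (P : system R n) (K : 'cV[R]_n -> R -> R).
Context (L l : R) (reg : regular P K L l).
Local Notation mu := (@lebesgue_measure R).
Local Notation I01 := `[0 : R, 1]%classic.
Local Notation Gu := (travel (lamu P) 0).
Local Notation Gv := (travel (lamv P) 0).
Local Notation tau := (travel (lamv P) 0 1).
Implicit Types (w : R -> R -> R * R) (X : R -> 'cV[R]_n) (Om : set (R * R)).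

Let L0 : 0 <= L := reg_L reg.
Let su := reg_lamu reg.
Let sv := reg_lamv reg.

Lemma tau_ge0 : 0 <= tau.
Proof. by rewrite (travel_ge0 sv)// ler01 lexx. Qed.

Lemma tau_vE t x : 0 <= x <= 1 -> tau_v P t x = t + (tau - Gv x).
Proof. by move=> x01; rewrite /tau_v (travelE sv). Qed.

Definition in_strip (Om : set (R * R)) : Prop :=
  measurable Om /\ forall p, Om p -> 0 <= p.1 <= 1.

Lemma halfstrip_in_strip : in_strip (@halfstrip R).
Proof.
split=> [|p []//].
have -> : @halfstrip R = I01 `*` `[0, +oo[%classic.
  by apply/seteqP; split => p; rewrite /halfstrip/= !in_itv/= andbT.
by apply: measurableX; exact: measurable_itv.
Qed.

Lemma determinate_in_strip t : in_strip (determinate P t).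
Proof.
split=> [|p []//].
have -> : determinate P t = [set p | I01 p.1 /\ t <= p.2 <= tau_v P t p.1].
  by apply/seteqP; split => p; rewrite /determinate/= in_itv.
apply: measurable_between => //.
apply: (@eq_measurable_fun _ _ _ _ _ (fun x => t + (tau - Gv x))).
  by move=> x; rewrite inE/= in_itv/= => x01; rewrite tau_vE.
by apply: measurable_funD => //; apply: measurable_funB => //; exact: (measurable_travel sv).
Qed.

Lemma f0_le t (Y : 'cV[R]_n) v : 0 <= t -> `|f0 P Y v t| <= L * Num.max `|Y| `|v|.
Proof.
move=> t0; have := reg_f0 reg t0 Y v 0 0.
by rewrite (reg_f00 reg t0) !subr0.
Qed.

Lemma g0_le t (Y : 'cV[R]_n) v : 0 <= t -> `|g0 P Y v t| <= L * Num.max `|Y| `|v|.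
Proof.
move=> t0; have := reg_g0 reg t0 Y v 0 0.
by rewrite (reg_g00 reg t0) !subr0.
Qed.

Lemma K_le t (Y : 'cV[R]_n) : 0 <= t -> `|K Y t| <= L * `|Y|.
Proof.
by move=> t0; have := reg_K reg t0 Y 0; rewrite (reg_K0 reg t0) !subr0.
Qed.

Section broad.
Variables (Om : set (R * R)) (t0 : R) (w : R -> R -> R * R) (X : R -> 'cV[R]_n).
Hypothesis strOm : in_strip Om.
Hypothesis bwX : broad_solution P Om t0 w X.

Lemma broad_path (a b : R) (c : R -> R) (T : R) : measurable_fun `[a, b] c ->
  (forall x, a <= x <= b -> Om (x, c x)) -> (forall x, a <= x <= b -> c x <= T) ->
  bounded_path a b (fun x => w x (c x)).
Proof.
move=> mc cOm cT; have [[mw /(_ T)[M wM]] _ _ _ _] := bwX.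
have mwc : measurable_fun `[a, b] (fun x => w x (c x)).
  apply: (@measurable_comp _ _ _ _ _ _ Om (fun p => w p.1 p.2) _ (fun x => (x, c x))) => //.
  - by have [] := strOm.
  - by move=> _ [x /= + <-]; rewrite in_itv/=; exact: cOm.
  - by apply: measurable_fun_pair_on.
split.
- by apply: (measurableT_comp measurable_fst mwc).
- by apply: (measurableT_comp measurable_snd mwc).
- by exists M => x xab; apply: wM; [exact: cOm|exact: cT].
Qed.

(** In the coordinates [Gu] and [Gv] the characteristic of [u] through [(x, s)]
    is [s - Gu x + Gu xi], where [s - Gu x] is the time at which it leaves
    [x = 0], and that of [v] is [s + Gv x - Gv xi], where [s + Gv x] is the time
    at which it arrives there. The exponential weights are functions of these. *)
Lemma broad_u x s y : Om (x, s) -> 0 <= y <= x -> Om (y, s - Gu x + Gu y) ->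
  (w x s).1 = (w y (s - Gu x + Gu y)).1 +
    \int[mu]_(xi in `[y, x]) (fu P xi (w xi (s - Gu x + Gu xi)) / lamu P xi).
Proof.
move=> xs yx; have [_ /(_ x s y xs yx) + _ _ _] := bwX.
have /andP[x0 x1] := strOm.2 _ xs.
have chE xi : y <= xi <= x -> s - travel (lamu P) xi x = s - Gu x + Gu xi.
  move=> /andP[yxi xix]; have /andP[y0 _] := yx.
  by rewrite (travelE su) ?(le_trans y0)// opprB addrA addrAC.
rewrite /= chE ?lexx ?(andP yx).2// => + yOm => /(_ yOm) ->.
by congr (_ + _); apply: eq_integral_itv => xi xiI; rewrite chE.
Qed.

Lemma broad_v x s y : Om (x, s) -> x <= y <= 1 -> Om (y, s + Gv x - Gv y) ->
  (w x s).2 = (w y (s + Gv x - Gv y)).2 +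
    \int[mu]_(xi in `[x, y]) (fv P xi (w xi (s + Gv x - Gv xi)) / lamv P xi).
Proof.
move=> xs xy yOm; have /andP[x0 x1] := strOm.2 _ xs; have /andP[xy' y1] := xy.
have [ch chE] : exists2 ch : R -> R,
    forall xi, x <= xi <= y -> ch xi = s + Gv x - Gv xi &
    Om (y, ch y) -> (w x s).2 = (w y (ch y)).2 +
      \int[mu]_(xi in `[x, y]) (fv P xi (w xi (ch xi)) / lamv P xi).
  have [_ _ bv _ _] := bwX; exists (fun xi => s - travel (lamv P) x xi).
    move=> xi /andP[xxi xiy]; rewrite (travelE sv); [ring|exact/andP|exact: le_trans y1].
  exact: (bv x s y xs xy).
have {}yOm : Om (y, ch y) by rewrite chE// xy' lexx.
move=> /(_ yOm) ->; congr (_ + _); last by apply: eq_integral_itv => xi /chE ->.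
by rewrite chE// xy' lexx.
Qed.

End broad.
End regular.

Section ode.
Context {R : realType} {n : nat} (P : system R n) (K : 'cV[R]_n -> R -> R).
Context (L l : R) (reg : regular P K L l).
Local Notation mu := (@lebesgue_measure R).
Implicit Types (w : R -> R -> R * R) (X : R -> 'cV[R]_n) (Om : set (R * R)).

Let L0 : 0 <= L := reg_L reg.

(** The finitely many coordinates of [X], and [v], are the arguments to which
    the Caratheodory criterion is applied. *)
Lemma measurable_state_comp (D : set R) (F : 'cV[R]_n -> R -> R -> R) X (v : R -> R) :
  measurable D -> (forall t, D t -> 0 <= t) ->
  (forall Y r, measurable_fun `[0 : R, +oo[%classic (F Y r)) ->
  (forall t, 0 <= t -> forall Y r Y' r',
     `|F Y r t - F Y' r' t| <= L * `|(Y - Y', r - r')|) ->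
  (forall j, measurable_fun D (fun t => X t j 0)) -> measurable_fun D v ->
  measurable_fun D (fun t => F (X t) (v t) t).
Proof.
move=> mD D0 mF lF mX mv.
pose q (j : option 'I_n) := if j is Some i then (fun t => X t i 0) else v.
pose f t (a : option 'I_n -> R) := F (\col_i a (Some i)) (a None) t.
apply: (@eq_measurable_fun _ _ _ _ _ (fun t => f t (q ^~ t))).
  by move=> t _; rewrite /f; congr (F _ _ _); apply/colP => i; rewrite mxE.
apply: (@measurable_caratheodory _ _ R _ D f q L) => //.
- move=> a; apply: measurable_funS (mF _ _) => // t Dt /=.
  by rewrite in_itv/= D0.
- by case.
- move=> t a b e Dt e0 abe; apply: (le_trans (lF _ (D0 _ Dt) _ _ _ _)).
  apply: ler_wpM2l => //; rewrite prod_norm_le abe andbT.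
  by apply: colvec_norm_le => // i; rewrite !mxE.
Qed.

Lemma f0_coord_lipschitz t i : 0 <= t -> forall Y r Y' r',
  `|f0 P Y r t i 0 - f0 P Y' r' t i 0| <= L * `|(Y - Y', r - r')|.
Proof.
move=> t0 Y r Y' r'; apply: le_trans (reg_f0 reg t0 Y r Y' r').
by have := colvec_norm_ge (f0 P Y r t - f0 P Y' r' t) i; rewrite !mxE.
Qed.

Lemma integrable_f0_comp (a b : R) X (v : R -> R) i M : 0 <= a ->
  (forall j, measurable_fun `[a, b] (fun t => X t j 0)) ->
  measurable_fun `[a, b] v ->
  (forall t, a <= t <= b -> `|X t| <= M /\ `|v t| <= M) ->
  mu.-integrable `[a, b] (EFin \o (fun t => f0 P (X t) (v t) t i 0)).
Proof.
move=> a0 mX mv bM; apply: (@integrable_itv_bounded _ _ _ _ (L * M)).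
  apply: (@measurable_state_comp _ (fun Y r t => f0 P Y r t i 0)) => //.
  - by move=> t /=; rewrite in_itv/= => /andP[/(le_trans a0)].
  - by move=> Y r; exact: (reg_f0m reg).
  - by move=> t t0 Y r Y' r'; exact: f0_coord_lipschitz.
move=> t tab; have /andP[/(le_trans a0) t0 _] := tab.
apply: (le_trans (colvec_norm_ge _ _)); apply: (le_trans (f0_le reg _ _ t0)).
by have [hX hv] := bM _ tab; rewrite ler_wpM2l// ge_max hX.
Qed.

Lemma within_continuous_state (a b : R) X : a <= b ->
  {within `[a, b], continuous X} ->
  (forall j, measurable_fun `[a, b] (fun t => X t j 0)) /\
  exists M, forall t, a <= t <= b -> `|X t| <= M.
Proof.
move=> ab cX; split.
  move=> j; apply: subspace_continuous_measurable_fun => // x.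
  apply: (@continuous_comp _ _ _ (X : subspace `[a, b] -> _) (fun Y : 'cV[R]_n => Y j 0)).
    exact: cX.
  exact: coord_continuous.
have [|c cab hc] := @EVT_max R (fun t => `|X t|) a b ab.
  move=> x; apply: (@continuous_comp _ _ _ (X : subspace `[a, b] -> _) (fun Y : 'cV[R]_n => `|Y|)).
    exact: cX.
  exact: norm_continuous.
by exists `|X c| => t tab; apply: hc; rewrite in_itv.
Qed.

Section broad.
Variables (Om : set (R * R)) (t0 b : R) (w : R -> R -> R * R) (X : R -> 'cV[R]_n).
Hypothesis strOm : in_strip Om.
Hypothesis bwX : broad_solution P Om t0 w X.
Hypothesis t00 : 0 <= t0.
Hypothesis t0b : forall s, t0 <= s <= b -> Om (0, s).

Lemma broad_trace : t0 <= b ->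
  [/\ forall j, measurable_fun `[t0, b] (fun t => X t j 0),
      measurable_fun `[t0, b] (fun t => (w 0 t).2)
    & exists M, forall t, t0 <= t <= b -> `|X t| <= M /\ `|(w 0 t).2| <= M].
Proof.
move=> t0b'; have [[mw /(_ b)[M hM]] _ _ [cX _] _] := bwX.
have cX' : {within `[t0, b], continuous X}.
  by apply: continuous_subspaceW cX => s /=; rewrite in_itv/=; exact: t0b.
have [mX [M' hM']] := within_continuous_state t0b' cX'.
split=> //.
  have m0 : measurable_fun `[t0, b] (fun t => w 0 t).
    apply: (@measurable_comp _ _ _ _ _ _ Om (fun p => w p.1 p.2) _ (fun t => (0, t))) => //.
    - by have [] := strOm.
    - by move=> _ [x /= + <-]; rewrite in_itv/=; exact: t0b.
    - by apply: measurable_fun_pair_on.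
  by apply: (measurableT_comp measurable_snd m0).
exists (Num.max M' M) => t tI; rewrite !le_max hM'//=; split => //.
have /andP[_ tb] := tI.
by have := hM 0 t (t0b tI) tb; rewrite prod_norm_le => /andP[_ ->]; rewrite orbT.
Qed.

Lemma broad_ode_integrable i : mu.-integrable `[t0, b]
  (EFin \o (fun s => f0 P (X s) (w 0 s).2 s i 0)).
Proof.
have [t0b'|bt0] := leP t0 b; last by rewrite set_itv_ge ?bnd_simp -?ltNge//; exact: integrable_set0.
by have [mX mv [M hM]] := broad_trace t0b'; exact: (integrable_f0_comp _ _ mX mv hM).
Qed.

Lemma broad_ode_from a s i : t0 <= a <= s -> s <= b ->
  X s i 0 = X a i 0 + \int[mu]_(r in `[a, s]) f0 P (X r) (w 0 r).2 r i 0.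
Proof.
move=> /andP[t0a as_] sb; have [_ _ _ [_ oX] _] := bwX.
rewrite (oX s (t0b _)) ?(le_trans t0a)// (oX a (t0b _)) ?t0a ?(le_trans as_)//.
rewrite (@integral_itv_split _ t0 a s) ?t0a ?addrA//.
by apply: (integrable_sub_itv _ sb (broad_ode_integrable i)).
Qed.

End broad.
End ode.

(** * Continuous dependence over the determinate set *)

(** An index for all scalar unknowns: one real function on [slot R n] collects
    [u], [v] and the coordinates of [X], and one weighted supremum norm controls
    them together. *)
Variant slot (R : realType) (n : nat) :=
  SU of R * R | SV of R * R | SX of R & 'I_n.

Section dependence.
Context {R : realType} {n : nat} (P : system R n) (K : 'cV[R]_n -> R -> R).
Context (L l : R) (reg : regular P K L l).
Local Notation Gu := (travel (lamu P) 0).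
Local Notation Gv := (travel (lamv P) 0).
Local Notation tau := (travel (lamv P) 0 1).
Implicit Types (w : R -> R -> R * R) (X : R -> 'cV[R]_n) (Om : set (R * R)).

Let L0 : 0 <= L := reg_L reg.
Let su := reg_lamu reg.
Let sv := reg_lamv reg.

Lemma determinateP t x s :
  determinate P t (x, s) <-> [/\ 0 <= x <= 1, t <= s & s + Gv x <= t + tau].
Proof.
rewrite /determinate/=; split.
  by move=> [x01 /andP[ts]]; rewrite (tau_vE reg)// addrA lerBrDr.
by move=> [x01 ts xs]; split => //; rewrite ts (tau_vE reg)// addrA lerBrDr.
Qed.

(** Where the characteristic through [(x, s)] is at time [t]. If that of [u] has
    left [x = 0] later than [t], then [u_foot] is 0, that is, its foot on the
    boundary. *)
Definition u_foot (t x s : R) : R := travel_inv (lamu P) (t - (s - Gu x)).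
Definition v_foot (t x s : R) : R := travel_inv (lamv P) (s + Gv x - t).

Lemma travel_le_inv lam (slam : speed lam l) x y : 0 <= x <= 1 -> 0 <= y <= 1 ->
  travel lam 0 x <= travel lam 0 y -> x <= y.
Proof.
move=> /andP[x0 x1] /andP[y0 y1]; rewrite leNgt => h; rewrite leNgt.
by apply: contra h => yx; rewrite (travel_lt slam).
Qed.

Lemma u_footP t x s : 0 <= x <= 1 -> t <= s -> s - Gu x <= t ->
  0 <= u_foot t x s <= x /\ s - Gu x + Gu (u_foot t x s) = t.
Proof.
move=> x01 ts st; have /andP[x0 x1] := x01.
have c01 : 0 <= t - (s - Gu x) <= Gu 1.
  rewrite subr_ge0 st/= lerBlDr (le_trans ts)//.
  by rewrite addrCA lerDl subr_ge0 (travel_le su) ?x0.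
have y01 := travel_inv_itv su c01; have yE := travel_invK su c01.
rewrite /u_foot yE; split; last by ring.
have /andP[-> _] := y01; apply: (travel_le_inv su) => //.
by rewrite yE; move: ts; lra.
Qed.

Lemma v_footP t x s : 0 <= x <= 1 -> t <= s -> s + Gv x <= t + tau ->
  x <= v_foot t x s <= 1 /\ s + Gv x - Gv (v_foot t x s) = t.
Proof.
move=> x01 ts st.
have c01 : 0 <= s + Gv x - t <= tau.
  have := travel_ge0 sv x01; move: ts st; lra.
have y01 := travel_inv_itv sv c01; have yE := travel_invK sv c01.
rewrite /v_foot yE; split; last by ring.
have /andP[_ ->] := y01; rewrite andbT; apply: (travel_le_inv sv) => //.
by rewrite yE; move: ts; lra.
Qed.

Lemma broad_path_u Om t0 w X (a b c : R) : in_strip Om -> broad_solution P Om t0 w X ->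
  0 <= a -> b <= 1 -> (forall x, a <= x <= b -> Om (x, c + Gu x)) ->
  bounded_path a b (fun x => w x (c + Gu x)).
Proof.
move=> sOm bw a0 b1 cOm; apply: (broad_path sOm bw (T := c + Gu 1)) => //.
  apply: measurable_funD => //.
  by apply: measurable_funS (measurable_travel su) => //; exact: sub_itvcc.
move=> x /andP[ax xb]; rewrite lerD2l (travel_le su)//.
by rewrite (le_trans a0) ?(le_trans xb).
Qed.

Lemma broad_path_v Om t0 w X (a b r : R) : in_strip Om -> broad_solution P Om t0 w X ->
  0 <= a -> b <= 1 -> (forall x, a <= x <= b -> Om (x, r - Gv x)) ->
  bounded_path a b (fun x => w x (r - Gv x)).
Proof.
move=> sOm bw a0 b1 cOm; apply: (broad_path sOm bw (T := r)) => //.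
  apply: measurable_funB => //.
  by apply: measurable_funS (measurable_travel sv) => //; exact: sub_itvcc.
move=> x /andP[ax xb]; rewrite gerBl (travel_ge0 sv)//.
by rewrite (le_trans a0 ax) (le_trans xb).
Qed.

Definition kappa : R := 1 + 4 * L.
Definition rate : R := 1 + 4 * L * kappa.

Lemma kappa_ge1 : 1 <= kappa. Proof. by rewrite /kappa lerDl mulr_ge0. Qed.
Lemma kappa_gt0 : 0 < kappa. Proof. exact: lt_le_trans kappa_ge1. Qed.
Lemma rate_gt0 : 0 < rate.
Proof. by rewrite /rate ltr_wpDr// !mulr_ge0// ltW// kappa_gt0. Qed.
Lemma L_kappa : L <= kappa / 4. Proof. by rewrite /kappa; lra. Qed.
Lemma L_kappa_rate : L * kappa / rate <= 1 / 4.
Proof. by rewrite ler_pdivrMr ?rate_gt0// /rate; lra. Qed.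

(** The difference of the solutions is measured with the weight
    [expR (rate * (s - t))], times [kappa] for [u]. The rate makes the terms under
    an integral small; the factor [kappa] makes small the reflection at [x = 0],
    which feeds [X] and [v] into [u] without any integration. *)
Lemma determinate_dependence t w X w' X' B :
  0 <= t -> 0 <= B ->
  broad_solution P (determinate P t) t w X ->
  broad_solution P (determinate P t) t w' X' ->
  (forall x, 0 <= x <= 1 -> `|w x t - w' x t| <= B) -> `|X t - X' t| <= B ->
  let C := 2 * kappa * expR (rate * tau) * B in
  (forall x s, determinate P t (x, s) -> `|w x s - w' x s| <= C) /\
  (forall s, t <= s <= t + tau -> `|X s - X' s| <= C).
Proof.
move=> t0 B0 bw bw' wB XB C.
have strD := determinate_in_strip reg t.
have tau0 := tau_ge0 reg.
have k1 := kappa_ge1; have k0 := kappa_gt0; have A0 := rate_gt0.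
have k0' := ltW k0.
have D0 s : t <= s <= t + tau -> determinate P t (0, s).
  by move=> /andP[ts st]; apply/determinateP; rewrite travel00 addr0 lexx ler01.
have tt : t <= t + tau by rewrite lerDl.
pose E s := expR (rate * (s - t)).
have E0 s : 0 <= E s by exact: expR_ge0.
have E1 s : t <= s -> 1 <= E s.
  by move=> ts; rewrite /E -expR0 ler_expR mulr_ge0 ?subr_ge0// ltW.
have Emono s s' : s <= s' -> E s <= E s'.
  by move=> ss'; rewrite /E ler_expR ler_wpM2l ?lerB// ltW.
(* the slots in the determinate set, the difference of the solutions there and
   its weight *)
pose S (i : slot R n) := match i with
  | SU p | SV p => determinate P t p | SX s _ => t <= s <= t + tau end.
pose d (i : slot R n) := match i with
  | SU p => `|(w p.1 p.2).1 - (w' p.1 p.2).1|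
  | SV p => `|(w p.1 p.2).2 - (w' p.1 p.2).2|
  | SX s i => `|X s i 0 - X' s i 0| end.
pose om (i : slot R n) := match i with
  | SU p => kappa * E p.2 | SV p => E p.2 | SX s i => E s end.
have om0 i : S i -> 0 <= om i by case: i => [p|p|s i] _ //=; rewrite mulr_ge0.
have [M M0 dM] : exists2 M, 0 <= M & forall i, S i -> d i <= M * om i.
  have [[_ /(_ (t + tau))[M1 hM1]] _ _ _ _] := bw.
  have [[_ /(_ (t + tau))[M2 hM2]] _ _ _ _] := bw'.
  have [_ _ [M3 hM3]] := broad_trace strD bw D0 tt.
  have [_ _ [M4 hM4]] := broad_trace strD bw' D0 tt.
  pose M := `|M1| + `|M2| + `|M3| + `|M4|.
  have M0 : 0 <= M by rewrite !addr_ge0.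
  have detw p : determinate P t p -> `|w p.1 p.2 - w' p.1 p.2| <= M.
    case: p => x s Dp; have [/andP[x0 x1] ts st] := (determinateP t x s).1 Dp.
    have st' : s <= t + tau.
      by rewrite (le_trans _ st)// lerDl (travel_ge0 sv)// x0.
    rewrite (le_trans (ler_normB _ _))// /M -addrA ler_wpDr ?addr_ge0//.
    by rewrite lerD// (le_trans _ (ler_norm _))// ?hM1 ?hM2.
  have om1 i : S i -> 1 <= om i.
    case: i => [[x s]|[x s]|s i] /=; last by move=> /andP[/E1].
      by move=> /(determinateP t x s).1 [_ /E1 e1 _]; rewrite -[leLHS]mulr1 ler_pM.
    by move=> /(determinateP t x s).1 [_ /E1 e1 _].
  exists M => // i Si; apply: (@le_trans _ _ M); last first.
    by rewrite -[leLHS]mulr1 ler_wpM2l// om1.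
  case: i Si => [p|p|s i] /=; first by move=> /detw; rewrite prod_norm_le => /andP[].
    by move=> /detw; rewrite prod_norm_le => /andP[].
  move=> sI; have [h3 _] := hM3 s sI; have [h4 _] := hM4 s sI.
  have := colvec_norm_ge (X s - X' s) i; rewrite !mxE => /le_trans; apply.
  rewrite (le_trans (ler_normB _ _))// /M -addrA ler_wpDl ?addr_ge0//.
  by rewrite lerD// (le_trans _ (ler_norm _)).
have q := L_kappa_rate.
have LA : L / rate <= 1 / 4.
  apply: le_trans q; rewrite ler_wpM2r ?invr_ge0 ?(ltW A0)//.
  by rewrite -[leLHS]mulr1 ler_wpM2l.
have step C1 : 0 <= C1 -> (forall i, S i -> d i <= C1 * om i) ->
    forall i, S i -> d i <= (B + C1 / 2) * om i.
  move=> C10 H.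
  have hv x s : determinate P t (x, s) -> `|(w x s).2 - (w' x s).2| <= C1 * E s.
    by move=> Dxs; exact: (H (SV n (x, s))).
  have hX s : t <= s <= t + tau -> `|X s - X' s| <= C1 * E s.
    move=> sI; apply: colvec_norm_le; first by rewrite mulr_ge0.
    by move=> i; rewrite !mxE; exact: (H (SX s i)).
  have hw x s : determinate P t (x, s) -> `|w x s - w' x s| <= kappa * C1 * E s.
    move=> Dxs; rewrite prod_norm_le; apply/andP; split.
      by rewrite [kappa * C1]mulrC -mulrA; exact: (H (SU n (x, s))).
    apply: (le_trans (hv x s Dxs)); rewrite ler_wpM2r// -[leLHS]mul1r.
    by rewrite ler_wpM2r.
  have qE s : L * (kappa * C1) / rate * E s <= C1 / 4 * E s.
    have -> : L * (kappa * C1) / rate = L * kappa / rate * C1 by ring.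
    by apply: ler_wpM2r => //; have := ler_wpM2r C10 q; lra.
  have kC : 0 <= kappa * C1 by rewrite mulr_ge0.
  case=> [[x s]|[x s]|s i] /=.
  - move=> Dxs; have [x01 ts st] := (determinateP t x s).1 Dxs.
    have /andP[x0 x1] := x01; pose c := s - Gu x.
    have Dch y xi : 0 <= y -> t <= c + Gu y -> y <= xi <= x -> determinate P t (xi, c + Gu xi).
      move=> y0 ty /andP[yxi xix]; have xi0 := le_trans y0 yxi.
      apply/determinateP; split; first by rewrite xi0 (le_trans xix).
        by rewrite (le_trans ty)// lerD2l (travel_le su) ?y0// (le_trans xix).
      have := travel_le su (a := xi) (b := x); rewrite xi0 xix => /(_ isT x1).
      have := travel_le sv (a := xi) (b := x); rewrite xi0 xix => /(_ isT x1).
      by move: st; rewrite /c; lra.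
    have foot y : 0 <= y <= x -> t <= c + Gu y ->
        `|(w x s).1 - (w' x s).1| <= `|(w y (c + Gu y)).1 - (w' y (c + Gu y)).1| + C1 / 4 * E s.
      move=> yx ty; have /andP[y0 yx'] := yx.
      have Dy : determinate P t (y, c + Gu y) by apply: (Dch y) => //; rewrite lexx.
      rewrite (broad_u reg strD bw Dxs yx Dy) (broad_u reg strD bw' Dxs yx Dy).
      rewrite opprD addrACA (le_trans (ler_normD _ _))// lerD2l.
      apply: le_trans (qE s).
      have -> : E s = expR (rate * (c - t + Gu x)) by rewrite /E /c; congr (expR (_ * _)); ring.
      apply: (flux_diff_growth su L0 (reg_fu reg)) => //.
      + by apply: (broad_path_u strD bw) => // xi; exact: Dch.
      + by apply: (broad_path_u strD bw') => // xi; exact: Dch.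
      + move=> xi xiI; have := hw _ _ (Dch y xi y0 ty xiI).
        by rewrite /E; congr (_ <= _ * expR (_ * _)); ring.
    (* the characteristic of [u] starts either on the initial line or at [x = 0] *)
    have [ct|tc] := leP c t.
      have [yx yE] := u_footP x01 ts ct; have := foot _ yx; rewrite yE lexx => /(_ isT).
      move=> /le_trans; apply; have := wB (u_foot t x s).
      have /andP[y0 yx'] := yx; rewrite y0 (le_trans yx' x1) => /(_ isT).
      rewrite prod_norm_le => /andP[hB _].
      have h1 : B * 1 <= B * (kappa * E s).
        by rewrite ler_wpM2l// -[leLHS]mulr1 ler_pM// E1.
      have h2 : C1 * E s <= C1 * (kappa * E s).
        by rewrite ler_wpM2l// -[leLHS]mul1r ler_wpM2r.
      have h3 : 0 <= C1 * E s by rewrite mulr_ge0.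
      by move: hB => /= hB; lra.
    have := foot 0; rewrite travel00 addr0 lexx x0 ltW// => /(_ isT isT).
    move=> /le_trans; apply.
    have cI : t <= c <= t + tau.
      rewrite ltW//= /c; have := travel_ge0 su x01; have := travel_ge0 sv x01.
      by move: st; lra.
    have c0 : 0 <= c by rewrite (le_trans t0)// ltW.
    have [_ _ _ _ /(_ c (D0 c cI) tc) ->] := bw.
    have [_ _ _ _ /(_ c (D0 c cI) tc) ->] := bw'.
    have h1 : `|g0 P (X c) (w 0 c).2 c - g0 P (X' c) (w' 0 c).2 c| <= L * (C1 * E c).
      apply: (le_trans (reg_g0 reg c0 _ _ _ _)); rewrite ler_wpM2l// prod_norm_le hX//=.
      by rewrite hv//; exact: D0.
    have h2 : L * (C1 * E c) <= kappa / 4 * (C1 * E s).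
      apply: ler_pM => //; rewrite ?mulr_ge0 ?L_kappa//.
      by rewrite ler_wpM2l// Emono// /c gerBl (travel_ge0 su).
    have h3 : C1 * E s <= C1 * (kappa * E s).
      by rewrite ler_wpM2l// -[leLHS]mul1r ler_wpM2r.
    have h4 : 0 <= B * (kappa * E s) by rewrite !mulr_ge0.
    by lra.
  - move=> Dxs; have [x01 ts st] := (determinateP t x s).1 Dxs.
    have /andP[x0 x1] := x01; have [xy yE] := v_footP x01 ts st.
    set y := v_foot t x s in xy yE; have /andP[xy' y1] := xy.
    have Dch xi : x <= xi <= y -> determinate P t (xi, s + Gv x - Gv xi).
      move=> /andP[xxi xiy]; have xi0 := le_trans x0 xxi; have xi1 := le_trans xiy y1.
      apply/determinateP; rewrite xi0 xi1 subrK; split => //.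
      by rewrite -yE lerB// (travel_le sv)// xi0.
    have Dy := Dch y; rewrite xy' lexx in Dy.
    rewrite (broad_v reg strD bw Dxs xy (Dy isT)) (broad_v reg strD bw' Dxs xy (Dy isT)).
    rewrite opprD addrACA (le_trans (ler_normD _ _))// mulrDl yE; apply: lerD.
      have := wB y; rewrite (le_trans x0 xy') y1 => /(_ isT).
      rewrite prod_norm_le => /andP[_ /le_trans]; apply.
      by rewrite -[leLHS]mulr1 ler_wpM2l// E1.
    apply: (@le_trans _ _ (C1 / 4 * E s)); last first.
      by rewrite ler_wpM2r//; move: C10; lra.
    apply: le_trans (qE s).
    have -> : E s = expR (rate * (s + Gv x - t - Gv x)).
      by rewrite /E; congr (expR (_ * _)); ring.
    apply: (flux_diff_decay sv L0 (reg_fv reg)) => //.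
    + by rewrite x0.
    + exact: (broad_path_v strD bw).
    + exact: (broad_path_v strD bw').
    + move=> xi xiI; have := hw _ _ (Dch xi xiI).
      by rewrite /E; congr (_ <= _ * expR (_ * _)); ring.
  - move=> sI; have /andP[ts st] := sI.
    have tts : t <= t <= s by rewrite lexx.
    rewrite (broad_ode_from reg strD bw t0 D0 _ tts st).
    rewrite (broad_ode_from reg strD bw' t0 D0 _ tts st).
    rewrite opprD addrACA (le_trans (ler_normD _ _))//.
    have hi : `|X t i 0 - X' t i 0| <= B.
      by have := le_trans (colvec_norm_ge (X t - X' t) i) XB; rewrite !mxE.
    rewrite mulrDl; apply: lerD.
      by rewrite (le_trans hi)// -[leLHS]mulr1 ler_wpM2l// E1.
    have ih := integrable_sub_itv (lexx t) st (broad_ode_integrable reg strD bw t0 D0 i).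
    have ih' := integrable_sub_itv (lexx t) st (broad_ode_integrable reg strD bw' t0 D0 i).
    apply: (le_trans (integral_diff_growth (c := t) ts A0 (mulr_ge0 L0 C10) ih ih' _)); last first.
      by rewrite -/(E s) ler_wpM2r//; have := ler_wpM2r C10 LA; lra.
    move=> r /andP[tr rs]; have rI : t <= r <= t + tau by rewrite tr (le_trans rs).
    have r0 := le_trans t0 tr.
    apply: (le_trans (f0_coord_lipschitz reg i r0 _ _ _ _)).
    rewrite -mulrA ler_wpM2l// prod_norm_le hX//= hv//.
    exact: D0.
have main := contraction_bound om0 B0 M0 dM step.
have Eb s : s <= t + tau -> E s <= expR (rate * tau).
  by move=> st; rewrite /E ler_expR ler_wpM2l ?(ltW A0)// lerBlDl.
split.
  move=> x s Dxs; have [/andP[x0 x1] ts st] := (determinateP t x s).1 Dxs.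
  have {}/Eb Es : s <= t + tau.
    by rewrite (le_trans _ st)// lerDl (travel_ge0 sv)// x0.
  rewrite prod_norm_le /C; apply/andP; split.
    have := main (SU n (x, s)) Dxs => /= /le_trans; apply.
    rewrite mulrA [leRHS]mulrAC [2 * B * _]mulrAC.
    by rewrite ler_wpM2l// mulr_ge0// mulr_ge0.
  have := main (SV n (x, s)) Dxs => /= /le_trans; apply.
  have -> : 2 * kappa * expR (rate * tau) * B = (2 * B) * (kappa * expR (rate * tau)).
    by ring.
  apply: ler_wpM2l; first exact: mulr_ge0.
  by rewrite (le_trans Es)// -[leLHS]mul1r ler_wpM2r// expR_ge0.
move=> s sI; have /andP[ts /Eb Es] := sI.
apply: colvec_norm_le; first by rewrite /C !mulr_ge0 ?expR_ge0.
move=> i; rewrite !mxE; have := main (SX s i) sI => /= /le_trans; apply.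
have -> : C = (2 * B) * (kappa * expR (rate * tau)) by rewrite /C; ring.
apply: ler_wpM2l; first exact: mulr_ge0.
by rewrite (le_trans Es)// -[leLHS]mul1r ler_wpM2r// expR_ge0.
Qed.

End dependence.

(** * Restriction to the determinate set and estimates beyond it *)

Section closed_loop.
Context {R : realType} {n : nat} (P : system R n) (K : 'cV[R]_n -> R -> R).
Context (L l : R) (reg : regular P K L l).
Local Notation mu := (@lebesgue_measure R).
Local Notation Gu := (travel (lamu P) 0).
Local Notation Gv := (travel (lamv P) 0).
Local Notation tau := (travel (lamv P) 0 1).
Implicit Types (w : R -> R -> R * R) (X : R -> 'cV[R]_n) (Om : set (R * R)).

Let L0 : 0 <= L := reg_L reg.
Let su := reg_lamu reg.
Let sv := reg_lamv reg.
Let tau0 : 0 <= tau := tau_ge0 reg.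

Lemma determinate_boundary t s : determinate P t (0, s) <-> t <= s <= t + tau.
Proof.
rewrite (determinateP reg) travel00 addr0 lexx ler01; split.
  by move=> [_ -> ->].
by move=> /andP[].
Qed.

(** Every condition is inherited by a subset but the equation of [X], which has
    to be restarted from the time [t]. *)
Lemma broad_restrict t w X : 0 <= t ->
  broad_solution P (@halfstrip R) 0 w X -> broad_solution P (determinate P t) t w X.
Proof.
move=> t0 bw; have [[mw bdw] bu bv [cX oX] bg] := bw.
have sub : determinate P t `<=` @halfstrip R.
  by move=> [x s] [/= x01 /andP[ts _]]; split => //=; exact: le_trans ts.
have strH := @halfstrip_in_strip R; have [mD _] := determinate_in_strip reg t.
split.
- split; first by apply: measurable_funS mw => //; have [] := strH.
  by move=> T; have [M hM] := bdw T; exists M => x s /sub; exact: hM.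
- by move=> x s y /sub xs yx ch /sub; exact: bu.
- by move=> x s y /sub xs yx ch /sub; exact: bv.
- split.
    by apply: continuous_subspaceW cX => s /sub.
  move=> s /determinate_boundary/andP[ts _] i.
  apply: (broad_ode_from reg strH bw (lexx 0) (b := s)) => //.
    by move=> r /andP[r0 _]; split => //=; rewrite ?lexx ?ler01.
  by rewrite t0.
- by move=> s /sub; move=> h ts; apply: bg => //; exact: le_lt_trans ts.
Qed.

Lemma zero_broad Om t0 : 0 <= t0 -> in_strip Om ->
  broad_solution P Om t0 (fun _ _ => 0) (fun=> 0).
Proof.
move=> t00 [mOm sOm]; split.
- by split; [exact: measurable_cst|move=> T; exists 0 => x s _ _; rewrite normr0].
- move=> x s y xs /andP[y0 yx] ch _ /=; rewrite (integral_flux0 _ (reg_fu reg)) ?addr0//.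
  by have /andP[_] := sOm _ xs.
- move=> x s y xs /andP[xy y1] ch _ /=; rewrite (integral_flux0 _ (reg_fv reg)) ?addr0//.
  by have /andP[] := sOm _ xs.
- split; first by apply: continuous_subspaceT => x; exact: cvg_cst.
  move=> s _ i; rewrite !mxE add0r; apply/esym.
  have [ts|st] := leP t0 s; last by rewrite set_itv_ge ?bnd_simp -?ltNge// Rintegral_set0.
  rewrite (@eq_integral_itv _ _ _ _ (fun=> 0)) ?integral_itv_cst ?mul0r//.
  by move=> r /andP[/(le_trans t00) r0 _]; rewrite (reg_f00 reg r0) mxE.
- by move=> s _ ts; rewrite (reg_g00 reg)// (le_trans t00)// ltW.
Qed.

(** Here [x] plays the role of time: in [Om] the characteristics of [v] are
    followed backwards from [x = 0] to [x], and those of [u] forwards from a point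
    [y <= x], at which the solution is already bounded. Both integrations
    go in the direction of increasing [x], so that the weight
    [expR (A * (Gu x + Gv x))] makes them contract, and it is bounded on
    [0, 1]. *)
Lemma outer_estimate w X Om T B : 0 <= B ->
  broad_solution P (@halfstrip R) 0 w X ->
  (forall x s, Om (x, s) -> [/\ 0 <= x <= 1, 0 <= s & s <= T]) ->
  (forall x s, Om (x, s) -> `|(w 0 (s + Gv x)).2| <= B /\
     forall xi, 0 <= xi <= x -> Om (xi, s + Gv x - Gv xi)) ->
  (forall x s, Om (x, s) -> exists y, [/\ 0 <= y <= x, 0 <= s - Gu x + Gu y,
     `|(w y (s - Gu x + Gu y)).1| <= B &
     forall xi, y <= xi <= x -> Om (xi, s - Gu x + Gu xi)]) ->
  forall x s, Om (x, s) ->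
    `|w x s| <= 2 * expR ((1 + 2 * L) * (Gu 1 + tau)) * B.
Proof.
move=> B0 bw subOm vOm uOm.
have strH := @halfstrip_in_strip R.
pose A := 1 + 2 * L; have A0 : 0 < A by rewrite ltr_wpDr// mulr_ge0.
have LA : L / A <= 1 / 2 by rewrite ler_pdivrMr// /A; lra.
have OmH x s : Om (x, s) -> @halfstrip R (x, s) by move=> /subOm[x01 s0 _].
pose om (p : R * R) := expR (A * (Gu p.1 + Gv p.1)).
have om0 p : Om p -> 0 <= om p by move=> _; exact: expR_ge0.
have om1 p : Om p -> 1 <= om p.
  case: p => x s /subOm[x01 _ _]; rewrite /om -expR0 ler_expR mulr_ge0 ?(ltW A0)//.
  by rewrite addr_ge0 ?(travel_ge0 su) ?(travel_ge0 sv).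
have [M M0 wM] : exists2 M, 0 <= M & forall p, Om p -> `|w p.1 p.2| <= M * om p.
  have [[_ /(_ T)[M hM]] _ _ _ _] := bw; exists `|M| => // -[x s] Oxs.
  have [x01 s0 sT] := subOm _ _ Oxs; have := hM _ _ (OmH _ _ Oxs) sT.
  move=> /le_trans; apply; rewrite (le_trans (ler_norm M))// -[leLHS]mulr1.
  by rewrite ler_wpM2l// om1.
have step C : 0 <= C -> (forall p, Om p -> `|w p.1 p.2| <= C * om p) ->
    forall p, Om p -> `|w p.1 p.2| <= (B + C / 2) * om p.
  move=> C0 wC [x s] Oxs /=; have [x01 s0 sT] := subOm _ _ Oxs.
  have /andP[x0 x1] := x01.
  have B1 : B <= B * om (x, s) by rewrite -[leLHS]mulr1 ler_wpM2l// om1.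
  have LC : L * C / A * om (x, s) <= C / 2 * om (x, s).
    by rewrite ler_wpM2r ?om0//; have := ler_wpM2r C0 LA; lra.
  rewrite prod_norm_le mulrDl; apply/andP; split.
    have [y [/andP[y0 yx] ys yB yOm]] := uOm _ _ Oxs.
    rewrite (broad_u reg strH bw (OmH _ _ Oxs) (y := y)) ?y0//; last first.
      by split => //=; rewrite y0 (le_trans yx).
    rewrite (le_trans (ler_normD _ _))// lerD// ?(le_trans yB)//.
    apply: le_trans LC.
    have -> : om (x, s) = expR (A * (Gv x + Gu x)) by rewrite /om addrC.
    apply: (flux_growth su L0 (reg_fu reg)) => //; first by rewrite y0.
      by apply: (broad_path_u reg strH bw) => // xi /yOm/OmH.
    move=> xi xiI; have /andP[yxi xix] := xiI.
    have := wC _ (yOm _ xiI) => /= /le_trans; apply.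
    apply: (ler_wpM2l C0); rewrite ler_expR; apply: (ler_wpM2l (ltW A0)).
    by rewrite addrC lerD2r (travel_le sv)// (le_trans y0).
  have [vB vOmx] := vOm _ _ Oxs.
  have O0 : @halfstrip R (0, s + Gv x).
    by have := OmH _ _ (vOmx 0 _); rewrite travel00 subr0 lexx; apply.
  have := broad_v reg strH bw O0 (y := x); rewrite travel00 addr0 addrK x0.
  move=> /(_ x1 (OmH _ _ Oxs)) E.
  have {E} -> : (w x s).2 = (w 0 (s + Gv x)).2 -
      \int[mu]_(xi in `[0, x]) (fv P xi (w xi (s + Gv x - Gv xi)) / lamv P xi).
    by rewrite E addrK.
  rewrite (le_trans (ler_normB _ _))// lerD// ?(le_trans vB)//.
  apply: le_trans LC.
  have -> : om (x, s) = expR (A * (Gu x + Gv x)) by [].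
  apply: (@flux_growth _ _ _ sv _ _ L0 (reg_fv reg) 0 x
    (fun xi => w xi (s + Gv x - Gv xi)) A C (Gu x) _ x1 A0 C0).
  - by rewrite lexx.
  - by apply: (broad_path_v reg strH bw) => // xi /vOmx/OmH.
  - move=> xi xiI; have /andP[xi0 xix] := xiI.
    have := wC _ (vOmx _ xiI) => /= /le_trans; apply.
    apply: (ler_wpM2l C0); rewrite ler_expR; apply: (ler_wpM2l (ltW A0)).
    by rewrite lerD2r (travel_le su)// xi0.
move=> x s Oxs; have := contraction_bound om0 B0 M0 wM step Oxs => /= /le_trans; apply.
have [/andP[x0 x1] _ _] := subOm _ _ Oxs.
rewrite mulrAC; apply: (ler_wpM2r B0); apply: (ler_wpM2l (ler0n R 2)).
rewrite ler_expR; apply: (ler_wpM2l (ltW A0)).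
by rewrite lerD// ?(travel_le su)// ?(travel_le sv)// x0.
Qed.

End closed_loop.

(** * The trace at the uncontrolled boundary *)

Section stability.
Context {R : realType} {n : nat} (P : system R n) (K : 'cV[R]_n -> R -> R).
Context (L l : R) (reg : regular P K L l).
Local Notation mu := (@lebesgue_measure R).
Local Notation I01 := `[0 : R, 1]%classic.
Local Notation Gu := (travel (lamu P) 0).
Local Notation Gv := (travel (lamv P) 0).
Local Notation tau := (travel (lamv P) 0 1).
Implicit Types (w : R -> R -> R * R) (X : R -> 'cV[R]_n).

Let L0 : 0 <= L := reg_L reg.
Let su := reg_lamu reg.
Let sv := reg_lamv reg.
Let tau0 : 0 <= tau := tau_ge0 reg.
Let strH : in_strip (@halfstrip R) := halfstrip_in_strip.

(** The design equation is posed from [x = 0], but its solution is also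
    determined by its value at [x = 1], which is the applied control: here it is
    integrated from there, with a weight that grows as [x] decreases. *)
Lemma design_ode_unique (a V V' : R -> R) :
  bounded_path 0 1 (fun x => (a x, V x)) -> bounded_path 0 1 (fun x => (a x, V' x)) ->
  (forall x, 0 <= x <= 1 -> V x = V 1 +
     \int[mu]_(xi in `[x, 1]) (fv P xi (a xi, V xi) / lamv P xi)) ->
  (forall x, 0 <= x <= 1 -> V' x = V' 1 +
     \int[mu]_(xi in `[x, 1]) (fv P xi (a xi, V' xi) / lamv P xi)) ->
  V 1 = V' 1 -> forall x, 0 <= x <= 1 -> V x = V' x.
Proof.
move=> bV bV' VE VE' V1 x x01.
pose A := 1 + 2 * L; have A0 : 0 < A by rewrite ltr_wpDr// mulr_ge0.
have LA : L / A <= 1 / 2 by rewrite ler_pdivrMr// /A; lra.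
pose om x := expR (A * (0 - Gv x)).
have om0 y : 0 <= y <= 1 -> 0 <= om y by move=> _; exact: expR_ge0.
have [M M0 dM] : exists2 M, 0 <= M & forall y, 0 <= y <= 1 -> `|V y - V' y| <= M * om y.
  have [_ _ [M1 hM1]] := bV; have [_ _ [M2 hM2]] := bV'.
  exists ((`|M1| + `|M2|) * expR (A * tau)) => [|y y01].
    by rewrite mulr_ge0 ?addr_ge0// expR_ge0.
  rewrite -mulrA -expRD -mulrDr add0r -[leLHS]mulr1.
  apply: ler_pM => //; last first.
    rewrite -[leLHS]expR0 ler_expR mulr_ge0 ?(ltW A0)// subr_ge0.
    by have /andP[y0 y1] := y01; rewrite (travel_le sv)// y0.
  have := hM1 y y01; rewrite prod_norm_le => /andP[_ h1].
  have := hM2 y y01; rewrite prod_norm_le => /andP[_ h2].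
  by rewrite (le_trans (ler_normB _ _))// lerD// (le_trans _ (ler_norm _)).
have step C : 0 <= C -> (forall y, 0 <= y <= 1 -> `|V y - V' y| <= C * om y) ->
    forall y, 0 <= y <= 1 -> `|V y - V' y| <= (0 + C / 2) * om y.
  move=> C0 H y y01; have /andP[y0 y1] := y01; rewrite add0r.
  rewrite (VE y y01) (VE' y y01) V1 opprD addrACA subrr add0r.
  apply: (@le_trans _ _ (L * C / A * om y)); last first.
    by apply: ler_wpM2r; [exact: om0|have := ler_wpM2r C0 LA; lra].
  have y11 : 0 <= y <= 1 := y01.
  apply: (@flux_diff_decay _ _ _ sv _ _ L0 (reg_fv reg) y 1 (fun xi => (a xi, V xi))
    (fun xi => (a xi, V' xi)) A C 0 y11 (lexx 1) A0 C0 (bounded_path_sub y0 (lexx 1) bV) (bounded_path_sub y0 (lexx 1) bV')).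
  move=> xi /andP[/(le_trans y0) xi0 xi1].
  rewrite prod_norm_le /= subrr normr0 mulr_ge0 ?expR_ge0//=.
  by apply: H; rewrite xi0.
have := contraction_bound om0 (lexx 0) M0 dM step x01.
by rewrite mulr0 mul0r normr_le0 subr_eq0 => /eqP.
Qed.

Section trajectory.
Variables (z0 : state R n) (z : R -> state R n).
Hypothesis traj : closed_loop_traj P K z0 z.
Let w x t := (z t).1 x.
Let X t := (z t).2.

Lemma traj_broad : broad_solution P (@halfstrip R) 0 w X.
Proof. by have [] := traj. Qed.

(** Whatever value the algorithm computes at time [t > 0], the prediction is the
    true future of the plant on the determinate set, so that the intended value
    of [v] is realized at [x = 0] after the delay [tau]. *)
Lemma controlled_trace s : tau < s -> (w 0 s).2 = K (X s) s.
Proof.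
move=> taus; pose t := s - tau.
have t_gt0 : 0 < t by rewrite subr_gt0.
have t0 := ltW t_gt0; have ts : t + tau = s by rewrite subrK.
have [_ _ _ [U [hU wU]]] := traj.
have [wb [Xb [V [bwb [wb0 Xb0] cV VE UV]]]] := hU t t0.
have bw := broad_restrict reg t0 traj_broad.
have strD := determinate_in_strip reg t.
(* the prediction and the plant have the same data at time [t] *)
have [wbE XbE] : (forall x r, determinate P t (x, r) -> wb x r = w x r) /\
    forall r, t <= r <= t + tau -> Xb r = X r.
  have := determinate_dependence reg t0 (lexx 0) bwb bw.
  rewrite Xb0 subrr normr0 => /(_ _ (lexx 0)) [].
    by move=> x x01; rewrite wb0// subrr normr0.
  rewrite mulr0 => h1 h2; split.
    by move=> x r /h1; rewrite normr_le0 subr_eq0 => /eqP.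
  by move=> r /h2; rewrite normr_le0 subr_eq0 => /eqP.
have Dtop x : 0 <= x <= 1 -> determinate P t (x, s - Gv x).
  move=> x01; have /andP[x0 x1] := x01; apply/(determinateP reg).
  rewrite subrK ts; split => //.
  by rewrite /t lerB// (travel_le sv)// x0.
have tauE x : 0 <= x <= 1 -> tau_v P t x = s - Gv x.
  by move=> x01; rewrite (tau_vE reg)// addrA ts.
(* the traces of the plant on the characteristic of [v] that arrives at time [s] *)
pose a x := (w x (s - Gv x)).1; pose V' x := (w x (s - Gv x)).2.
have i0 : 0 <= (0 : R) <= 1 by rewrite lexx ler01.
have i1 : 0 <= (1 : R) <= 1 by rewrite ler01 lexx.
have bV' : bounded_path 0 1 (fun x => (a x, V' x)).
  have := @broad_path_v _ _ _ _ _ _ reg _ _ _ _ 0 1 s strD bw (lexx 0) (lexx 1) Dtop.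
  rewrite (_ : (fun x => w x (s - Gv x)) = (fun x => (a x, V' x)))//.
  by apply/funext => x; rewrite /a /V'; case: (w x (s - Gv x)).
have bV : bounded_path 0 1 (fun x => (a x, V x)).
  have [ma _ [M hM]] := bV'.
  have mV : measurable_fun `[0 : R, 1]%classic V.
    by apply: subspace_continuous_measurable_fun.
  have [c _ hc] := @EVT_max R (fun x => `|V x|) 0 1 ler01
    (fun x => @continuous_comp _ _ _ (V : subspace I01 -> R) (@Num.norm _ R) x (cV x)
       (@norm_continuous _ R _)).
  split => //; exists (Num.max M `|V c|) => x x01.
  have := hM x x01; rewrite !prod_norm_le !le_max => /andP[-> _] /=.
  by rewrite hc ?orbT// in_itv.
have V1 : V 1 = V' 1.
  by rewrite /V' -UV -wU// /t /w.
have VE' x : 0 <= x <= 1 -> V x = K (X s) s -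
    \int[mu]_(xi in `[0, x]) (fv P xi (a xi, V xi) / lamv P xi).
  move=> x01; have /andP[x0 x1] := x01.
  rewrite VE// tauE// travel00 subr0 XbE ?ts ?lexx ?andbT /t ?gerBl//.
  congr (_ - _); apply: eq_integral_itv => xi /andP[xi0 xix].
  have xi01 : 0 <= xi <= 1 by rewrite xi0 (le_trans xix).
  by rewrite tauE// wbE//; exact: Dtop.
have -> : (w 0 s).2 = V' 0 by rewrite /V' travel00 subr0.
rewrite -(@design_ode_unique a V V' bV bV' _ _ V1 0 i0).
- by rewrite VE'// integral_itv_point subr0.
- move=> x x01; have /andP[x0 x1] := x01; rewrite (VE' _ x01) (VE' _ i1).
  rewrite (@integral_itv_split _ 0 x 1) ?x0//; first ring.
  exact: (integrable_flux sv L0 (reg_fv reg) (lexx 0) (lexx 1) bV).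
- move=> x x01; have /andP[x0 x1] := x01.
  have D1 : determinate P t (1, s - Gv x + Gv x - Gv 1) by rewrite subrK; exact: Dtop.
  have := @broad_v _ _ _ _ _ _ reg _ _ _ _ strD bw x (s - Gv x) 1 (Dtop x x01) _ D1.
  rewrite x1 lexx => /(_ isT); rewrite -/(V' x) => ->; rewrite !subrK; congr (_ + _).
  by apply: eq_integral_itv => xi _; rewrite /a /V' -surjective_pairing.
Qed.

(** The equation of [X] contains the trace of [v], which [controlled_trace]
    replaces by the feedback law except at the time [tau] itself. *)
Lemma traj_nominal : nominal_traj P K tau (X tau) X.
Proof.
have bw := traj_broad; have [_ _ _ [cX _] _] := bw; split=> //; split.
  apply: continuous_subspaceW cX => s /=; rewrite in_itv/= andbT => taus.
  by split; rewrite /= ?lexx ?ler01// (le_trans tau0).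
move=> s /=; rewrite in_itv/= andbT => taus i.
have H0 r : 0 <= r <= s -> @halfstrip R (0, r).
  by move=> /andP[r0 _]; split; rewrite /= ?lexx ?ler01.
have s0 : 0 <= s := le_trans tau0 taus.
have [mX mv [M hM]] := broad_trace strH bw H0 s0.
rewrite (broad_ode_from reg strH bw (lexx 0) H0 i (a := tau) (s := s)) ?tau0//.
congr (_ + _); apply: integral_itv_eq_off_left.
- exact: (integrable_sub_itv tau0 (lexx s) (broad_ode_integrable reg strH bw (lexx 0) H0 i)).
- have mX' j : measurable_fun `[tau, s] (fun t => X t j 0).
    by apply: measurable_funS (mX j) => //; exact: sub_itvcc.
  apply: (@integrable_f0_comp _ _ _ _ _ _ reg tau s X (fun r => K (X r) r) i
    (Num.max M (L * M)) tau0 mX').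
    apply: (@measurable_state_comp _ _ _ _ _ _ reg _ (fun Y _ t => K Y t) X (fun=> 0)) => //.
    + by move=> t /=; rewrite in_itv/= => /andP[/(le_trans tau0)].
    + by move=> Y _; exact: (reg_Km reg).
    + move=> t t0 Y r Y' r'; apply: (le_trans (reg_K reg t0 Y Y')).
      by rewrite ler_wpM2l// le_max lexx.
  move=> t /andP[/(le_trans tau0) t0 ts].
  have := hM t; rewrite t0 ts => /(_ isT)[hX _]; rewrite !le_max hX; split => //.
  by apply/orP; right; rewrite (le_trans (K_le reg _ t0))// ler_wpM2l.
by move=> r /andP[taur rs]; rewrite -controlled_trace.
Qed.

End trajectory.
End stability.

(** * Stability and attractivity *)

Section asymptotic_stability.
Context {R : realType} {n : nat} (P : system R n) (K : 'cV[R]_n -> R -> R).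
Context (L l : R) (reg : regular P K L l).
Local Notation Gu := (travel (lamu P) 0).
Local Notation Gv := (travel (lamv P) 0).
Local Notation tau := (travel (lamv P) 0 1).

Let L0 : 0 <= L := reg_L reg.
Let su := reg_lamu reg.
Let sv := reg_lamv reg.
Let tau0 : 0 <= tau := tau_ge0 reg.

Lemma state_norm_le (z : state R n) c : (forall x, 0 <= x <= 1 -> `|z.1 x| <= c) ->
  `|z.2| <= c -> (state_norm z <= c%:E)%E.
Proof.
move=> h1 h2; rewrite /state_norm ge_max lee_fin h2 andbT.
by apply: ge_ereal_sup => _ [x /= + <-]; rewrite in_itv/= lee_fin; exact: h1.
Qed.

Lemma state_norm_lt (z : state R n) d : (state_norm z < d%:E)%E ->
  (forall x, 0 <= x <= 1 -> `|z.1 x| <= d) /\ `|z.2| <= d.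
Proof.
rewrite /state_norm gt_max lte_fin => /andP[h1 /ltW h2]; split => // x x01.
rewrite -lee_fin (le_trans _ (ltW h1))//; apply: ereal_sup_ubound.
by exists x => //=; rewrite in_itv.
Qed.

Lemma state_norm_ge0 (z : state R n) : (0 <= state_norm z)%E.
Proof. by rewrite /state_norm le_max lee_fin normr_ge0 orbT. Qed.

Lemma cvg_pinfty0_ereal (f : R -> \bar R) : (forall t, 0 <= f t)%E ->
  (forall e, 0 < e -> exists T : R, forall t, T <= t -> (f t <= e%:E)%E) ->
  f t @[t --> +oo] --> 0%E.
Proof.
move=> f0 fe.
have ffin t e : (f t <= e%:E)%E -> f t \is a fin_num.
  by move=> h; rewrite ge0_fin_numE// (le_lt_trans h)// ltry.
apply/fine_cvgP; split.
  have [T hT] := fe 1 ltr01.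
  by near=> t; apply: (@ffin t 1); apply: hT; near: t; apply: nbhs_pinfty_ge; exact: num_real.
apply/cvgrPdist_le => e e0; have [T hT] := fe e e0.
near=> t; have ht : (f t <= e%:E)%E by apply: hT; near: t; apply: nbhs_pinfty_ge; exact: num_real.
rewrite sub0r normrN /= ger0_norm ?fine_ge0// -lee_fin fineK//.
exact: ffin ht.
Unshelve. all: by end_near. Qed.

Lemma ereal_cvg0_pinfty (g : R -> R) : (g t)%:E @[t --> +oo] --> 0%E ->
  forall e, 0 < e -> exists T : R, forall t, T <= t -> `|g t| <= e.
Proof.
move=> /fine_cvgP[_ /cvgrPdist_le h] e /h [T [_ hT]]; exists (T + 1) => t Tt.
have /hT : T < t by rewrite (lt_le_trans _ Tt)// ltrDl.
by rewrite /= sub0r normrN.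
Qed.

Definition initial_gain : R := 2 * kappa L * expR (rate L * tau).
Definition boundary_gain : R := 2 * expR ((1 + 2 * L) * (Gu 1 + tau)) * (1 + L) ^+ 2.

Lemma initial_gain_ge0 : 0 <= initial_gain.
Proof. by rewrite /initial_gain !mulr_ge0 ?expR_ge0// ltW// (kappa_gt0 reg). Qed.

Lemma boundary_gain_ge1 : 1 <= boundary_gain.
Proof.
rewrite /boundary_gain -[leLHS]mulr1 ler_pM//; last first.
  by rewrite exprn_ege1// lerDl.
rewrite -[leLHS]mulr1 ler_pM//; first by rewrite ler1n.
rewrite -[leLHS]expR0 ler_expR mulr_ge0//; first by rewrite addr_ge0// mulr_ge0.
by rewrite addr_ge0// (travel_ge0 su)// ler01 lexx.
Qed.

Section trajectory.
Variables (z0 : state R n) (z : R -> state R n).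
Hypothesis traj : closed_loop_traj P K z0 z.
Let w x t := (z t).1 x.
Let X t := (z t).2.
Let bw := traj_broad traj.

Lemma halfstrip_boundary (s : R) : 0 <= s -> @halfstrip R (0, s).
Proof. by move=> s0; split; rewrite /= ?lexx ?ler01. Qed.

(** Over the first determinate set the input has no influence, and the solution
    is compared with the zero solution. *)
Lemma initial_estimate B : 0 <= B ->
  (forall x, 0 <= x <= 1 -> `|z0.1 x| <= B) -> `|z0.2| <= B ->
  (forall x s, determinate P 0 (x, s) -> `|w x s| <= initial_gain * B) /\
  (forall s, 0 <= s <= tau -> `|X s| <= initial_gain * B).
Proof.
move=> B0 hw hX; have [_ w0 X0 _] := traj.
have zb := zero_broad reg (lexx 0) (determinate_in_strip reg 0).
have := determinate_dependence reg (lexx 0) B0 (broad_restrict reg (lexx 0) bw) zb.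
rewrite /= !subr0 X0 => /(_ _ hX) [].
  by move=> x x01; rewrite subr0 w0// hw.
by move=> h1 h2; split => [x s /h1|s]; [|rewrite -{1}[tau]add0r => /h2]; rewrite subr0.
Qed.

Lemma boundary_estimate B s : tau < s -> `|X s| <= B ->
  `|w 0 s| <= (1 + L) ^+ 2 * B.
Proof.
move=> taus XB; have s_gt0 : 0 < s := le_lt_trans tau0 taus; have s0 := ltW s_gt0.
have B0 := le_trans (normr_ge0 _) XB.
have vB : `|(w 0 s).2| <= L * B.
  by rewrite (controlled_trace reg traj taus) (le_trans (K_le reg _ s0))// ler_wpM2l.
rewrite prod_norm_le; apply/andP; split; last first.
  by rewrite (le_trans vB)// ler_wpM2r//; have := L0; nra.
have [_ _ _ _ -> //] := bw; last exact: halfstrip_boundary.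
apply: (le_trans (g0_le reg _ _ s0)).
apply: (@le_trans _ _ (L * ((1 + L) * B))).
  rewrite ler_wpM2l// ge_max; apply/andP; split.
    by rewrite (le_trans XB)// -[leLHS]mul1r ler_wpM2r// lerDl.
  by rewrite (le_trans vB)// ler_wpM2r// lerDr.
by rewrite mulrA ler_wpM2r//; have := L0; nra.
Qed.

(** After [T + Gu 1] every characteristic of [u] comes from a point of [x = 0]
    at which the solution is controlled by [X] after the time [T]. *)
Lemma late_estimate B T : tau < T -> (forall s, T <= s -> `|X s| <= B) ->
  forall x s, 0 <= x <= 1 -> T + Gu 1 <= s -> `|w x s| <= boundary_gain * B.
Proof.
move=> tauT XB x s x01 Ts; have T0 : 0 <= T := ltW (le_lt_trans tau0 tauT).
have B0 : 0 <= B := le_trans (normr_ge0 _) (XB T (lexx T)).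
have wB r : T <= r -> `|w 0 r| <= (1 + L) ^+ 2 * B.
  by move=> Tr; apply: boundary_estimate; [exact: lt_le_trans Tr|exact: XB].
(* the points whose characteristic of [u] has left [x = 0] after [T]; the upper
   bound on the time of arrival of [v] only makes the region bounded *)
pose Om : set (R * R) := [set p | [/\ 0 <= p.1 <= 1, T + Gu p.1 <= p.2 &
  p.2 + Gv p.1 <= s + tau]].
rewrite /boundary_gain -mulrA; apply: (@outer_estimate _ _ _ _ _ _ reg w X Om (s + tau)) => //.
- by rewrite mulr_ge0// exprn_ge0// addr_ge0.
- move=> y r [/= y01 Tr rs]; split => //.
    by rewrite (le_trans _ Tr)// addr_ge0// (travel_ge0 su).
  by rewrite (le_trans _ rs)// lerDl (travel_ge0 sv).
- move=> y r [/= y01 Tr rs]; have /andP[y0 y1] := y01; split.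
    have /wB : T <= r + Gv y.
      rewrite (le_trans _ (_ : r <= _))// ?lerDl ?(travel_ge0 sv)//.
      by rewrite (le_trans _ Tr)// lerDl (travel_ge0 su).
    by rewrite prod_norm_le => /andP[].
  move=> xi /andP[xi0 xiy]; split => /=; last by rewrite subrK.
    by rewrite xi0 (le_trans xiy).
  have := travel_le su (a := xi) (b := y); rewrite xi0 xiy => /(_ isT y1).
  have := travel_le sv (a := xi) (b := y); rewrite xi0 xiy => /(_ isT y1).
  by move: Tr; lra.
- move=> y r [/= y01 Tr rs]; have /andP[y0 y1] := y01.
  have Tc : T <= r - Gu y by move: Tr; lra.
  exists 0; rewrite travel00 addr0 lexx y0 (le_trans T0 Tc); split => //.
    by have := wB _ Tc; rewrite prod_norm_le => /andP[].
  move=> xi /andP[xi0 xiy]; split => /=; first by rewrite xi0 (le_trans xiy).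
    by rewrite lerD2r.
  have := travel_le su (a := xi) (b := y); rewrite xi0 xiy => /(_ isT y1).
  have := travel_le sv (a := xi) (b := y); rewrite xi0 xiy => /(_ isT y1).
  by move: rs; lra.
split => //=.
  rewrite (le_trans _ Ts)// lerD2l; have /andP[x0 x1] := x01.
  by rewrite (travel_le su)// x0.
by rewrite lerD2l; have /andP[x0 x1] := x01; rewrite (travel_le sv)// x0.
Qed.

(** A characteristic of [u] that reaches the outer region without coming from
    [x = 0] there has crossed the last [v]-characteristic of the determinate
    set, on which the solution is already under control. *)
Lemma global_estimate B :
  (forall x s, determinate P 0 (x, s) -> `|w x s| <= B) ->
  (forall s, 0 <= s -> `|X s| <= B) ->
  forall x s, @halfstrip R (x, s) -> `|w x s| <= boundary_gain * B.
Proof.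
move=> wB XB x s [/= x01 s0].
have B0 : 0 <= B := le_trans (normr_ge0 _) (XB 0 (lexx 0)).
have [st|/ltW st] := leP (s + Gv x) tau.
  have /wB/le_trans : determinate P 0 (x, s).
    by apply/(determinateP reg); rewrite add0r.
  by apply; rewrite -[leLHS]mul1r ler_wpM2r// boundary_gain_ge1.
have L1 : 1 <= (1 + L) ^+ 2 by rewrite exprn_ege1// lerDl.
have wB0 r : 0 <= r -> `|w 0 r| <= (1 + L) ^+ 2 * B.
  move=> r0; have [rt|tr] := leP r tau; last exact: boundary_estimate (XB _ r0).
  have /wB/le_trans : determinate P 0 (0, r).
    by apply/(determinate_boundary reg); rewrite add0r r0.
  by apply; rewrite -[leLHS]mul1r ler_wpM2r.
pose Om : set (R * R) := [set p | [/\ 0 <= p.1 <= 1, 0 <= p.2, tau <= p.2 + Gv p.1 &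
  p.2 + Gv p.1 <= s + Gv x]].
rewrite /boundary_gain -mulrA; apply: (@outer_estimate _ _ _ _ _ _ reg w X Om (s + Gv x)) => //.
- by rewrite mulr_ge0// exprn_ge0// addr_ge0.
- move=> y r [/= y01 r0 tr rs]; split => //.
  by rewrite (le_trans _ rs)// lerDl (travel_ge0 sv).
- move=> y r [/= y01 r0 tr rs]; have /andP[y0 y1] := y01; split.
    have /wB0 : 0 <= r + Gv y by rewrite (le_trans tau0).
    by rewrite prod_norm_le => /andP[].
  move=> xi /andP[xi0 xiy]; split => /=; rewrite ?subrK//.
    by rewrite xi0 (le_trans xiy).
  have := travel_le sv (a := xi) (b := y); rewrite xi0 xiy => /(_ isT y1).
  by move: r0; lra.
- move=> y r [/= y01 r0 tr rs]; have /andP[y0 y1] := y01.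
  pose c := r - Gu y.
  suff [yf [/andP[yf0 yfy] cf uf tf]] : exists yf, [/\ 0 <= yf <= y, 0 <= c + Gu yf,
      `|(w yf (c + Gu yf)).1| <= (1 + L) ^+ 2 * B & tau <= c + Gu yf + Gv yf].
    exists yf; split => //; first by rewrite yf0.
    move=> xi /andP[yxi xiy]; have xi0 := le_trans yf0 yxi; have xi1 := le_trans xiy y1.
    have h1 : Gv xi <= Gv y by apply: (travel_le sv) => //; rewrite xi0.
    have h2 : Gu xi <= Gu y by apply: (travel_le su) => //; rewrite xi0.
    have h3 : Gv yf <= Gv xi by apply: (travel_le sv) => //; rewrite yf0.
    have h4 : Gu yf <= Gu xi by apply: (travel_le su) => //; rewrite yf0.
    rewrite -/c; split => /=; first by rewrite xi0.
    + by rewrite (le_trans cf)// lerD2l.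
    + by rewrite (le_trans tf)// lerD// lerD2l.
    + by rewrite (le_trans _ rs)// /c lerD// addrAC -[leRHS]addr0 -addrA lerD2l subr_le0.
  have [tc|ct] := leP tau c.
    exists 0; rewrite travel00 !addr0 travel00 addr0 lexx y0 (le_trans tau0 tc); split => //.
    by have := wB0 c (le_trans tau0 tc); rewrite prod_norm_le => /andP[].
  (* where the characteristic of [u] crosses the line [s + Gv x = tau] *)
  have [||yf] := @IVT R (fun q => Gu q + Gv q) 0 y (tau - c) y0.
  + apply: (@continuous_subspaceW _ _ _ `[0 : R, 1]%classic); first exact: sub_itvcc.
    move=> q; apply: continuousD.
      exact: (continuous_travel su).
    exact: (continuous_travel sv).
  + rewrite !travel00 addr0 ge_min le_max; apply/andP; split; apply/orP.
      by left; rewrite subr_ge0 ltW.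
    by right; rewrite /c; move: tr; lra.
  rewrite in_itv/= => yfI yfE; have /andP[yf0 yfy] := yfI.
  have yf1 := le_trans yfy y1; have yf01 : 0 <= yf <= 1 by rewrite yf0.
  have cE : c + Gu yf = tau - Gv yf by move: yfE; lra.
  have c0 : 0 <= tau - Gv yf by rewrite subr_ge0 (travel_le sv)// yf0.
  exists yf; rewrite cE subrK; split => //.
  have /wB : determinate P 0 (yf, tau - Gv yf).
    by apply/(determinateP reg); rewrite subrK add0r.
  rewrite prod_norm_le => /andP[/le_trans h _]; apply: h.
  by rewrite -[leLHS]mul1r ler_wpM2r.
Qed.

End trajectory.

Hypothesis nominal_gas :
  gas_origin setT (fun X : 'cV[R]_n => `|X|%:E) tau (nominal_traj P K tau).

(** Up to the time [tau] the state grows at most by the factor [initial_gain],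
    whence a small state [X tau] from which the nominal equation is started. *)
Lemma closed_loop_stable e : 0 < e -> exists2 d, 0 < d &
  forall z0 z, closed_loop_traj P K z0 z -> (state_norm z0 < d%:E)%E ->
    forall t, 0 <= t -> (state_norm (z t) < e%:E)%E.
Proof.
move=> e0; have [_ _ stab _] := nominal_gas.
have g1 := boundary_gain_ge1; have g10 : 0 < boundary_gain := lt_le_trans ltr01 g1.
pose e' := e / (2 * boundary_gain); have e'0 : 0 < e' by rewrite divr_gt0// mulr_gt0.
have [d' d'0 hd'] := stab e' e'0.
pose m := Num.min d' e'; have m0 : 0 < m by rewrite lt_min d'0.
have g00 := initial_gain_ge0; have g0S : 0 < initial_gain + 1 by rewrite ltr_wpDl.
exists (m / (initial_gain + 1)) => [|z0 z tr hz0 t t0]; first exact: divr_gt0.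
have d0 : 0 <= m / (initial_gain + 1) by rewrite ltW// divr_gt0.
have gd : initial_gain * (m / (initial_gain + 1)) < m.
  by rewrite mulrCA gtr_pMr// ltr_pdivrMr// mul1r ltrDl.
have [hw hX] := state_norm_lt hz0.
have [wD XD] := initial_estimate tr d0 hw hX.
have me : m <= e' by rewrite ge_min lexx orbT.
have md : m <= d' by rewrite ge_min lexx.
have Xe s : 0 <= s -> `|(z s).2| <= e'.
  move=> s0; have [st|/ltW ts] := leP s tau.
    by rewrite (le_trans (XD s _)) ?s0// (le_trans (ltW gd)).
  rewrite -lee_fin ltW//; apply: (hd' _ _ (traj_nominal reg tr) _ s ts).
  by rewrite lte_fin (le_lt_trans (XD tau _)) ?tau0 ?lexx// (lt_le_trans gd).
have wDe x s : determinate P 0 (x, s) -> `|(z s).1 x| <= e'.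
  by move=> /wD/le_trans; apply; rewrite (le_trans (ltW gd)).
have ge : boundary_gain * e' = e / 2 by rewrite /e'; field; rewrite gt_eqF.
apply: (@le_lt_trans _ _ (e / 2)%:E); last by rewrite lte_fin; lra.
apply: state_norm_le.
  by move=> x x01; rewrite -ge; exact: (global_estimate tr wDe Xe).
by rewrite (le_trans (Xe t t0))// -ge -[leLHS]mul1r ler_wpM2r// ltW.
Qed.

Lemma closed_loop_attractive z0 z : closed_loop_traj P K z0 z ->
  state_norm (z t) @[t --> +oo] --> 0%E.
Proof.
move=> tr; have [_ _ _ attr] := nominal_gas.
have Xe := ereal_cvg0_pinfty (attr _ _ (traj_nominal reg tr)).
apply: cvg_pinfty0_ereal => [t|e e0]; first exact: state_norm_ge0.
have g1 := boundary_gain_ge1; have g10 : 0 < boundary_gain := lt_le_trans ltr01 g1.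
have e'0 : 0 < e / boundary_gain by rewrite divr_gt0.
have [T hT] := Xe _ e'0.
pose T1 := Num.max T (tau + 1).
have T1tau : tau < T1 by rewrite lt_max ltrDl ltr01 orbT.
have hT1 s : T1 <= s -> `|(z s).2| <= e / boundary_gain.
  by rewrite ge_max => /andP[Ts _]; have := hT s Ts; rewrite normr_id.
have Gu1 : 0 <= Gu 1 by rewrite (travel_ge0 su)// ler01 lexx.
exists (T1 + Gu 1) => t Tt; apply: state_norm_le.
  move=> x x01; have := late_estimate tr T1tau hT1 x01 Tt.
  by rewrite mulrC divfK// gt_eqF.
rewrite (le_trans (hT1 t _))//; first by rewrite (le_trans _ Tt)// lerDl.
by rewrite ler_pdivrMr// -[leLHS]mulr1 ler_wpM2l// ltW.
Qed.

End asymptotic_stability.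

(** * Solvability of the design equation *)

Section design_ode.
Context {R : realType} {n : nat} (P : system R n) (K : 'cV[R]_n -> R -> R).
Context (L l : R) (reg : regular P K L l).
Local Notation mu := (@lebesgue_measure R).
Local Notation I01 := `[0 : R, 1]%classic.
Local Notation Gv := (travel (lamv P) 0).
Local Notation tau := (travel (lamv P) 0 1).

Let L0 : 0 <= L := reg_L reg.
Let sv := reg_lamv reg.
Let tau0 : 0 <= tau := tau_ge0 reg.

(** A Volterra equation with a Lipschitz right-hand side; the functional [Phi] is
    extended by zero outside [0, 1] to have a fixed point on all of [R]. *)
Lemma design_ode_exists (a : R -> R) (k : R) : measurable_fun I01 a ->
  (exists M, forall x, 0 <= x <= 1 -> `|a x| <= M) ->
  exists V : R -> R, {within I01, continuous V} /\
    forall x, 0 <= x <= 1 -> V x = k -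
      \int[mu]_(xi in `[0, x]) (fv P xi (a xi, V xi) / lamv P xi).
Proof.
move=> ma [Ma aM].
pose A := 1 + 2 * L; have A0 : 0 < A by rewrite ltr_wpDr// mulr_ge0.
have LA : L / A <= 1 / 2 by rewrite ler_pdivrMr// /A; lra.
pose om x := expR (A * (0 + Gv x)).
pose good (V : R -> R) := measurable_fun I01 V /\
  exists M, forall x, 0 <= x <= 1 -> `|V x| <= M.
pose Phi (V : R -> R) x := if 0 <= x <= 1 then
  k - \int[mu]_(xi in `[0, x]) (fv P xi (a xi, V xi) / lamv P xi) else 0.
have path V : good V -> bounded_path 0 1 (fun x => (a x, V x)).
  move=> [mV [MV VM]]; split => //; exists (Num.max Ma MV) => x x01.
  by rewrite prod_norm_le !le_max aM//= VM// orbT.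
have om1 x : 0 <= x <= 1 -> 1 <= om x.
  move=> x01; rewrite /om -[leLHS]expR0 ler_expR mulr_ge0 ?(ltW A0)//.
  by rewrite add0r (travel_ge0 sv).
have PhiE V x : 0 <= x <= 1 -> Phi V x = k -
    \int[mu]_(xi in `[0, x]) (fv P xi (a xi, V xi) / lamv P xi).
  by rewrite /Phi => ->.
have Phi_lip V : good V -> exists M, forall x y, 0 <= x <= 1 -> 0 <= y <= 1 ->
    `|Phi V x - Phi V y| <= M * `|x - y|.
  move=> /path/(flux_integral_lipschitz sv L0 (reg_fv reg))[M hM].
  exists M => x y x01 y01; rewrite !PhiE// opprB addrC addrA subrK distrC; exact: hM.
have Phi_cont V : good V -> {within I01, continuous (Phi V)}.
  move=> /Phi_lip[M hM]; apply: locally_lipschitz_within_continuous => x /=.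
  rewrite in_itv/= => x01; exists M => y; rewrite in_itv/= => y01 _; exact: hM.
have good_Phi V : good V -> good (Phi V).
  move=> gV; split.
    by apply: subspace_continuous_measurable_fun => //; exact: Phi_cont.
  have [M hM] := Phi_lip V gV; exists (`|Phi V 0| + `|M|) => x x01.
  have i0 : 0 <= (0 : R) <= 1 by rewrite lexx ler01.
  rewrite -(subrK (Phi V 0) (Phi V x)) addrC (le_trans (ler_normD _ _))// lerD2l.
  rewrite (le_trans (hM x 0 x01 i0))// subr0; have /andP[x0 x1] := x01.
  rewrite (ger0_norm x0) (le_trans (ler_wpM2r x0 (ler_norm M)))//.
  by rewrite -[leRHS]mulr1 ler_wpM2l.
have good0 : good (fun=> 0).
  by split; [exact: measurable_cst|exists 0 => x _; rewrite normr0].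
have contr V V' C : good V -> good V' -> 0 <= C -> (forall x, `|V x - V' x| <= C * om x) ->
    forall x, `|Phi V x - Phi V' x| <= C / 2 * om x.
  move=> gV gV' C0 VC x; have [x01|nx] := boolP (0 <= x <= 1); last first.
    by rewrite /Phi (negbTE nx) subrr normr0 mulr_ge0 ?expR_ge0// divr_ge0.
  have /andP[x0 x1] := x01.
  rewrite !PhiE// opprB addrC addrA subrK distrC.
  apply: (@le_trans _ _ (L * C / A * om x)); last first.
    by apply: ler_wpM2r; [exact: expR_ge0|have := ler_wpM2r C0 LA; lra].
  have x0x : (0 : R) <= 0 <= x by rewrite lexx.
  apply: (@flux_diff_growth _ _ _ sv _ _ L0 (reg_fv reg) 0 x (fun xi => (a xi, V xi))
    (fun xi => (a xi, V' xi)) A C 0 x0x x1 A0 C0).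
  - exact: bounded_path_sub (path _ gV).
  - exact: bounded_path_sub (path _ gV').
  move=> xi _; rewrite prod_norm_le; apply/andP; split; last exact: VC.
  by rewrite /= subrr normr0 mulr_ge0// expR_ge0.
have [C0 hC0] : exists C0, forall x, `|Phi (fun=> 0) x| <= C0 * om x.
  have [_ [M hM]] := good_Phi _ good0; exists `|M| => x.
  have [x01|nx] := boolP (0 <= x <= 1); last first.
    by rewrite /Phi (negbTE nx) normr0 mulr_ge0// expR_ge0.
  rewrite (le_trans (hM x x01))// (le_trans (ler_norm M))// -[leLHS]mulr1.
  by rewrite ler_wpM2l// om1.
have [||V [gV VE]] := weighted_fixed_point (om := om) _ good0 good_Phi _ hC0 contr.
- by move=> x; exact: expR_gt0.
- move=> w W C gw wC wW; split.
    by apply: (measurable_fun_cvg (h := w)) => [k'|x _]; [have [] := gw k'|exact: wW].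
  exists (`|C| * expR (A * (0 + tau))) => x x01; have /andP[x0 x1] := x01.
  apply: (le_trans (norm_limit_le (fun k' => wC k' x) (wW x))).
  apply: (@le_trans _ _ (`|C| * om x)); first by rewrite ler_wpM2r ?expR_ge0// ler_norm.
  apply: (ler_wpM2l (normr_ge0 C)); rewrite ler_expR; apply: (ler_wpM2l (ltW A0)).
  by rewrite lerD2l (travel_le sv)// x0.
exists V; split.
  by have := Phi_cont V gV; rewrite (_ : Phi V = V)//; exact/funext.
by move=> x x01; rewrite -{1}VE PhiE.
Qed.

Lemma zero_trajectory : closed_loop_traj P K 0 (fun=> 0).
Proof.
split=> //; first exact: (zero_broad reg (lexx 0) halfstrip_in_strip).
exists (fun=> 0); split=> [t t0|//].
exists (fun _ _ => 0), (fun=> 0), (fun=> 0); split=> //.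
- exact: (zero_broad reg t0 (determinate_in_strip reg t)).
- by move=> x; exact: cvg_cst.
- move=> x /andP[x0 x1]; rewrite (reg_K0 reg); last first.
    by rewrite (tau_vE reg) ?lexx ?ler01// travel00 subr0 addr_ge0.
  by rewrite (integral_flux0 _ (reg_fv reg)) ?subr0.
Qed.

End design_ode.

(** * Existence of trajectories *)

Section existence.
Context {R : realType} {n : nat} (P : system R n) (K : 'cV[R]_n -> R -> R).
Context (L l : R) (reg : regular P K L l).
Local Notation mu := (@lebesgue_measure R).
Local Notation I01 := `[0 : R, 1]%classic.
Local Notation Gu := (travel (lamu P) 0).
Local Notation Gv := (travel (lamv P) 0).
Local Notation tau := (travel (lamv P) 0 1).
Implicit Types (W : slot R n -> R) (p : R * R).

Let L0 : 0 <= L := reg_L reg.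
Let su := reg_lamu reg.
Let sv := reg_lamv reg.
Let tau0 : 0 <= tau := tau_ge0 reg.
Let strH : in_strip (@halfstrip R) := halfstrip_in_strip.

Variables (q0 : R -> R * R) (X0 : 'cV[R]_n).
Hypothesis mq0 : measurable_fun I01 q0.
Hypothesis bq0 : exists M : R, forall x, 0 <= x <= 1 -> `|q0 x| <= M.

Definition field W (x s : R) : R * R := (W (SU n (x, s)), W (SV n (x, s))).
Definition ode_state W (s : R) : 'cV[R]_n := \col_i W (SX s i).

(** The value that the characteristic of [u] through [p] carries when it enters
    the half-strip, through [x = 0] or from the initial line. *)
Definition u_entry W p : R :=
  let c := p.2 - Gu p.1 in
  if 0 < c then g0 P (ode_state W c) (field W 0 c).2 c
  else (q0 (u_foot P 0 p.1 p.2)).1.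

Definition u_step W p : R := u_entry W p +
  \int[mu]_(xi in `[u_foot P 0 p.1 p.2, p.1])
    (fu P xi (field W xi (p.2 - Gu p.1 + Gu xi)) / lamu P xi).

(** A characteristic of [v] that arrives at [x = 0] after [tau] started on the
    controlled boundary. There the closed loop is encoded backwards: the value is
    integrated from the feedback law at the arrival. *)
Definition v_step W p : R :=
  let r := p.2 + Gv p.1 in
  if r <= tau then (q0 (v_foot P 0 p.1 p.2)).2 +
    \int[mu]_(xi in `[p.1, v_foot P 0 p.1 p.2])
      (fv P xi (field W xi (r - Gv xi)) / lamv P xi)
  else K (ode_state W r) r -
    \int[mu]_(xi in `[0, p.1]) (fv P xi (field W xi (r - Gv xi)) / lamv P xi).

Definition X_step W s i : R := X0 i 0 +
  \int[mu]_(r in `[0, s]) f0 P (ode_state W r) (field W 0 r).2 r i 0.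

Definition in_halfstrip p : bool := (0 <= p.1 <= 1) && (0 <= p.2).

Definition solution_map W (i : slot R n) : R :=
  match i with
  | SU p => if in_halfstrip p then u_step W p else 0
  | SV p => if in_halfstrip p then v_step W p else 0
  | SX s i => if 0 <= s then X_step W s i else 0
  end.

(** A substitute for time: every point of a characteristic that enters the
    equation at [(x, s)] has at most its depth, also beyond the determinate set,
    where [v] is computed from a later time. There, along the characteristic of
    [v] that arrives at [x = 0] at the time [r], time is [r - Gv x] and the factor
    2 makes the depth [r + Gv x] increase with [x]. *)
Definition depth p : R := if p.2 + Gv p.1 <= tau then p.2 else p.2 + 2 * Gv p.1.

Local Notation kap := (kappa L).
Definition depth_rate : R := 1 + 4 * L * kap ^+ 2.

(** The feedback law and the reflection at [x = 0] couple the unknowns without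
    integration, from [X] to [v] and from [X] and [v] to [u]; each gains a factor
    [kap]. *)
Definition weight (i : slot R n) : R :=
  match i with
  | SU p => kap ^+ 2 * expR (depth_rate * depth p)
  | SV p => kap * expR (depth_rate * depth p)
  | SX s _ => expR (depth_rate * s)
  end.

Let k1 : 1 <= kap := kappa_ge1 reg.
Let k0 : 0 < kap := kappa_gt0 reg.

Lemma depth_rate_gt0 : 0 < depth_rate.
Proof. by rewrite ltr_wpDr// !mulr_ge0// ltW. Qed.
Let A0 := depth_rate_gt0.

Lemma weight_gt0 i : 0 < weight i.
Proof. by case: i => [p|p|s i] /=; rewrite ?mulr_gt0 ?exprn_gt0 ?expR_gt0. Qed.

Lemma depth0 s : depth (0, s) = s.
Proof. by rewrite /depth/= travel00 mulr0 !addr0; case: ifP. Qed.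

Lemma depth_le x s : 0 <= x <= 1 -> depth (x, s) <= s + 2 * tau.
Proof.
move=> x01; have g0 := travel_ge0 sv x01; have /andP[x0 x1] := x01.
have g1 : Gv x <= tau by apply: (travel_le sv) => //; rewrite x0.
rewrite /depth/=; case: ifP => _; lra.
Qed.

Lemma depth_ge x s : 0 <= x <= 1 -> s <= depth (x, s).
Proof.
by move=> x01; have g0 := travel_ge0 sv x01; rewrite /depth/=; case: ifP => _; lra.
Qed.

Lemma depth_u x s xi : 0 <= xi <= x -> x <= 1 ->
  depth (xi, s - Gu x + Gu xi) <= depth (x, s) - Gu x + Gu xi.
Proof.
move=> xix x1; have /andP[xi0 xix'] := xix.
have gv : Gv xi <= Gv x by apply: (travel_le sv).
have gu : Gu xi <= Gu x by apply: (travel_le su).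
have gv0 : 0 <= Gv xi by apply: (travel_ge0 sv); rewrite xi0 (le_trans xix').
rewrite /depth/=; case: ifPn => h1; case: ifPn => h2; rewrite ?lexx//; lra.
Qed.

Lemma depth_v_early r xi : r <= tau -> depth (xi, r - Gv xi) = r - Gv xi.
Proof. by rewrite /depth/= subrK => ->. Qed.

Lemma depth_v_late r xi : tau < r -> depth (xi, r - Gv xi) = r + Gv xi.
Proof. by rewrite /depth/= subrK leNgt => ->; ring. Qed.

Definition good W : Prop :=
  [/\ measurable_fun setT (fun p => W (SU n p)),
      measurable_fun setT (fun p => W (SV n p)),
      forall i, measurable_fun setT (fun s => W (SX s i))
    & exists C, forall i, `|W i| <= C * weight i].

Lemma field_diff W W' C x s : (forall i, `|W i - W' i| <= C * weight i) ->
  `|field W x s - field W' x s| <= kap ^+ 2 * C * expR (depth_rate * depth (x, s)).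
Proof.
move=> h; have C0 : 0 <= C.
  by have := le_trans (normr_ge0 _) (h (SV n (x, s))); rewrite pmulr_lge0// weight_gt0.
have e0 := expR_ge0 (depth_rate * depth (x, s)).
rewrite prod_norm_le; apply/andP; split => /=.
  by have := h (SU n (x, s)); rewrite /= mulrCA mulrA.
have := h (SV n (x, s)) => /= /le_trans; apply.
rewrite mulrA ler_wpM2r// mulrC ler_wpM2r// expr2 -[leLHS]mulr1 ler_wpM2l//.
exact: ltW.
Qed.

Lemma state_diff W W' C s : 0 <= C -> (forall i, `|W i - W' i| <= C * weight i) ->
  `|ode_state W s - ode_state W' s| <= C * expR (depth_rate * s).
Proof.
move=> C0 h; apply: colvec_norm_le; first by rewrite mulr_ge0// expR_ge0.
by move=> i; rewrite !mxE; exact: (h (SX s i)).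
Qed.

Lemma boundary_diff W W' C s : (forall i, `|W i - W' i| <= C * weight i) ->
  `|(ode_state W s - ode_state W' s, (field W 0 s).2 - (field W' 0 s).2)| <=
  kap * C * expR (depth_rate * s).
Proof.
move=> h; have C0 : 0 <= C.
  by have := le_trans (normr_ge0 _) (h (SV n (0, s))); rewrite pmulr_lge0// weight_gt0.
have e0 := expR_ge0 (depth_rate * s).
rewrite prod_norm_le; apply/andP; split => /=.
  by rewrite (le_trans (state_diff s C0 h))// ler_wpM2r// -[leLHS]mul1r ler_wpM2r.
by have := h (SV n (0, s)); rewrite /= depth0 mulrCA mulrA.
Qed.

Lemma field_bound W C x s : (forall i, `|W i| <= C * weight i) ->
  `|field W x s| <= kap ^+ 2 * C * expR (depth_rate * depth (x, s)).
Proof.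
move=> h; have := @field_diff W (fun=> 0) C x s.
rewrite (_ : field (fun=> 0) x s = 0)// subr0; apply => i; rewrite subr0; exact: h.
Qed.

Lemma boundary_bound W C s : (forall i, `|W i| <= C * weight i) ->
  `|(ode_state W s, (field W 0 s).2)| <= kap * C * expR (depth_rate * s).
Proof.
move=> h; have := @boundary_diff W (fun=> 0) C s.
rewrite (_ : ode_state (fun=> 0) s = 0); last by apply/colP => i; rewrite !mxE.
rewrite /= !subr0; apply => i; rewrite subr0; exact: h.
Qed.

Lemma field_path W (a b : R) (c : R -> R) (T : R) : good W -> 0 <= a -> b <= 1 ->
  measurable_fun `[a, b]%classic c -> (forall x, a <= x <= b -> c x <= T) ->
  bounded_path a b (fun x => field W x (c x)).
Proof.
move=> [mU mV _ [C hC]] a0 b1 mc cT.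
have mxc : measurable_fun `[a, b]%classic (fun x => (x, c x)).
  by apply: measurable_fun_pair_on.
split.
- exact: (measurableT_comp mU mxc).
- exact: (measurableT_comp mV mxc).
exists (kap ^+ 2 * `|C| * expR (depth_rate * (T + 2 * tau))) => x xab.
have C0 : 0 <= kap ^+ 2 * C.
  rewrite mulr_ge0 ?exprn_ge0 ?(ltW k0)//.
  by have := le_trans (normr_ge0 _) (hC (SV n (x, x))); rewrite pmulr_lge0// weight_gt0.
apply: (le_trans (field_bound _ _ hC)); apply: ler_pM => //; rewrite ?expR_ge0//.
  by rewrite ler_wpM2l ?ler_norm// exprn_ge0// ltW.
rewrite ler_expR; apply: (ler_wpM2l (ltW A0)); have /andP[ax xb] := xab.
have x01 : 0 <= x <= 1 by rewrite (le_trans a0 ax) (le_trans xb).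
by rewrite (le_trans (depth_le _ x01))// lerD2r cT.
Qed.

Lemma field_path_u W a b c : good W -> 0 <= a -> b <= 1 ->
  bounded_path a b (fun x => field W x (c + Gu x)).
Proof.
move=> gW a0 b1; apply: (@field_path W a b (fun x => c + Gu x) (c + Gu 1)) => //.
  apply: measurable_funD => //.
  by apply: measurable_funS (measurable_travel su) => //; exact: sub_itvcc.
move=> x /andP[ax xb]; rewrite lerD2l (travel_le su)//.
by rewrite (le_trans a0) ?(le_trans xb).
Qed.

Lemma field_path_v W a b r : good W -> 0 <= a -> b <= 1 ->
  bounded_path a b (fun x => field W x (r - Gv x)).
Proof.
move=> gW a0 b1; apply: (@field_path W a b (fun x => r - Gv x) r) => //.
  apply: measurable_funB => //.
  by apply: measurable_funS (measurable_travel sv) => //; exact: sub_itvcc.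
move=> x /andP[ax xb]; rewrite gerBl (travel_ge0 sv)//.
by rewrite (le_trans a0 ax) (le_trans xb).
Qed.

Lemma good_boundary W : good W ->
  [/\ forall j, measurable_fun setT (fun s => ode_state W s j 0),
      measurable_fun setT (fun s => (field W 0 s).2)
    & exists2 C, 0 <= C & forall s, `|ode_state W s| <= C * expR (depth_rate * s) /\
        `|(field W 0 s).2| <= C * expR (depth_rate * s)].
Proof.
move=> [mU mV mX [C hC]]; split.
- move=> j; apply: (@eq_measurable_fun _ _ _ _ _ (fun s => W (SX s j))) => //.
  by move=> s _; rewrite mxE.
- apply: (measurableT_comp mV); apply: measurable_fun_pair_on => //.
have C0 : 0 <= C.
  by have := le_trans (normr_ge0 _) (hC (SV n (0, 0))); rewrite pmulr_lge0// weight_gt0.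
exists (kap * C) => [|s]; first by rewrite mulr_ge0// ltW.
by have := boundary_bound s hC; rewrite prod_norm_le => /andP[].
Qed.

Lemma integrable_ode_state W i b : good W ->
  mu.-integrable `[0, b]
    (EFin \o (fun r => f0 P (ode_state W r) (field W 0 r).2 r i 0)).
Proof.
move=> /good_boundary[mX mv [C C0 hC]].
apply: (@integrable_f0_comp _ _ _ _ _ _ reg 0 b (ode_state W) (fun r => (field W 0 r).2) i
  (C * expR (depth_rate * b))) => //.
- by move=> j; exact: measurable_funTS.
- exact: measurable_funTS.
move=> t /andP[t0 tb]; have [h1 h2] := hC t.
have tb' : C * expR (depth_rate * t) <= C * expR (depth_rate * b).
  by rewrite (ler_wpM2l C0)// ler_expR (ler_wpM2l (ltW A0)).
by rewrite (le_trans h1)// (le_trans h2).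
Qed.

Lemma u_foot_itv p : in_halfstrip p -> 0 <= u_foot P 0 p.1 p.2 <= p.1.
Proof.
case: p => x s /andP[/= x01 s0]; have /andP[x0 x1] := x01.
have [c0|c0] := leP (s - Gu x) 0; first by have [] := u_footP reg x01 s0 c0.
by rewrite /u_foot sub0r (travel_inv_neg su) ?oppr_lt0// lexx.
Qed.

Lemma depth_rate_small C : 0 <= C -> L * (kap ^+ 2 * C) / depth_rate <= C / 4.
Proof.
move=> C0; have k2 : 0 <= kap ^+ 2 by rewrite exprn_ge0// ltW.
rewrite ler_pdivrMr// /depth_rate; have := mulr_ge0 (mulr_ge0 L0 k2) C0.
by move: C0; lra.
Qed.

(** Of the factor 1 / 2, one half pays for the integral, by the choice of
    [depth_rate], and the other for the entry value at [x = 0], by the powers of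
    [kap] in the weight. *)
Lemma solution_map_contraction W W' C : good W -> good W' -> 0 <= C ->
  (forall i, `|W i - W' i| <= C * weight i) ->
  forall i, `|solution_map W i - solution_map W' i| <= C / 2 * weight i.
Proof.
move=> gW gW' C0 h i.
have triv : 0 <= C / 2 * weight i by rewrite mulr_ge0 ?divr_ge0// ltW// weight_gt0.
have k0' := ltW k0; have k20 : 0 <= kap ^+ 2 by rewrite exprn_ge0.
have k2C : 0 <= kap ^+ 2 * C by rewrite mulr_ge0.
have k21 : 1 <= kap ^+ 2 by rewrite exprn_ege1.
have kk2 : kap <= kap ^+ 2 by rewrite expr2 -[leLHS]mulr1 ler_wpM2l.
have small := depth_rate_small C0; have Lk : L <= kap / 4 := L_kappa L.
case: i triv => [[x s]|[x s]|s i] triv; rewrite /solution_map.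
- case: ifPn => [hs|_]; last by rewrite subrr normr0.
  have /andP[/= x01 s0] := hs; have /andP[x0 x1] := x01.
  rewrite /u_step /=; set c := s - Gu x; set y := u_foot P 0 x s.
  have yx : 0 <= y <= x := u_foot_itv hs; have /andP[y0 _] := yx.
  pose E := expR (depth_rate * depth (x, s)); have E0 : 0 <= E := expR_ge0 _.
  have entry : `|u_entry W (x, s) - u_entry W' (x, s)| <= kap ^+ 2 / 4 * (C * E).
    rewrite /u_entry /= -/c; case: ifPn => [c0|_]; last first.
      by rewrite subrr normr0 !mulr_ge0// invr_ge0.
    apply: (le_trans (reg_g0 reg (ltW c0) _ _ _ _)).
    apply: (le_trans (ler_wpM2l L0 (boundary_diff c h))).
    have cE : expR (depth_rate * c) <= E.
      rewrite ler_expR (ler_wpM2l (ltW A0))// (le_trans _ (depth_ge s x01))//.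
      by rewrite gerBl (travel_ge0 su).
    apply: (@le_trans _ _ (L * (kap * C * E))).
      by apply: (ler_wpM2l L0); apply: ler_wpM2l => //; rewrite mulr_ge0.
    have -> : kap ^+ 2 / 4 * (C * E) = kap / 4 * (kap * C * E) by ring.
    by apply: ler_wpM2r => //; rewrite !mulr_ge0.
  have int : `|\int[mu]_(xi in `[y, x]) (fu P xi (field W xi (c + Gu xi)) / lamu P xi) -
      \int[mu]_(xi in `[y, x]) (fu P xi (field W' xi (c + Gu xi)) / lamu P xi)| <= C / 4 * E.
    have -> : E = expR (depth_rate * (depth (x, s) - Gu x + Gu x)) by rewrite subrK.
    apply: le_trans (ler_wpM2r (expR_ge0 _) small).
    apply: (@flux_diff_growth _ _ _ su _ _ L0 (reg_fu reg) y x _ _ depth_rate (kap ^+ 2 * C)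
      (depth (x, s) - Gu x) yx x1 A0 k2C).
    + exact: field_path_u.
    + exact: field_path_u.
    move=> xi /andP[yxi xix]; apply: (le_trans (field_diff xi (c + Gu xi) h)).
    apply: (ler_wpM2l k2C); rewrite ler_expR; apply: (ler_wpM2l (ltW A0)).
    by apply: depth_u => //; rewrite (le_trans y0).
  rewrite opprD addrACA (le_trans (ler_normD _ _))// (le_trans (lerD entry int))//.
  rewrite -/E; have : 1 * (C * E) <= kap ^+ 2 * (C * E) by rewrite ler_wpM2r// mulr_ge0.
  lra.
- case: ifPn => [hs|_]; last by rewrite subrr normr0.
  have /andP[/= x01 s0] := hs; have /andP[x0 x1] := x01.
  rewrite /v_step /=; set r := s + Gv x.
  have sE : s = r - Gv x by rewrite /r addrK.
  pose E := expR (depth_rate * depth (x, s)); have E0 : 0 <= E := expR_ge0 _.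
  have CE : C * E <= kap * (C * E) by rewrite -[leLHS]mul1r ler_wpM2r// mulr_ge0.
  have CE0 : 0 <= C * E by rewrite mulr_ge0.
  rewrite -/E; case: ifPn => [rtau|].
    have rtau' : s + Gv x <= 0 + tau by rewrite add0r.
    have [] := v_footP reg x01 s0 rtau'.
    set y := v_foot P 0 x s => /andP[xy y1] _.
    rewrite opprD addrACA subrr add0r.
    apply: (@le_trans _ _ (C / 4 * E)); last by move: CE CE0; lra.
    have -> : E = expR (depth_rate * (r - Gv x)) by rewrite /E sE depth_v_early.
    apply: le_trans (ler_wpM2r (expR_ge0 _) small).
    have xy' : 0 <= x <= y by rewrite x0.
    apply: (@flux_diff_decay _ _ _ sv _ _ L0 (reg_fv reg) x y _ _ depth_rate (kap ^+ 2 * C)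
      r xy' y1 A0 k2C).
    + exact: field_path_v.
    + exact: field_path_v.
    by move=> xi _; have := field_diff xi (r - Gv xi) h; rewrite depth_v_early.
  rewrite -ltNge => taur; have r0 : 0 <= r by rewrite ltW// (le_lt_trans tau0).
  have EE : E = expR (depth_rate * (r + Gv x)) by rewrite /E sE depth_v_late.
  have hK : `|K (ode_state W r) r - K (ode_state W' r) r| <= kap / 4 * (C * E).
    apply: (le_trans (reg_K reg r0 _ _)).
    apply: (le_trans (ler_wpM2l L0 (state_diff r C0 h))).
    apply: ler_pM => //; first by rewrite mulr_ge0// expR_ge0.
    apply: (ler_wpM2l C0); rewrite EE ler_expR; apply: (ler_wpM2l (ltW A0)).
    by rewrite lerDl (travel_ge0 sv).
  have int : `|\int[mu]_(xi in `[0, x]) (fv P xi (field W xi (r - Gv xi)) / lamv P xi) -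
      \int[mu]_(xi in `[0, x]) (fv P xi (field W' xi (r - Gv xi)) / lamv P xi)| <= C / 4 * E.
    rewrite EE; apply: le_trans (ler_wpM2r (expR_ge0 _) small).
    have x0x : (0 : R) <= 0 <= x by rewrite lexx.
    apply: (@flux_diff_growth _ _ _ sv _ _ L0 (reg_fv reg) 0 x _ _ depth_rate (kap ^+ 2 * C)
      r x0x x1 A0 k2C).
    + exact: field_path_v.
    + exact: field_path_v.
    by move=> xi _; have := field_diff xi (r - Gv xi) h; rewrite depth_v_late.
  rewrite opprD addrACA (le_trans (ler_normD _ _))//.
  rewrite -normrN opprD opprK in int; apply: (le_trans (lerD hK _)).
    by rewrite opprK; exact: int.
  by move: CE CE0; lra.
- case: ifPn => [s0|_]; last by rewrite subrr normr0.
  rewrite /X_step opprD addrACA subrr add0r.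
  apply: (@le_trans _ _ (C / 4 * expR (depth_rate * s))); last first.
    by rewrite ler_wpM2r ?expR_ge0//; move: C0; lra.
  have LkC : 0 <= L * (kap * C) by rewrite !mulr_ge0.
  have := integral_diff_growth (c := 0) s0 A0 LkC (integrable_ode_state i s gW)
    (integrable_ode_state i s gW').
  rewrite subr0 => H; apply: (le_trans (H _)).
    move=> r /andP[r0 _]; apply: (le_trans (f0_coord_lipschitz reg i r0 _ _ _ _)).
    by rewrite -mulrA subr0; apply: (ler_wpM2l L0); exact: boundary_diff.
  rewrite ler_wpM2r ?expR_ge0//; apply: le_trans small.
  rewrite ler_wpM2r ?invr_ge0 ?(ltW A0)//; apply: (ler_wpM2l L0).
  by rewrite ler_wpM2r.
Qed.

Lemma in_halfstripE : in_halfstrip @^-1` [set true] = @halfstrip R.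
Proof.
apply/seteqP; split => p; first by move=> /andP[].
by move=> [h1 h2]; apply/andP.
Qed.

Lemma measurable_in_halfstrip : measurable_fun setT in_halfstrip.
Proof.
by apply: (measurable_fun_bool true); rewrite setTI in_halfstripE; have [] := strH.
Qed.

Lemma measurable_if_halfstrip (f : R * R -> R) : measurable_fun (@halfstrip R) f ->
  measurable_fun setT (fun p => if in_halfstrip p then f p else 0).
Proof.
move=> mf; apply: measurable_fun_if => //; first exact: measurable_in_halfstrip.
by rewrite setTI in_halfstripE.
Qed.

Let mH : measurable (@halfstrip R) := strH.1.

Lemma measurable_u_origin : measurable_fun (@halfstrip R) (fun p => p.2 - Gu p.1).
Proof.
apply: measurable_funB; first exact: measurable_funTS.
apply: (measurable_comp01 (measurable_travel su)); first exact: measurable_funTS.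
by move=> p [].
Qed.

Lemma measurable_v_arrival : measurable_fun (@halfstrip R) (fun p => p.2 + Gv p.1).
Proof.
apply: measurable_funD; first exact: measurable_funTS.
apply: (measurable_comp01 (measurable_travel sv)); first exact: measurable_funTS.
by move=> p [].
Qed.

Lemma measurable_u_foot : measurable_fun (@halfstrip R) (fun p => u_foot P 0 p.1 p.2).
Proof.
apply: (measurableT_comp (measurable_travel_inv su measurableT)).
by apply: measurable_funB => //; exact: measurable_u_origin.
Qed.

Lemma measurable_v_foot : measurable_fun (@halfstrip R) (fun p => v_foot P 0 p.1 p.2).
Proof.
apply: (measurableT_comp (measurable_travel_inv sv measurableT)).
by apply: measurable_funB => //; exact: measurable_v_arrival.
Qed.

Lemma measurable_g0_boundary W : good W -> measurable_fun `[0 : R, +oo[%classic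
  (fun r => g0 P (ode_state W r) (field W 0 r).2 r).
Proof.
move=> /good_boundary[mX mv _].
apply: (@measurable_state_comp _ _ _ _ _ _ reg _ (g0 P)) => //.
- by move=> t /=; rewrite in_itv/= andbT.
- exact: (reg_g0m reg).
- exact: (reg_g0 reg).
- by move=> j; exact: measurable_funTS.
- exact: measurable_funTS.
Qed.

Lemma measurable_K_boundary W : good W -> measurable_fun `[0 : R, +oo[%classic
  (fun r => K (ode_state W r) r).
Proof.
move=> /good_boundary[mX _ _].
apply: (@measurable_state_comp _ _ _ _ _ _ reg _ (fun Y _ t => K Y t) _ (fun=> 0)) => //.
- by move=> t /=; rewrite in_itv/= andbT.
- by move=> Y _; exact: (reg_Km reg).
- move=> t t0 Y r Y' r'; apply: (le_trans (reg_K reg t0 Y Y')).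
  by rewrite ler_wpM2l// le_max lexx.
- by move=> j; exact: measurable_funTS.
Qed.

(** The operator preserves measurability in [(x, s)] because the integrals along
    the characteristics depend measurably on their end point. *)
Lemma measurable_flux_integral (lam : R -> R) (phi : R -> R * R -> R) W (D : set (R * R))
    (a b : R * R -> R) (ch : R * R -> R -> R) :
  speed lam l -> flux phi L -> good W -> measurable D ->
  measurable_fun D a -> measurable_fun D b ->
  (forall p, D p -> 0 <= a p /\ b p <= 1) ->
  (measurable_fun [set q : (R * R) * R | D q.1 /\ a q.1 <= q.2 <= b q.1]
     (fun q => ch q.1 q.2)) ->
  measurable_fun D (fun p => \int[mu]_(xi in `[a p, b p])
     (phi xi (field W xi (ch p xi)) / lam xi)).
Proof.
move=> slam fphi gW mD ma mb ab01 mch.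
have mE := measurable_between mD ma mb; have [mU mV _ _] := gW.
apply: (@measurable_integral_param _ _ R D a b
  (fun q => phi q.2 (field W q.2 (ch q.1 q.2)) / lam q.2)) => //.
have mpair : measurable_fun [set q : (R * R) * R | D q.1 /\ a q.1 <= q.2 <= b q.1]
    (fun q => (q.2, ch q.1 q.2)).
  by apply: measurable_fun_pair_on => //; exact: measurable_funTS.
apply: (@measurable_flux_comp _ _ _ slam _ _ L0 fphi _ _ _ snd
  (fun q => W (SU n (q.2, ch q.1 q.2))) (fun q => W (SV n (q.2, ch q.1 q.2)))) => //.
- exact: measurable_funTS.
- move=> q [Dq /andP[aq qb]]; have [a0 b1] := ab01 _ Dq.
  by rewrite (le_trans a0 aq) (le_trans qb).
- exact: (measurableT_comp mU mpair).
- exact: (measurableT_comp mV mpair).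
Qed.

Lemma measurable_u_step W : good W -> measurable_fun (@halfstrip R) (u_step W).
Proof.
move=> gW; apply: measurable_funD.
  apply: (measurable_fun_if mH).
  - apply: measurable_fun_ltr => //; exact: measurable_u_origin.
  - apply: (measurable_comp_ge0 (measurable_g0_boundary gW)).
      by apply: measurable_funS measurable_u_origin.
    by move=> p [_ /ltW].
  - have mq1 : measurable_fun I01 (fst \o q0) by exact: (measurableT_comp measurable_fst).
    apply: (measurable_comp01 mq1).
      by apply: measurable_funS measurable_u_foot.
    move=> p [Hp _]; have /andP[-> yp] : 0 <= u_foot P 0 p.1 p.2 <= p.1.
      by apply: u_foot_itv; apply/andP.
    by have [/andP[_ p1] _] := Hp; rewrite (le_trans yp).
apply: (@measurable_flux_integral (lamu P) (fu P) W (@halfstrip R)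
  (fun p => u_foot P 0 p.1 p.2) fst (fun p xi => p.2 - Gu p.1 + Gu xi)) => //.
- exact: reg_fu reg.
- exact: measurable_u_foot.
- exact: measurable_funTS.
- move=> p Hp; have /andP[y0 _] : 0 <= u_foot P 0 p.1 p.2 <= p.1.
    by apply: u_foot_itv; apply/andP.
  by have [/andP[_ p1] _] := Hp.
apply: measurable_funD.
  apply: (measurable_comp mH) measurable_u_origin _.
    by move=> _ [q [Hq _] <-].
  exact: measurable_funTS.
apply: (measurable_comp01 (measurable_travel su)); first exact: measurable_funTS.
move=> q [Hq /andP[aq qb]]; have /andP[y0 _] : 0 <= u_foot P 0 q.1.1 q.1.2 <= q.1.1.
  by apply: u_foot_itv; apply/andP.
by have [/andP[_ p1] _] := Hq; rewrite (le_trans y0 aq) (le_trans qb).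
Qed.

Lemma v_foot_itv p : halfstrip p -> p.2 + Gv p.1 <= tau ->
  p.1 <= v_foot P 0 p.1 p.2 <= 1.
Proof.
by case: p => x s [/= x01 s0] rt; have [|//] := v_footP reg x01 s0; rewrite add0r.
Qed.

Lemma measurable_v_step W : good W -> measurable_fun (@halfstrip R) (v_step W).
Proof.
move=> gW.
have mr (D : set (R * R)) : measurable D -> D `<=` @halfstrip R ->
    measurable_fun [set q : (R * R) * R | D q.1 /\ 0 <= q.2 <= 1]
      (fun q => q.1.2 + Gv q.1.1 - Gv q.2).
  move=> mD DH; apply: measurable_funB.
    apply: (measurable_comp mH) measurable_v_arrival _.
      by move=> _ [q [/DH Hq _] <-].
    exact: measurable_funTS.
  apply: (measurable_comp01 (measurable_travel sv)); first exact: measurable_funTS.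
  by move=> q [].
have sub (D : set (R * R)) (a b : R * R -> R) : measurable D -> D `<=` @halfstrip R ->
    (forall p, D p -> 0 <= a p /\ b p <= 1) ->
    measurable_fun [set q : (R * R) * R | D q.1 /\ a q.1 <= q.2 <= b q.1]
      (fun q => q.1.2 + Gv q.1.1 - Gv q.2).
  move=> mD DH ab; apply: measurable_funS (mr D mD DH).
    exact: (@measurable_between _ _ R D (fun=> 0) (fun=> 1) mD
      (@measurable_cst _ _ _ _ _ _) (@measurable_cst _ _ _ _ _ _)).
  move=> q [Dq /andP[aq qb]]; have [a0 b1] := ab _ Dq; split=> //.
  by rewrite (le_trans a0 aq) (le_trans qb).
have mle : measurable_fun (@halfstrip R) (fun p => p.2 + Gv p.1 <= tau).
  by apply: measurable_fun_ler => //; exact: measurable_v_arrival.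
have mD b : measurable (@halfstrip R `&` (fun p => p.2 + Gv p.1 <= tau) @^-1` [set b]).
  by apply: mle.
have DH b : @halfstrip R `&` (fun p => p.2 + Gv p.1 <= tau) @^-1` [set b] `<=` @halfstrip R.
  by move=> p [].
apply: (measurable_fun_if mH mle).
- have foot01 p : (@halfstrip R `&` (fun p => p.2 + Gv p.1 <= tau) @^-1` [set true]) p ->
      0 <= p.1 /\ v_foot P 0 p.1 p.2 <= 1.
    by move=> [Hp /(v_foot_itv Hp)/andP[_ ->]]; have [/andP[-> _] _] := Hp.
  apply: measurable_funD.
    have mq2 : measurable_fun I01 (snd \o q0) by exact: (measurableT_comp measurable_snd).
    apply: (measurable_comp01 mq2).
      by apply: measurable_funS measurable_v_foot.
    move=> p [Hp /(v_foot_itv Hp)/andP[xy ->]]; rewrite andbT (le_trans _ xy)//.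
    by have [/andP[]] := Hp.
  apply: (@measurable_flux_integral (lamv P) (fv P) W _
    fst (fun p => v_foot P 0 p.1 p.2) (fun p xi => p.2 + Gv p.1 - Gv xi)) => //.
  + exact: reg_fv reg.
  + exact: measurable_funTS.
  + by apply: measurable_funS measurable_v_foot.
  + exact: (sub _ fst (fun p => v_foot P 0 p.1 p.2)).
- have late01 p : (@halfstrip R `&` (fun p => p.2 + Gv p.1 <= tau) @^-1` [set false]) p ->
      (0 : R) <= 0 /\ p.1 <= 1.
    by move=> [[/andP[_ ->] _] _].
  apply: measurable_funB.
    apply: (measurable_comp_ge0 (measurable_K_boundary gW)).
      by apply: measurable_funS measurable_v_arrival.
    by move=> p [[p01 p0] _]; rewrite addr_ge0// (travel_ge0 sv).
  apply: (@measurable_flux_integral (lamv P) (fv P) W _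
    (fun=> 0) fst (fun p xi => p.2 + Gv p.1 - Gv xi)) => //.
  + exact: reg_fv reg.
  + exact: measurable_funTS.
  + exact: (sub _ (fun=> 0) fst).
Qed.

Lemma measurable_X_step W i : good W ->
  measurable_fun `[0 : R, +oo[%classic (X_step W ^~ i).
Proof.
move=> gW; have [mX mv _] := good_boundary gW.
have mh : measurable_fun `[0 : R, +oo[%classic
    (fun r => f0 P (ode_state W r) (field W 0 r).2 r i 0).
  apply: (@measurable_state_comp _ _ _ _ _ _ reg _ (fun Y r t => f0 P Y r t i 0)) => //.
  - by move=> t /=; rewrite in_itv/= andbT.
  - by move=> Y r; exact: (reg_f0m reg).
  - by move=> t t0 Y r Y' r'; exact: (f0_coord_lipschitz reg).
  - by move=> j; exact: measurable_funTS.
  - exact: measurable_funTS.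
apply: measurable_funD; first exact: measurable_cst.
apply: (@measurable_integral_param _ _ R _ (fun=> 0) id
  (fun q => f0 P (ode_state W q.2) (field W 0 q.2).2 q.2 i 0)) => //.
apply: (measurable_comp_ge0 mh); first exact: measurable_funTS.
by move=> q [_ /andP[]].
Qed.

Lemma good0 : good (fun=> 0).
Proof.
split=> [||i|]; [exact: measurable_cst|exact: measurable_cst|exact: measurable_cst|].
by exists 0 => i; rewrite normr0 mul0r.
Qed.

Lemma solution_map0_bound : exists C, forall i, `|solution_map (fun=> 0) i| <= C * weight i.
Proof.
have [M hM] := bq0; pose C := `|M| + `|X0|; have C0 : 0 <= C by rewrite addr_ge0.
have k0' := ltW k0; have k21 : 1 <= kap ^+ 2 by rewrite exprn_ege1.
have fE x s : field (fun=> 0) x s = 0 by [].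
have sE s : ode_state (fun=> 0) s = 0 by apply/colP => i; rewrite !mxE.
have e1 (r : R) : 0 <= r -> 1 <= expR (depth_rate * r).
  by move=> r0; rewrite -[leLHS]expR0 ler_expR mulr_ge0// ltW.
have d1 p : in_halfstrip p -> 1 <= expR (depth_rate * depth p).
  case: p => x s /andP[/= x01 s0]; apply: e1.
  exact: le_trans (depth_ge s x01).
have MC : M <= C by rewrite (le_trans (ler_norm M))// lerDl.
have qC y : 0 <= y <= 1 -> `|(q0 y).1| <= C /\ `|(q0 y).2| <= C.
  by move=> /hM; rewrite prod_norm_le => /andP[h1 h2]; rewrite (le_trans h1)// (le_trans h2).
exists C => i; have triv : 0 <= C * weight i by rewrite mulr_ge0// ltW// weight_gt0.
case: i triv => [[x s]|[x s]|s i] triv; rewrite /solution_map.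
- case: ifPn => [hs|_]; last by rewrite normr0.
  have w1 : C <= C * weight (SU n (x, s)).
    by rewrite -[leLHS]mulr1 ler_wpM2l//= -[leLHS]mulr1 ler_pM// d1.
  have /andP[/= x01 s0] := hs; have /andP[x0 x1] := x01.
  have /andP[y0 yx] := u_foot_itv hs.
  rewrite /u_step/= (integral_flux0 _ (reg_fu reg))// addr0 /u_entry/=.
  case: ifPn => [c0|_]; first by rewrite sE (reg_g00 reg) ?(ltW c0)// normr0.
  by apply: le_trans w1; have [] := qC (u_foot P 0 x s); rewrite ?y0 ?(le_trans yx).
- case: ifPn => [hs|_]; last by rewrite normr0.
  have w1 : C <= C * weight (SV n (x, s)).
    by rewrite -[leLHS]mulr1 ler_wpM2l//= -[leLHS]mulr1 ler_pM// d1.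
  have /andP[/= x01 s0] := hs; have /andP[x0 x1] := x01.
  rewrite /v_step/=; case: ifPn => [rt|].
    have /andP[/= xy y1] : x <= v_foot P 0 x s <= 1 by exact: (@v_foot_itv (x, s)).
    rewrite (integral_flux0 _ (reg_fv reg))// addr0; apply: le_trans w1.
    by have [] := qC (v_foot P 0 x s); rewrite ?y1 ?(le_trans x0).
  rewrite -ltNge => tr; rewrite (integral_flux0 _ (reg_fv reg))// subr0 sE.
  by rewrite (reg_K0 reg) ?normr0// ltW// (le_lt_trans tau0).
- case: ifPn => [s0|_]; last by rewrite normr0.
  rewrite /X_step (@eq_integral_itv _ _ _ _ (fun=> 0)); last first.
    by move=> r /andP[r0 _]; rewrite ?fE sE (reg_f00 reg r0) mxE.
  rewrite integral_itv_cst// mul0r addr0 (le_trans (colvec_norm_ge _ _))//.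
  apply: (@le_trans _ _ C); first by rewrite /C lerDr.
  by rewrite -[leLHS]mulr1 ler_wpM2l//= e1.
Qed.

Lemma good_solution_map W : good W -> good (solution_map W).
Proof.
move=> gW; split.
- exact: (measurable_if_halfstrip (measurable_u_step gW)).
- exact: (measurable_if_halfstrip (measurable_v_step gW)).
- move=> i.
  have mge0 : measurable_fun [set: R] (fun s : R => 0 <= s) by exact: measurable_fun_ler.
  apply: measurable_fun_if => //; rewrite setTI.
    apply: measurable_funS (measurable_X_step i gW) => // s /= s0.
    by rewrite in_itv/= s0.
have [C hC] := solution_map0_bound; have [_ _ _ [C' hC']] := gW.
have C'0 : 0 <= `|C'| by [].
have h i : `|W i - (fun=> 0) i| <= `|C'| * weight i.
  rewrite subr0 (le_trans (hC' i))// ler_wpM2r ?ler_norm// ltW//.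
  exact: weight_gt0.
exists (C + `|C'| / 2) => i.
rewrite -(subrK (solution_map (fun=> 0) i) (solution_map W i)) addrC.
rewrite (le_trans (ler_normD _ _))// mulrDl lerD//.
exact: (solution_map_contraction gW good0 C'0 h).
Qed.

Lemma solution_map_fixed_point : exists W, good W /\ forall i, solution_map W i = W i.
Proof.
have [C hC] := solution_map0_bound.
apply: (weighted_fixed_point weight_gt0 good0 good_solution_map _ hC).
  move=> w W C' gw wC wW; split.
  - by apply: (measurable_fun_cvg (h := fun k p => w k (SU n p))) => [k|p _];
      [have [] := gw k|exact: wW].
  - by apply: (measurable_fun_cvg (h := fun k p => w k (SV n p))) => [k|p _];
      [have [] := gw k|exact: wW].
  - by move=> i; apply: (measurable_fun_cvg (h := fun k s => w k (SX s i))) => [k|s _];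
      [have [] := gw k|exact: wW].
  by exists C' => i; exact: (norm_limit_le (fun k => wC k i) (wW i)).
by move=> W W' C' gW gW' C'0 h; exact: solution_map_contraction.
Qed.

Section fixed_point.
Variable W : slot R n -> R.
Hypothesis gW : good W.
Hypothesis fixW : forall i, solution_map W i = W i.
Local Notation w := (field W).
Local Notation X := (ode_state W).

Lemma fixed_u x s : @halfstrip R (x, s) -> (w x s).1 = u_step W (x, s).
Proof.
move=> xs; rewrite /field/= -[LHS]fixW /=.
by rewrite (_ : in_halfstrip (x, s)) //; apply/andP.
Qed.

Lemma fixed_v x s : @halfstrip R (x, s) -> (w x s).2 = v_step W (x, s).
Proof.
move=> xs; rewrite /field/= -[LHS]fixW /=.
by rewrite (_ : in_halfstrip (x, s)) //; apply/andP.
Qed.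

Lemma fixed_v_late x r : 0 <= x <= 1 -> tau < r -> (w x (r - Gv x)).2 =
  K (X r) r - \int[mu]_(xi in `[0, x]) (fv P xi (w xi (r - Gv xi)) / lamv P xi).
Proof.
move=> x01 taur; have /andP[x0 x1] := x01.
rewrite fixed_v /v_step/= ?subrK; first by rewrite leNgt taur.
split=> //=; rewrite subr_ge0 (le_trans _ (ltW taur))// (travel_le sv)// x0.
Qed.

Lemma fixed_X s i : 0 <= s -> X s i 0 = X_step W s i.
Proof. by move=> s0; rewrite mxE -[LHS]fixW /= s0. Qed.

Lemma fixed_initial x : 0 <= x <= 1 -> w x 0 = q0 x.
Proof.
move=> x01; have Hx : @halfstrip R (x, 0) by split.
rewrite [LHS]surjective_pairing [RHS]surjective_pairing; congr pair.
  rewrite fixed_u// /u_step /u_entry /u_foot/= !sub0r opprK (travelK su)//.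
  by rewrite integral_itv_point addr0 oppr_gt0 ltNge (travel_ge0 su).
have /andP[x0 x1] := x01.
rewrite fixed_v// /v_step /v_foot/= add0r subr0 (travelK sv)//.
by rewrite integral_itv_point addr0 (travel_le sv)// x0.
Qed.

Lemma fixed_X_lipschitz (T : R) : exists M, forall x y, 0 <= x -> x <= y -> y <= T ->
  `|X x - X y| <= M * `|x - y|.
Proof.
have [mX mv [C C0 hC]] := good_boundary gW.
pose M := L * (C * expR (depth_rate * T)).
have M0 : 0 <= M by rewrite !mulr_ge0// expR_ge0.
exists M => x y x0 xy yT; apply: colvec_norm_le => [|i].
  by rewrite mulr_ge0.
have -> : `|x - y| = y - x by rewrite distrC ger0_norm// subr_ge0.
have -> : (X x - X y) i 0 = X x i 0 - X y i 0 by rewrite !mxE.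
rewrite (fixed_X i x0) (fixed_X i (le_trans x0 xy)) /X_step opprD addrACA subrr add0r.
rewrite distrC; apply: integral_increment_le; first by rewrite x0.
  exact: integrable_ode_state.
move=> r /andP[xr ry]; have r0 := le_trans x0 xr.
rewrite (le_trans (colvec_norm_ge _ _))// (le_trans (f0_le reg _ _ r0))//.
apply: (ler_wpM2l L0); have [h1 h2] := hC r; rewrite ge_max.
have e : C * expR (depth_rate * r) <= C * expR (depth_rate * T).
  by rewrite (ler_wpM2l C0)// ler_expR (ler_wpM2l (ltW A0))// (le_trans ry).
by rewrite (le_trans h1 e) (le_trans h2 e).
Qed.

Lemma fixed_ode : ode_solution [set s | @halfstrip R (0, s)] 0
  (fun s => f0 P (X s) (w 0 s).2 s) X.
Proof.
split.
  apply: locally_lipschitz_within_continuous => x [/= _ x0].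
  have [M hM] := fixed_X_lipschitz (x + 1); exists M => y [/= _ y0] xy1.
  have yx1 : y <= x + 1.
    by move: xy1; rewrite distrC => /ltW/(le_trans (ler_norm _)); rewrite lerBlDl.
  have [xy|/ltW yx] := leP x y; first exact: hM.
  by rewrite distrC (distrC x); apply: hM; rewrite // lerDl.
move=> s [/= _ s0] i; rewrite (fixed_X i s0) (fixed_X i (lexx 0)) /X_step.
by rewrite integral_itv_point addr0.
Qed.

(** Two points of one characteristic have the same foot and the same entry
    value, so that the difference of their values is the integral in between. *)
Lemma fixed_broad : broad_solution P (@halfstrip R) 0 w X.
Proof.
have [mU mV _ [C hC]] := gW; split.
- split.
    apply: measurable_funTS.
    rewrite (_ : (fun p => w p.1 p.2) = (fun p => (W (SU n p), W (SV n p)))).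
      exact: measurable_fun_pair.
    by apply/funext => -[x s].
  move=> T; exists (kap ^+ 2 * `|C| * expR (depth_rate * (T + 2 * tau))) => x s [/= x01 s0] sT.
  apply: (le_trans (field_bound _ _ hC)).
  have k20 : 0 <= kap ^+ 2 by rewrite exprn_ge0// ltW.
  apply: (@le_trans _ _ (kap ^+ 2 * `|C| * expR (depth_rate * depth (x, s)))).
    by apply: ler_wpM2r; [exact: expR_ge0|rewrite ler_wpM2l// ler_norm].
  apply: ler_wpM2l; first by rewrite mulr_ge0.
  rewrite ler_expR; apply: (ler_wpM2l (ltW A0)).
  by rewrite (le_trans (depth_le _ x01))// lerD2r.
- move=> x s y xs yx ch yOm; have /andP[y0 yx'] := yx; have [/= /andP[x0 x1] s0] := xs.
  have chE xi : y <= xi <= x -> ch xi = s - Gu x + Gu xi.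
    by move=> /andP[yxi xix]; rewrite /ch (travelE su) ?(le_trans y0)//; ring.
  clearbody ch.
  rewrite (@eq_integral_itv _ y x _
    (fun xi => fu P xi (w xi (s - Gu x + Gu xi)) / lamu P xi)); last by move=> xi /chE ->.
  move: yOm; rewrite chE ?lexx// => yOm.
  have cE : s - Gu x + Gu y - Gu y = s - Gu x by rewrite addrK.
  rewrite (fixed_u xs : W (SU n (x, s)) = _).
  rewrite (fixed_u yOm : W (SU n (y, s - Gu x + Gu y)) = _).
  rewrite /u_step /u_entry /u_foot/= cE -addrA; congr (_ + _).
  have /= /andP[f0 fy] := @u_foot_itv (y, s - Gu x + Gu y) (introT andP yOm).
  rewrite /u_foot cE in f0 fy.
  apply: integral_itv_split; first by rewrite fy.
  apply: (integrable_flux su L0 (reg_fu reg)) => //.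
  exact: field_path_u.
- move=> x s y xs xy ch yOm; have /andP[xy' y1] := xy; have [/= /andP[x0 x1] s0] := xs.
  have chE xi : x <= xi <= y -> ch xi = s + Gv x - Gv xi.
    move=> /andP[xxi xiy].
    by rewrite /ch (travelE sv); [ring|exact/andP|exact: le_trans y1].
  clearbody ch.
  rewrite (@eq_integral_itv _ x y _
    (fun xi => fv P xi (w xi (s + Gv x - Gv xi)) / lamv P xi)); last by move=> xi /chE ->.
  move: yOm; rewrite chE ?lexx ?andbT// => yOm.
  have rE : s + Gv x - Gv y + Gv y = s + Gv x by rewrite subrK.
  have int a b : 0 <= a -> b <= 1 -> mu.-integrable `[a, b]
      (EFin \o (fun xi => fv P xi (w xi (s + Gv x - Gv xi)) / lamv P xi)).
    move=> a0 b1; apply: (integrable_flux sv L0 (reg_fv reg)) => //.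
    exact: field_path_v.
  have yv := @v_foot_itv _ yOm.
  rewrite (fixed_v xs : W (SV n (x, s)) = _).
  rewrite (fixed_v yOm : W (SV n (y, s + Gv x - Gv y)) = _).
  rewrite /v_step /v_foot/= rE.
  rewrite /v_foot/= rE in yv.
  case: ifPn => [/yv/andP[yf f1]|_].
    rewrite (@integral_itv_split _ x y (travel_inv (lamv P) (s + Gv x - 0))) ?xy'//.
      by ring.
    exact: int.
  rewrite (@integral_itv_split _ 0 x y) ?x0//; first by ring.
  exact: int.
- exact: fixed_ode.
- move=> s Hs s_gt0; rewrite (fixed_u Hs).
  rewrite /u_step /u_entry /u_foot/= travel00 subr0 s_gt0 sub0r.
  by rewrite (travel_inv_neg su) ?oppr_lt0// integral_itv_point addr0.
Qed.

(** For the solution of the fixed point problem the prediction at time [t] is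
    the solution itself, so that only a solution [V] of the design equation
    along the last characteristic of the determinate set has to be supplied. *)
Lemma fixed_feedback t (V : R -> R) : 0 <= t -> {within I01, continuous V} ->
  (forall x, 0 <= x <= 1 -> V x = K (X (t + tau)) (t + tau) -
     \int[mu]_(xi in `[0, x]) (fv P xi ((w xi (t + tau - Gv xi)).1, V xi) / lamv P xi)) ->
  feedback P K t (w ^~ t) (X t) (V 1).
Proof.
move=> t0 cV VE; exists w, X, V; split=> //.
  apply: (broad_restrict reg t0); exact: fixed_broad.
have i0 : 0 <= (0 : R) <= 1 by rewrite lexx ler01.
move=> x x01; rewrite VE// (tau_vE reg) // travel00 subr0.
congr (_ - _); apply: eq_integral_itv => xi /andP[xi0 xix]; have /andP[_ x1] := x01.
by rewrite (tau_vE reg) ?xi0 ?(le_trans xix)// addrA.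
Qed.

(** At a positive time the trace of [v] itself solves the design equation, by
    the construction of [v_step], and the computed control is its value at
    [x = 1]. *)
Lemma fixed_feedback_gt0 t : 0 < t -> feedback P K t (w ^~ t) (X t) (w 1 t).2.
Proof.
move=> t0; pose V x := (w x (t + tau - Gv x)).2.
have -> : (w 1 t).2 = V 1 by rewrite /V addrK.
have tau_lt : tau < t + tau by rewrite ltrDr.
have VE x : 0 <= x <= 1 -> V x = K (X (t + tau)) (t + tau) -
    \int[mu]_(xi in `[0, x]) (fv P xi (w xi (t + tau - Gv xi)) / lamv P xi).
  by move=> x01; exact: fixed_v_late.
apply: fixed_feedback (ltW t0) _ _.
  apply: locally_lipschitz_within_continuous => x; rewrite /= in_itv/= => x01.
  have [M hM] := flux_integral_lipschitz sv L0 (reg_fv reg)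
    (field_path_v (t + tau) gW (lexx 0) (lexx 1)).
  exists M => y; rewrite in_itv/= => y01 _; rewrite !VE//.
  by rewrite opprD addrACA subrr add0r -opprD normrN; exact: hM.
by move=> x x01; rewrite VE.
Qed.

(** The last characteristic of the determinate set of time 0 carries initial
    data, which need not satisfy the design equation. *)
Lemma fixed_feedback0 : exists U0, feedback P K 0 (w ^~ 0) (X 0) U0.
Proof.
have [mu_ mv_ [M hM]] := field_path_v (0 + tau) gW (lexx 0) (lexx 1).
have [||V [cV VE]] := design_ode_exists reg (a := fun x => (w x (0 + tau - Gv x)).1)
  (K (X (0 + tau)) (0 + tau)); first exact: mu_.
  by exists M => x /hM; rewrite prod_norm_le => /andP[].
by exists (V 1); apply: fixed_feedback.
Qed.

End fixed_point.

Lemma trajectory_exists : exists z, closed_loop_traj P K (q0, X0) z.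
Proof.
have [W [gW fixW]] := solution_map_fixed_point.
exists (fun t => (field W ^~ t, ode_state W t)); split.
- exact: fixed_broad.
- by move=> x x01; exact: fixed_initial.
- by apply/colP => i; rewrite (fixed_X fixW)// /X_step integral_itv_point addr0.
have [U0 fU0] := fixed_feedback0 gW fixW.
exists (fun t => if 0 < t then (field W 1 t).2 else U0); split=> t t0; last by rewrite t0.
case: ifPn => [|]; first exact: fixed_feedback_gt0.
by rewrite -leNgt => t0'; rewrite (@le_anti _ _ t 0)// t0'.
Qed.

End existence.

(** * Global asymptotic stability of the closed loop *)

Theorem theorem5 (R : realType) (n : nat) (P : system R n)
    (K : 'cV[R]_n -> R -> R) (hmeas : measurable_data P K)
    (h1 : S1 P) (h2 : S2 P) (h3 : S3 P) (h4 : S4 P K) :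
  gas_origin (@admissible R n) (@state_norm R n) 0 (closed_loop_traj P K).
Proof.
have [L [l reg]] := regular_data hmeas h1 h2 h3 h4.
have [_ _ /(_ _ (tau_ge0 reg)) nominal_gas] := h4; split.
- exact: zero_trajectory reg.
- by move=> [q0 X0] [mq0 bq0]; exact: (trajectory_exists reg).
- exact: (closed_loop_stable reg nominal_gas).
- exact: (closed_loop_attractive reg nominal_gas).
Qed.
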